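(* Let $w,v$ be weights on $\mathbf{R}^n$ such that $w,w^{-\alpha},v^\beta\in L^1_{\rm loc}(\mathbf{R}^n)$ with some $\alpha>0$ and $\beta>1$. Assume that $$\max\biggl\{n\Bigl(\frac1\alpha+\frac1\beta\Bigr),\,1+\frac1\alpha\biggr\}\le p<n\Bigl(1+\frac1\alpha\Bigr),$$ and let $d\mu=w\,dx$ and $d\nu=v\,dx$. Then the embeddings $$W^{1,p}(\mathbf{R}^n,\mu)\hookrightarrow L^q(E,\nu)\quad\text{and}\quad D^p(\mathbf{R}^n,\mu)\cap L^1(E,\nu)\hookrightarrow L^q(E,\nu)$$ are compact for every bounded Lebesgue measurable set $E\subset\mathbf{R}^n$ and all exponents $$1\le q\le\frac{np(1-1/\beta)}{(n-p)+n/\alpha}.$$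
   Context: A weight is a nonnegative measurable function, with $w>0$ a.e. Here $W^{1,p}(\mathbf{R}^n,\mu)=\{u\in L^p(\mathbf{R}^n,\mu):|\nabla u|\in L^p(\mathbf{R}^n,\mu)\}$ and $D^p(\mathbf{R}^n,\mu)=\{u\in L^1_{\rm loc}(\mathbf{R}^n,\mu):|\nabla u|\in L^p(\mathbf{R}^n,\mu)\}$, where $\nabla u$ is the distributional gradient of $u$ (so that $u\in L^1_{\rm loc}(\mathbf{R}^n,dx)$ is implicit). The norms are $\|u\|_{L^p(\mathbf{R}^n,\mu)}+\|\nabla u\|_{L^p(\mathbf{R}^n,\mu)}$ on $W^{1,p}(\mathbf{R}^n,\mu)$ and $\|\nabla u\|_{L^p(\mathbf{R}^n,\mu)}+\|u\|_{L^1(E,\nu)}$ on $D^p(\mathbf{R}^n,\mu)\cap L^1(E,\nu)$. An embedding is compact if every bounded sequence has a subsequence converging in the target space. *)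

(* Defs.v *)
From HB Require Import structures.
From mathcomp Require Import all_boot all_order all_algebra.
From mathcomp Require Import all_classical all_reals all_analysis.
From mathcomp Require Import measurable_realfun.

Set Implicit Arguments.
Unset Strict Implicit.
Unset Printing Implicit Defensive.

Import Order.TTheory GRing.Theory Num.Theory.
Import numFieldNormedType.Exports.

Local Open Scope classical_set_scope.
Local Open Scope ring_scope.

Section lebesgue_outer.
Context {R : realType} {n : nat}.
Local Open Scope ereal_scope.

(* [None] encodes the empty box: in dimension 0 no half-open box is empty. *)
Definition box (c : option ('rV[R]_n * 'rV[R]_n)) : set 'rV[R]_n :=
  if c is Some (a, b) then
    [set x | forall i, (a ord0 i < x ord0 i <= b ord0 i)%R]
  else set0.

Definition box_volume (c : option ('rV[R]_n * 'rV[R]_n)) : \bar R :=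
  if c is Some (a, b) then
    (\prod_(i < n) Num.max 0 (b ord0 i - a ord0 i))%:E
  else 0.

Definition lebesgue_outer (A : set 'rV[R]_n) : \bar R :=
  ereal_inf [set \sum_(k <oo) box_volume (c k) |
             c in [set c : nat -> option ('rV[R]_n * 'rV[R]_n) |
                   A `<=` \bigcup_k box (c k)]].

Lemma box_volume_ge0 c : 0 <= box_volume c.
Proof.
case: c => [[a b]|//]; rewrite lee_fin; apply: prodr_ge0 => i _.
by rewrite le_max lexx.
Qed.

Lemma lebesgue_outer_ge0 A : 0 <= lebesgue_outer A.
Proof.
apply: le_ereal_inf_tmp => _ [c _ <-].
by apply: nneseries_ge0 => k _ _; exact: box_volume_ge0.
Qed.

Lemma lebesgue_outer0 : lebesgue_outer set0 = 0.
Proof.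
apply/eqP; rewrite eq_le lebesgue_outer_ge0 andbT.
apply: ereal_inf_lbound; exists (fun=> None) => //=.
by rewrite eseries0.
Qed.

Lemma le_lebesgue_outer : {homo lebesgue_outer : A B / A `<=` B >-> A <= B}.
Proof.
move=> A B AB; apply: ereal_inf_le_tmp => _ [c Bc <-].
by exists c => //; exact: subset_trans AB Bc.
Qed.

Lemma lebesgue_outer_sigma_subadditive : sigma_subadditive lebesgue_outer.
Proof.
move=> A; have [[i ioo]|] := pselect (exists i, lebesgue_outer (A i) = +oo).
  rewrite (eseries_pinfty _ _ ioo) ?leey// => k _.
  by rewrite -ltNye (lt_le_trans _ (lebesgue_outer_ge0 _)).
rewrite -forallNE => Aoo.
suff add2e (e : {posnum R}) : lebesgue_outer (\bigcup_k A k) <=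
    \sum_(i <oo) lebesgue_outer (A i) + e%:num%:E.
  by apply/lee_addgt0Pr => _/posnumP[].
rewrite (le_trans _ (epsilon_trick _ _ _))//; last first.
  by move=> k; exact: lebesgue_outer_ge0.
pose P k (c : nat -> option ('rV[R]_n * 'rV[R]_n)) :=
  A k `<=` \bigcup_j box (c j) /\ \sum_(j <oo) box_volume (c j) <=
    lebesgue_outer (A k) + (e%:num / (2 ^ k.+1)%:R)%:E.
have [G PG] : {G : nat -> nat -> _ & forall k, P k (G k)}.
  apply: (@choice _ _ P) => k.
  have en1 : (0 < e%:num / (2 ^ k.+1)%:R :> R)%R by [].
  have fA : lebesgue_outer (A k) \is a fin_num.
    by rewrite ge0_fin_numE ?lebesgue_outer_ge0// ltey; exact/eqP/Aoo.
  have [_ [c Ac <-] lec] := lb_ereal_inf_adherent en1 fA.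
  by exists c; split => //; exact/ltW.
have G_ge0 x : 0 <= (box_volume \o uncurry G) x by exact: box_volume_ge0.
apply: (@le_trans _ _ (\esum_(i in setT) (box_volume \o uncurry G) i)).
  apply: ereal_inf_lbound => /=.
  have /card_esym/ppcard_eqP[f] := card_nat2.
  exists (uncurry G \o f).
    move=> t [i _ /(PG i).1[j _ Gt]]; exists (f^-1%FUN (i, j)) => //=.
    by rewrite invK ?inE.
  rewrite -(esum_pred_image (box_volume \o uncurry G) _ xpredT)
    ?[fun=> _]set_true//.
  by rewrite image_eq.
rewrite (_ : esum _ _ = \sum_(i <oo) \sum_(j <oo) box_volume (G i j)).
  apply: lee_lim.
  - by apply: is_cvg_nneseries => i _ _; apply: nneseries_ge0 => j _ _;
      exact: box_volume_ge0.
  - by apply: is_cvg_nneseries => i _ _; apply: adde_ge0 => //;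
      exact: lebesgue_outer_ge0.
  - by near=> k; apply: lee_sum => i _; exact: (PG i).2.
pose J : nat -> set (nat * nat) := fun i => [set (i, j) | j in setT].
rewrite (_ : setT = \bigcup_k J k); last first.
  by rewrite predeqE => -[a b]; split => // _; exists a => //; exists b.
rewrite esum_bigcupT /=; last 2 first.
- apply/trivIsetP => i j _ _ ij.
  rewrite predeqE => -[k m] /=; split => //= -[] [_] _ [<-{k} _].
  by move=> [m' _] [] /esym/eqP; rewrite (negbTE ij).
- by move=> x; exact: G_ge0.
rewrite -(image_id [set: nat]) -fun_true esum_pred_image//; last first.
  by move=> k _; apply: esum_ge0 => x _; exact: (G_ge0 x).
apply: eq_eseriesr => /= j _.
rewrite -(esum_pred_image (box_volume \o uncurry G) (pair j) predT)//=.
- by congr esum; rewrite predeqE => -[a b]; split; move=> [i _ <-]; exists i.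
- by move=> i _; exact: (G_ge0 (j, i)).
- by move=> ? ? _ _; exact: (@can_inj _ _ _ snd).
Unshelve. all: by end_near. Qed.

HB.instance Definition _ := isOuterMeasure.Build R _ lebesgue_outer
  lebesgue_outer0 lebesgue_outer_ge0 le_lebesgue_outer
  lebesgue_outer_sigma_subadditive.

End lebesgue_outer.

(* From here on, [measurable] on 'rV_n means Lebesgue (not Borel) measurable. *)
HB.instance Definition _ (R : realType) (n : nat) :=
  Measurable.copy 'rV[R]_n (caratheodory_type (@lebesgue_outer R n)).

Definition lebesgue {R : realType} {n : nat} : set 'rV[R]_n -> \bar R :=
  lebesgue_outer.

HB.instance Definition _ (R : realType) (n : nat) :=
  isMeasure.Build _ 'rV[R]_n R lebesgue
    (@caratheodory_measure0 R _ (@lebesgue_outer R n))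
    (@caratheodory_measure_ge0 R _ (@lebesgue_outer R n))
    (@caratheodory_measure_sigma_additive R _ (@lebesgue_outer R n)).

Record weight (R : realType) (n : nat) := Weight {
  weight_fun :> 'rV[R]_n -> R ;
  weight_measurable : measurable_fun setT weight_fun ;
  weight_ge0 : forall x, 0 <= weight_fun x ;
  weight_gt0 : {ae @lebesgue R n, forall x, 0 < weight_fun x} }.

Section weighted_measure.
Context {R : realType} {n : nat} (w : weight R n).
Local Open Scope ereal_scope.

Definition weighted (A : set 'rV[R]_n) : \bar R :=
  \int[lebesgue]_(x in A) (w x)%:E.

Let weighted0 : weighted set0 = 0.
Proof. exact: integral_set0. Qed.

Let weighted_ge0 A : 0 <= weighted A.
Proof. by apply: integral_ge0 => x _; rewrite lee_fin weight_ge0. Qed.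

Let weighted_sigma_additive : semi_sigma_additive weighted.
Proof.
move=> F mF tF mUF; rewrite /weighted ge0_integral_bigcup//.
- apply: is_cvg_ereal_nneg_natsum => k _.
  by apply: integral_ge0 => x _; rewrite lee_fin weight_ge0.
- apply/measurable_EFinP; apply: measurable_funTS; exact: weight_measurable.
- by move=> x _; rewrite lee_fin weight_ge0.
Qed.

HB.instance Definition _ :=
  isMeasure.Build _ _ _ weighted weighted0 weighted_ge0 weighted_sigma_additive.

End weighted_measure.

Section sobolev.
Context {R : realType} {n : nat}.
Implicit Types (m : {measure set 'rV[R]_n -> \bar R}) (f u phi : 'rV[R]_n -> R).

Definition L1loc m f := measurable_fun setT f /\
  forall K, compact K -> (\int[m]_(x in K) `|f x|%:E < +oo)%E.

Definition partial (i : 'I_n) f : 'rV[R]_n -> R :=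
  fun x => 'D_(delta_mx ord0 i) f x.

Definition smooth f := forall s : seq 'I_n,
  let g := foldr partial f s in
  continuous g /\ forall x i, derivable g x (delta_mx ord0 i).

Definition test_function phi :=
  smooth phi /\ compact (closure [set x | phi x != 0]).

Definition is_weak_grad u (g : 'rV[R]_n -> 'rV[R]_n) := forall i : 'I_n,
  L1loc lebesgue (fun x => g x ord0 i) /\
  forall phi, test_function phi ->
    (\int[lebesgue]_x (u x * partial i phi x)%:E =
     - \int[lebesgue]_x (g x ord0 i * phi x)%:E)%E.

Definition weakly_differentiable u :=
  L1loc lebesgue u /\ exists g, is_weak_grad u g.

(* The weak gradient is determined almost everywhere only; [xget] selects a
   representative (and returns 0 if u has none). *)
Definition weak_grad u : 'rV[R]_n -> 'rV[R]_n :=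
  xget (fun=> 0) [set g | is_weak_grad u g].

(* Spelled out because the library norm on 'rV_n is the sup norm. *)
Definition abs_grad u : 'rV[R]_n -> R :=
  fun x => Num.sqrt (\sum_(i < n) weak_grad u x ord0 i ^+ 2).

Definition W1p (p : R) m : set ('rV[R]_n -> R) :=
  [set u | [/\ weakly_differentiable u, u \in Lfun m p%:E &
               abs_grad u \in Lfun m p%:E]].

Definition W1p_norm (p : R) m u : \bar R :=
  ('N[m]_p%:E[EFin \o u] + 'N[m]_p%:E[EFin \o abs_grad u])%E.

Definition Dp (p : R) m : set ('rV[R]_n -> R) :=
  [set u | [/\ weakly_differentiable u, L1loc m u &
               abs_grad u \in Lfun m p%:E]].

(* L^q(E, nu) and its norm, as the L^q space of the restriction of nu to E. *)
Definition LqE (q : R) m (E : set 'rV[R]_n) (mE : measurable E) :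
  set ('rV[R]_n -> R) := [set u | u \in Lfun (mrestr m mE) q%:E].

Definition LqE_norm (q : R) m (E : set 'rV[R]_n) (mE : measurable E) u :
  \bar R := 'N[mrestr m mE]_q%:E[EFin \o u].

Definition DpL1_norm (p : R) m1 m2 (E : set 'rV[R]_n) (mE : measurable E) u :
  \bar R := ('N[m1]_p%:E[EFin \o abs_grad u] + LqE_norm 1 m2 mE u)%E.

End sobolev.

(* Function spaces are sets of representatives with an extended-real-valued
   norm; the embedding sends (the class of) u in X to (the class of) u in Y. *)
Definition embedding (R : realType) (T : Type) (X Y : set (T -> R))
    (normX normY : (T -> R) -> \bar R) :=
  X `<=` Y /\ exists C : R, forall u, X u -> (normY u <= C%:E * normX u)%E.

Definition compact_embedding (R : realType) (T : Type) (X Y : set (T -> R))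
    (normX normY : (T -> R) -> \bar R) :=
  embedding X Y normX normY /\
  forall u : nat -> T -> R, (forall k, X (u k)) ->
    (exists C : R, forall k, (normX (u k) <= C%:E)%E) ->
    exists (s : nat -> nat) (l : T -> R), [/\ {homo s : i j / (i < j)%N}, Y l &
      (fun k => normY (u (s k) \- l)) @ \oo --> (0 : \bar R)].

(* Main.v *)
Require Import Defs.
From mathcomp Require Import all_boot all_order all_algebra.
From mathcomp Require Import all_classical all_reals all_analysis.
From mathcomp Require Import measurable_realfun ring lra.
Set Implicit Arguments.
Unset Strict Implicit.
Unset Printing Implicit Defensive.
Import Order.TTheory GRing.Theory Num.Theory.
Import numFieldNormedType.Exports.
Local Open Scope classical_set_scope.
Local Open Scope ring_scope.

(** Put s = p alpha / (1 + alpha). The inequalities 1 + 1/alpha <= p < n (1 + 1/alpha) say that 1 <=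
    s < n, so n >= 2. Let Q be a cube containing E. Young's inequality against the integrable
    function w^(-alpha) bounds the gradient of u in L^s(Q) by its weighted L^p norm, and the
    Sobolev-Poincaré inequality then bounds u minus its mean in L^st(Q), where st = n s / (n - s).
    The bound on q says that q beta / (beta - 1) <= st, so Young's inequality against v^beta gives
    the bound in L^q(E, nu). Both spaces enter through one class, [sobolev_family], which records a
    bound on the gradient in L^s(Q) and on the mean over Q. For W^(1,p) the mean is controlled by u
    in L^s(Q) ([W1p_family]). For D^p the oscillation is controlled in L^1(E, nu), hence so is the
    mean times nu(E) ([Dp_family]); this needs E of positive measure, and a null E is trivial.

    Compactness reaches the endpoint q beta / (beta - 1) = st because v^beta is one fixed integrable
    function. Rellich's theorem gives a subsequence converging almost everywhere to some l. Young's
    inequality bounds |u_k - l|^q v by t (|u_k - l|^st + 1) plus a multiple of v^beta, so the excess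
    over the first term tends to 0 in L^1 by dominated convergence, while the first term has an
    integral of order t ([weighted_cvg]).

    The unweighted inequalities are proved on grids. A cube is cut into equal cells and u is
    averaged over each against a smooth kernel. The kernels of two adjacent cells differ by a
    partial derivative of a test function ([partial_potential]), so the definition of the weak
    gradient itself bounds the difference of neighbouring averages ([avg_diff_le]). On the grid, the
    discrete Loomis-Whitney inequality gives a Gagliardo-Nirenberg inequality ([grid_sobolev1]) and,
    applied to a power, [grid_sobolev_poincare], with a constant independent of the mesh. The
    averages converge to u in L^1 ([step_avg_cvg]) and Fatou's lemma carries the inequalities over
    to u ([cube_limit]), which gives [poincare_cube] and [sobolev_poincare_cube]. Rellich's theorem
    ([rellich_ae]) follows from Poincaré's inequality on small cells: a bounded sequence is L^1
    close to its cell means, which are finitely many bounded numbers. *)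

(** * Inequalities for real powers *)

Section powR_inequalities.
Context {R : realType}.
Implicit Types (x y a b s t : R).

Lemma le_powR2 s x y : 0 <= s -> 0 <= x -> x <= y -> x `^ s <= y `^ s.
Proof.
by move=> s0 x0 xy; apply: ge0_ler_powR => //; rewrite nnegrE// (le_trans x0).
Qed.

Lemma powR_prod (I : Type) (r : seq I) (P : pred I) (E : I -> R) s :
  (forall i, P i -> 0 <= E i) ->
  \prod_(i <- r | P i) E i `^ s = (\prod_(i <- r | P i) E i) `^ s.
Proof.
move=> E0; elim: r => [|i r IH]; first by rewrite !big_nil powR1.
rewrite !big_cons; case: ifPn => // Pi.
by rewrite IH powRM ?E0// prodr_ge0.
Qed.

Lemma powRV x s : 0 <= x -> x^-1 `^ s = (x `^ s)^-1.
Proof.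
move=> x0; transitivity ((x `^ s) `^ (-1)); last by rewrite powR_inv1 ?powR_ge0.
by rewrite -(powR_inv1 x0) -!powRrM mulrC.
Qed.

(** Both bases are at most the larger of [a] and [b]. The sharp weights of Young's inequality are
    given up, since only the existence of constants matters. *)
Lemma powR_young a b t : 0 <= a -> 0 <= b -> 0 <= t <= 1 ->
  a `^ (1 - t) * b `^ t <= a + b.
Proof.
move=> a0 b0 /andP[t0 t1].
wlog ab : a b t a0 b0 t0 t1 / a <= b.
  move=> H; have [ab|ba] := leP a b; first exact: H.
  have := H b a (1 - t) b0 a0.
  rewrite subKr mulrC (addrC b); apply; rewrite ?subr_ge0//; last exact: ltW.
  by rewrite gerBl.
apply: (@le_trans _ _ b); last by rewrite lerDr.
have [b00|bn0] := eqVneq b 0.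
  rewrite b00 in ab *; have [->|tn0] := eqVneq t 0; last by rewrite powR0// mulr0.
  have -> : a = 0 by apply: le_anti; rewrite a0 andbT; move: ab; lra.
  by rewrite subr0 powRr1// powRr0 mulr1.
apply: (@le_trans _ _ (b `^ (1 - t) * b `^ t)).
  by rewrite ler_wpM2r ?powR_ge0// le_powR2// subr_ge0.
by rewrite -powRD ?bn0 ?implybT// subrK powRr1.
Qed.

(** The crude inequality for e a and e^(-(1-t)/t) b, in whose product the powers of [e] cancel. The
    free parameter later serves to absorb terms. *)
Lemma powR_young_eps a b t e : 0 <= a -> 0 <= b -> 0 < t <= 1 -> 0 < e ->
  a `^ (1 - t) * b `^ t <= e * a + e `^ (- ((1 - t) / t)) * b.
Proof.
move=> a0 b0 /andP[t0 t1] e0.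
have ea0 : 0 <= e * a by rewrite mulr_ge0// ltW.
have eb0 : 0 <= e `^ (- ((1 - t) / t)) * b by rewrite mulr_ge0// powR_ge0.
apply: le_trans (@powR_young _ _ t ea0 eb0 _); last by rewrite t1 ltW.
rewrite (powRM _ (ltW e0) a0) powRM ?powR_ge0// -powRrM mulNr divfK ?gt_eqF//.
have /(congr1 ( *%R^~ (a `^ (1 - t) * b `^ t))) : e `^ (1 - t) * e `^ (- (1 - t)) = 1.
  by rewrite -powRD ?subrr ?powRr0// ?(gt_eqF e0) ?implybT.
by rewrite mul1r mulrACA => ->.
Qed.

(** Convexity: x^s lies above its tangent at y. It is Young's inequality with exponents s and
    s/(s-1), and the source of the Jensen inequalities below. *)
Lemma powR_tangent s x y : 1 <= s -> 0 <= x -> 0 <= y ->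
  s * x * y `^ (s - 1) <= x `^ s + (s - 1) * y `^ s.
Proof.
rewrite le_eqVlt => /predU1P[<-|s1] x0 y0.
  by rewrite subrr powRr0 mul0r addr0 powRr1// mul1r mulr1.
have s0 : 0 < s by rewrite (lt_trans _ s1).
have q0 : 0 < s / (s - 1) by rewrite divr_gt0// subr_gt0.
have := @conjugate_powR _ x (y `^ (s - 1)) s (s / (s - 1)) x0
  (powR_ge0 _ _) s0 q0.
have sn0 : s != 0 by rewrite gt_eqF.
have s1n0 : s - 1 != 0 by rewrite subr_eq0 gt_eqF.
rewrite -powRrM mulrCA divff// mulr1.
have -> : s^-1 + (s / (s - 1))^-1 = 1 by field; rewrite sn0 s1n0.
move=> /(_ erefl) /(ler_wpM2l (ltW s0)).
rewrite mulrA => /le_trans; apply; rewrite mulrDr.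
by apply: lerD; rewrite le_eqVlt; apply/orP; left; apply/eqP; field;
  rewrite ?sn0 ?s1n0.
Qed.

(** The tangent at the larger of the two points bounds the difference; both powers are kept for
    symmetry. *)
Lemma powR_sub_le s x y : 1 <= s -> 0 <= x -> 0 <= y ->
  `|x `^ s - y `^ s| <= s * (x `^ (s - 1) + y `^ (s - 1)) * `|x - y|.
Proof.
move=> s1 x0 y0.
wlog xy : x y x0 y0 / y <= x.
  move=> H; have [yx|/ltW xy] := leP y x; first exact: H.
  by rewrite distrC (addrC (x `^ _)) (distrC x); apply: H.
have s0 : 0 <= s by rewrite (le_trans _ s1).
rewrite !ger0_norm ?subr_ge0//; last exact: le_powR2.
have H := powR_tangent s1 y0 x0.
have := mulr_ge0 (mulr_ge0 s0 (powR_ge0 y (s - 1))) (_ : 0 <= x - y).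
have -> : x `^ s = x * x `^ (s - 1).
  have [->|xn0] := eqVneq x 0.
    by rewrite mul0r powR0// gt_eqF// (lt_le_trans _ s1).
  rewrite -[X in X * _](powRr1 x0) -powRD ?xn0 ?implybT//.
  by congr (_ `^ _); ring.
rewrite subr_ge0 => /(_ xy).
move: H; have -> : x `^ s = x * x `^ (s - 1).
  have [->|xn0] := eqVneq x 0.
    by rewrite mul0r powR0// gt_eqF// (lt_le_trans _ s1).
  rewrite -[X in X * _](powRr1 x0) -powRD ?xn0 ?implybT//.
  by congr (_ `^ _); ring.
lra.
Qed.

Lemma powR_addr_le s x y : 0 <= s -> 0 <= x -> 0 <= y ->
  (x + y) `^ s <= 2 `^ s * (x `^ s + y `^ s).
Proof.
move=> s0 x0 y0; wlog xy : x y x0 y0 / x <= y.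
  move=> H; have [xy|/ltW xy] := leP x y; first exact: H.
  by rewrite addrC (addrC (x `^ _)); apply: H.
apply: (@le_trans _ _ ((2 * y) `^ s)).
  by apply: le_powR2 => //; rewrite ?addr_ge0// mulr_natl mulr2n lerD2r.
by rewrite powRM// ler_wpM2l ?powR_ge0// lerDr powR_ge0.
Qed.

Lemma powR_le1D s t x : 0 <= s -> s <= t -> 0 <= x -> x `^ s <= 1 + x `^ t.
Proof.
move=> s0 st x0; have [x1|x1] := leP x 1.
  apply: (@le_trans _ _ (1 `^ s)); first exact: le_powR2.
  by rewrite powR1 lerDl powR_ge0.
by rewrite (le_trans (ler_powR (ltW x1) st))// lerDr.
Qed.

(** Sum the tangent inequality at the mean [m]: the left side becomes s |I| m^s, of which (s-1) |I|
    m^s cancels. *)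
Lemma powR_jensen (I : finType) (f : I -> R) s : (0 < #|I|)%N -> 1 <= s ->
  (forall i, 0 <= f i) ->
  ((\sum_i f i) / #|I|%:R) `^ s <= (\sum_i f i `^ s) / #|I|%:R.
Proof.
move=> I0 s1 f0; set m := _ / _.
have N0 : 0 < #|I|%:R :> R by rewrite ltr0n.
have m0 : 0 <= m by rewrite divr_ge0 ?sumr_ge0// ltW.
rewrite ler_pdivlMr// mulrC.
have : \sum_i (s * f i * m `^ (s - 1)) <= \sum_i (f i `^ s + (s - 1) * m `^ s).
  by apply: ler_sum => i _; apply: powR_tangent.
rewrite big_split/= sumr_const -mulr_suml -mulr_sumr.
have -> : \sum_i f i = m * #|I|%:R by rewrite /m divfK// gt_eqF.
have -> : s * (m * #|I|%:R) * m `^ (s - 1) = s * #|I|%:R * m `^ s.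
  have [->|mn0] := eqVneq m 0.
    by rewrite mul0r mulr0 mul0r powR0 ?mulr0// gt_eqF// (lt_le_trans _ s1).
  have -> : m `^ s = m * m `^ (s - 1).
    rewrite -[X in X * _](powRr1 m0) -powRD ?mn0 ?implybT//.
    by congr (_ `^ _); ring.
  by ring.
rewrite -[(_ * m `^ s) *+ _]mulr_natr; move: (m `^ s) (#|I|%:R) => u N; lra.
Qed.

(** Hölder's inequality for |A| factors with equal exponents: normalise every sum to 1 and apply the
    arithmetic-geometric mean inequality term by term. *)
Lemma sum_prod_powR_le (I J : finType) (A : {pred J}) (x : J -> I -> R) :
  (0 < #|A|)%N -> (forall j i, 0 <= x j i) ->
  \sum_i \prod_(j in A) x j i `^ (#|A|%:R^-1) <=
  \prod_(j in A) (\sum_i x j i) `^ (#|A|%:R^-1).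
Proof.
move=> A0 x0; set c := #|A|%:R^-1.
have cn0 : c != 0 by rewrite invr_neq0// pnatr_eq0 -lt0n.
have c0 : 0 <= c by rewrite invr_ge0.
have X0 j : 0 <= \sum_i x j i by apply: sumr_ge0.
(* A vanishing sum kills its factor for every [i], so only positive sums have to be divided by. *)
have [[j jA Xj0]|nX0] := pselect (exists2 j, j \in A & \sum_i x j i = 0).
  rewrite big1 => [|i _]; first by rewrite prodr_ge0// => k _; rewrite powR_ge0.
  rewrite (bigD1 j)//=.
  have -> : x j i = 0.
    have /eqP : \sum_i x j i == 0 by apply/eqP.
    by move/eqP; rewrite psumr_eq0// => /allP/(_ i (mem_index_enum _))/eqP.
  by rewrite powR0// mul0r.
have Xp j : j \in A -> 0 < \sum_i x j i.
  by move=> jA; rewrite lt0r X0 andbT; apply/eqP => Xj; apply: nX0; exists j.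
pose P := \prod_(j in A) (\sum_i x j i) `^ c.
have P0 : 0 < P by apply: prodr_gt0 => j jA; rewrite powR_gt0// Xp.
rewrite -[leLHS](divfK (lt0r_neq0 P0)) -[leRHS]mul1r ler_pM2r//.
rewrite mulr_suml.
apply: (@le_trans _ _ (\sum_i (\sum_(j in A) x j i / (\sum_i x j i)) * c)).
  apply: ler_sum => i _.
  pose E j := x j i / \sum_i x j i.
  have E0 j : 0 <= E j by rewrite divr_ge0.
  have [+ _] := @leif_AGM _ _ A E (fun j _ => E0 j).
  rewrite -/c => H.
  have -> : (\prod_(j in A) x j i `^ c) / P = (\prod_(j in A) E j) `^ c.
    rewrite -powR_prod// /P -prodfV -big_split/=.
    apply: eq_bigr => j jA; rewrite /E powRM ?invr_ge0//; congr (_ * _).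
    by rewrite powRV.
  rewrite (le_trans (le_powR2 c0 _ H)) ?prodr_ge0//.
  rewrite -powR_mulrn ?mulr_ge0 ?sumr_ge0//.
  rewrite -powRrM divff ?pnatr_eq0 -?lt0n// powRr1// mulr_ge0// sumr_ge0//.
rewrite -mulr_suml exchange_big/=.
under eq_bigr => j jA do rewrite -mulr_suml divff ?gt_eqF ?Xp//.
by rewrite sumr_const -mulr_natl mulr1 divff// pnatr_eq0 -lt0n.
Qed.

End powR_inequalities.

(** * Discrete Sobolev and Poincare inequalities on a cubic grid *)

Section grid.
Context {R : realType} {n M : nat}.
Local Notation N := (M.+1).
Local Notation grid := {ffun 'I_n -> 'I_M.+1}.
Implicit Types (z : grid) (f g a : grid -> R) (i j k : 'I_n) (t : 'I_M.+1).

Definition upd z j t : grid := [ffun i => if i == j then t else z i].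

Definition line_sum j f : grid -> R := fun z => \sum_t f (upd z j t).

Definition line_mean j f : grid -> R := fun z => line_sum j f z / N%:R.

(** The forward difference is set to 0 on the last layer, so [inord] is only evaluated within
    range. *)
Definition fdiff i a : grid -> R := fun z =>
  if ((z i).+1 < N)%N then `|a (upd z i (inord (z i).+1)) - a z| else 0.

Definition grid_mean a : R := (\sum_z a z) / (N ^ n)%:R.

Lemma upd_upd z j t t' : upd (upd z j t) j t' = upd z j t'.
Proof. by apply/ffunP => i; rewrite !ffunE; case: eqP. Qed.

Lemma updC z i j t t' : i != j -> upd (upd z i t) j t' = upd (upd z j t') i t.
Proof.
move=> ij; apply/ffunP => k; rewrite !ffunE.
by have [->|//] := eqVneq k j; rewrite eq_sym (negbTE ij).
Qed.

Lemma upd_id z j : upd z j (z j) = z.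
Proof. by apply/ffunP => i; rewrite !ffunE; case: eqP => // ->. Qed.

Lemma line_sum_ge0 j f : (forall z, 0 <= f z) -> forall z, 0 <= line_sum j f z.
Proof. by move=> f0 z; apply: sumr_ge0. Qed.

Lemma line_sum_upd j f z t : line_sum j f (upd z j t) = line_sum j f z.
Proof. by apply: eq_bigr => t' _; rewrite upd_upd. Qed.

Lemma line_sumC i j f : line_sum i (line_sum j f) = line_sum j (line_sum i f).
Proof.
have [->//|ij] := eqVneq i j; apply/funext => z.
rewrite /line_sum exchange_big/=; apply: eq_bigr => t _.
by apply: eq_bigr => t' _; rewrite updC.
Qed.

Lemma sum_line_sum j f : \sum_z line_sum j f z = N%:R * \sum_z f z.
Proof.
rewrite /line_sum pair_big/=.
(* The map exchanges [t] with the [j]-th coordinate of [z], hence is an involution. *)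
rewrite (reindex_onto (fun u : grid * 'I_N => (upd u.1 j u.2, u.1 j))
  (fun u => (upd u.1 j u.2, u.1 j))); last first.
  by move=> [z t] _ /=; rewrite upd_upd upd_id ffunE eqxx.
rewrite /= (eq_bigl xpredT); last first.
  by case=> z t /=; rewrite upd_upd upd_id ffunE eqxx/= eqxx.
under eq_bigr => u _ do rewrite upd_upd upd_id.
rewrite -(pair_big xpredT xpredT (fun z _ => f z))/= mulr_sumr.
by apply: eq_bigr => z _; rewrite sumr_const card_ord mulr_natl.
Qed.

Lemma sum_line_mean j f : \sum_z line_mean j f z = \sum_z f z.
Proof. by rewrite -mulr_suml sum_line_sum mulrAC divff ?mul1r// pnatr_eq0. Qed.

(** The coordinates of [z] are replaced by those of [z'] one at a time. *)
Lemma upd_invariant_const f : (forall z j t, f (upd z j t) = f z) ->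
  forall z z', f z = f z'.
Proof.
move=> fupd z z'.
pose mix (s : seq 'I_n) : grid := [ffun i => if i \in s then z' i else z i].
have mixE s : f (mix s) = f z.
  elim: s => [|k s <-]; first by congr f; apply/ffunP => i; rewrite ffunE.
  rewrite -(fupd (mix s) k (z' k)); congr f; apply/ffunP => i.
  by rewrite !ffunE inE; case: eqP => [->|].
rewrite -(mixE (enum 'I_n)); congr f; apply/ffunP => i.
by rewrite ffunE mem_enum.
Qed.

Definition line_sums (s : seq 'I_n) f := foldr line_sum f s.

Lemma line_sums_line_sum s j f :
  line_sums s (line_sum j f) = line_sum j (line_sums s f).
Proof. by elim: s => //= k s ->; rewrite line_sumC. Qed.

Lemma line_sums_upd s j f z t : j \in s ->
  line_sums s f (upd z j t) = line_sums s f z.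
Proof.
elim: s z => //= k s IH z; rewrite inE => /predU1P[->|js]; first exact: line_sum_upd.
have [->|jk] := eqVneq j k; first exact: line_sum_upd.
by apply: eq_bigr => t' _; rewrite (updC _ _ _ jk); exact: IH.
Qed.

Lemma line_sums_ge0 s f : (forall z, 0 <= f z) ->
  forall z, 0 <= line_sums s f z.
Proof. by move=> f0; elim: s => //= k s IH; exact: line_sum_ge0. Qed.

Lemma sum_line_sums s f :
  \sum_z line_sums s f z = (N ^ size s)%:R * \sum_z f z.
Proof.
elim: s => [|k s IH] /=; first by rewrite expn0 mul1r.
by rewrite sum_line_sum IH expnS natrM mulrA.
Qed.

Lemma grid_gt0 : 0 < (N ^ n)%:R :> R.
Proof. by rewrite ltr0n expn_gt0. Qed.

Lemma card_grid : #|{: grid}| = (N ^ n)%N.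
Proof. by rewrite card_ffun !card_ord. Qed.

Lemma line_sums_all f z : line_sums (enum 'I_n) f z = \sum_z f z.
Proof.
have H := upd_invariant_const
  (fun z j t => @line_sums_upd (enum 'I_n) j f z t (mem_enum _ _)).
apply: (mulfI (lt0r_neq0 grid_gt0)).
have := sum_line_sums (enum 'I_n) f; rewrite size_enum_ord => <-.
rewrite (eq_bigr (fun=> line_sums (enum 'I_n) f z)); last first.
  by move=> z' _; exact: H.
by rewrite sumr_const card_grid mulr_natl.
Qed.

(** Sum over one direction after another. Along direction [k] the [k]-th factor is constant and
    comes out; Hölder's inequality applies to the n - 1 others and moves the sum along [k] inside
    their bases. *)
Lemma loomis_whitney (F : 'I_n -> grid -> R) : (2 <= n)%N ->
  (forall i z, 0 <= F i z) ->
  \sum_z \prod_i line_sum i (F i) z `^ (n.-1%:R^-1) <=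
  \prod_i (\sum_z F i z) `^ (n.-1%:R^-1).
Proof.
move=> n2 F0; set c := n.-1%:R^-1.
have n10 : (0 < n.-1)%N by rewrite -subn1 subn_gt0.
(* Once the directions in [s] are summed, the base of factor [i] is summed over [s] and [i]; [H]
   prevents summing twice along [i]. *)
pose H (s : seq 'I_n) i := if i \in s then F i else line_sum i (F i).
suff key s z : uniq s ->
    line_sums s (fun z => \prod_i line_sum i (F i) z `^ c) z <=
    \prod_i line_sums s (H s i) z `^ c.
  have z0 : grid by exact: [ffun=> ord0].
  rewrite -(line_sums_all _ z0) (le_trans (key _ _ (enum_uniq _)))//.
  rewrite le_eqVlt; apply/orP; left; apply/eqP; apply: eq_bigr => i _.
  by rewrite line_sums_all /H mem_enum.
elim: s z => [//|k s IH] z /= /andP[ks us].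
have H0 i z' : 0 <= H s i z'.
  by rewrite /H; case: ifP => _ //; exact: line_sum_ge0.
apply: (@le_trans _ _ (\sum_t \prod_i line_sums s (H s i) (upd z k t) `^ c)).
  by apply: ler_sum => t _; exact: IH.
rewrite (eq_bigr (fun t => line_sums s (H s k) (upd z k t) `^ c *
  \prod_(i | i != k) line_sums s (H s i) (upd z k t) `^ c)); last first.
  by move=> t _; rewrite (bigD1 k).
rewrite [leRHS](bigD1 k)//=.
have -> : H (k :: s) k = F k by rewrite /H inE eqxx.
have -> : H s k = line_sum k (F k) by rewrite /H (negbTE ks).
under eq_bigr => t _ do rewrite line_sums_line_sum line_sum_upd.
rewrite -mulr_sumr ler_wpM2l ?powR_ge0//.
have ck : #|[pred i | i != k]| = n.-1.
  by rewrite (cardC1 k) card_ord.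
have := @sum_prod_powR_le R 'I_N 'I_n [pred i | i != k]
  (fun i t => line_sums s (H s i) (upd z k t)).
rewrite ck -/c => /(_ n10 (fun i t => line_sums_ge0 _ (H0 i) _)) /le_trans.
apply; rewrite le_eqVlt; apply/orP; left; apply/eqP; apply: eq_bigr => i ik.
by rewrite /H inE (negbTE ik).
Qed.

(** By telescoping, the oscillation along a line is at most its total variation. *)
Lemma ord_telescope (h : 'I_N -> R) t t' :
  `|h t - h t'| <= \sum_(q < N)
    if (q.+1 < N)%N then `|h (inord q.+1) - h q| else 0.
Proof.
wlog tt' : t t' / (t' <= t)%N.
  by move=> H; have [/H//|/ltnW/H] := leqP t' t; rewrite distrC.
pose h' q := h (inord q).
have h'E (q : 'I_N) : h q = h' q by rewrite /h' inord_val.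
rewrite !h'E -telescope_sumr//.
rewrite (le_trans (ler_norm_sum _ _ _))//.
have tN : (t <= N)%N by rewrite ltnW.
pose F q := if (q.+1 < N)%N then `|h' q.+1 - h' q| else 0.
rewrite [leRHS](eq_bigr (fun q : 'I_N => F q)) => [|q _]; last by rewrite (h'E q).
rewrite -(big_mkord xpredT F).
rewrite [leRHS](big_cat_nat (n := t))//= [in leRHS](big_cat_nat (n := t') (p := t))//=.
rewrite -addrA addrCA; apply: ler_wpDr.
  by apply: addr_ge0; apply: sumr_ge0 => q _; rewrite /F; case: ifP.
rewrite big_nat [leRHS]big_nat; apply: ler_sum => q /andP[_ qt].
by rewrite /F (leq_ltn_trans qt).
Qed.

Lemma sub_upd_le_line_sum j a z t :
  `|a z - a (upd z j t)| <= line_sum j (fdiff j a) z.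
Proof.
have := ord_telescope (fun t => a (upd z j t)) (z j) t.
rewrite /= upd_id => /le_trans; apply; apply: ler_sum => k _.
by rewrite /fdiff ffunE eqxx upd_upd.
Qed.

Lemma fdiff_ge0 i a z : 0 <= fdiff i a z.
Proof. by rewrite /fdiff; case: ifP. Qed.

Let norm_invN : `|N%:R^-1| = N%:R^-1 :> R.
Proof. by rewrite ger0_norm. Qed.

Lemma sub_line_mean_le j a z :
  `|a z - line_mean j a z| <= line_sum j (fdiff j a) z.
Proof.
have N0 : 0 < N%:R :> R by [].
have -> : a z - line_mean j a z = (\sum_t (a z - a (upd z j t))) / N%:R.
  by rewrite sumrB sumr_const card_ord -[a z *+ _]mulr_natr mulrBl mulfK ?gt_eqF.
rewrite normrM norm_invN ler_pdivrMr//.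
rewrite (le_trans (ler_norm_sum _ _ _))//.
rewrite (le_trans (ler_sum _ (fun t _ => sub_upd_le_line_sum j a z t)))//.
by rewrite sumr_const card_ord mulr_natr.
Qed.

(** There is no boundary condition, so the mean along the line has to be added to the variation. *)
Lemma norm_le_line_sum j a z :
  `|a z| <= line_sum j (fun z => fdiff j a z + `|a z| / N%:R) z.
Proof.
rewrite /line_sum big_split/= -[a z](subrK (line_mean j a z)).
rewrite (le_trans (ler_normD _ _))// lerD ?sub_line_mean_le//.
rewrite normrM norm_invN -mulr_suml ler_wpM2r//.
exact: ler_norm_sum.
Qed.

(** Gagliardo-Nirenberg argument: |a z| is below n line sums, one per direction, so its power
    n/(n-1) is below the product of their powers 1/(n-1), to which [loomis_whitney] applies. *)
Lemma grid_sobolev1 a : (2 <= n)%N ->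
  \sum_z `|a z| `^ (n%:R / n.-1%:R) <=
  (\sum_z (\sum_i fdiff i a z + `|a z| / N%:R)) `^ (n%:R / n.-1%:R).
Proof.
move=> n2; set c := n.-1%:R^-1.
pose F i z := fdiff i a z + `|a z| / N%:R.
have F0 i z : 0 <= F i z by rewrite addr_ge0// fdiff_ge0.
have c0 : 0 <= c by rewrite invr_ge0.
apply: (@le_trans _ _ (\sum_z \prod_i line_sum i (F i) z `^ c)).
  apply: ler_sum => z _.
  rewrite mulrC powRrM powR_mulrn ?powR_ge0// -[n in _ ^+ n]card_ord.
  rewrite -prodr_const; apply: ler_prod => i _.
  by rewrite powR_ge0/= le_powR2// norm_le_line_sum.
rewrite (le_trans (loomis_whitney n2 F0))//.
rewrite mulrC powRrM powR_mulrn ?powR_ge0// -[n in _ ^+ n]card_ord.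
rewrite -prodr_const; apply: ler_prod => i _.
rewrite powR_ge0/= le_powR2// ?sumr_ge0//.
apply: ler_sum => z _; rewrite lerD2r (bigD1 i)//= lerDl sumr_ge0// => k _.
exact: fdiff_ge0.
Qed.

Lemma line_mean_powR_le j a s : 1 <= s ->
  \sum_z `|line_mean j a z| `^ s <= \sum_z `|a z| `^ s.
Proof.
move=> s1; rewrite -(sum_line_mean j (fun z => `|a z| `^ s)).
apply: ler_sum => z _; rewrite /line_mean /line_sum.
have := @powR_jensen R 'I_N (fun t => `|a (upd z j t)|) s.
rewrite card_ord => /(_ isT s1 (fun=> normr_ge0 _)); apply: le_trans.
apply: le_powR2 => //; first by rewrite (le_trans _ s1).
by rewrite normrM norm_invN ler_wpM2r// ler_norm_sum.
Qed.

Definition line_means (s : seq 'I_n) f := foldr line_mean f s.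

Lemma line_meansE s f z : line_means s f z = line_sums s f z / (N ^ size s)%:R.
Proof.
elim: s z => [|k s IH] z /=; first by rewrite divr1.
rewrite /line_mean /line_sum; under eq_bigr => t _ do rewrite IH.
by rewrite -mulr_suml expnS natrM invfM [_^-1 * _^-1]mulrC mulrA.
Qed.

Lemma line_means_all f z : line_means (enum 'I_n) f z = grid_mean f.
Proof. by rewrite line_meansE line_sums_all size_enum_ord. Qed.

(** Split a minus its mean along [k :: r] as (a - mean_k a) + mean_k (a - mean_r a). The variation
    along lines bounds the first term; [line_mean_powR_le] and induction bound the second. Each
    direction costs a factor 2^s. *)
Lemma grid_poincare_seq s (r : seq 'I_n) a : 1 <= s ->
  \sum_z `|a z - line_means r a z| `^ s <=
  (2 `^ s) ^+ size r *
    (N%:R `^ s * \sum_(i <- r) \sum_z fdiff i a z `^ s).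
Proof.
move=> s1; have s0 : 0 <= s by rewrite (le_trans _ s1).
elim: r => [|k r IH] /=.
  rewrite big_nil mulr0 mulr0 big1// => z _.
  by rewrite subrr normr0 powR0// gt_eqF// (lt_le_trans _ s1).
have H1 : \sum_z `|a z - line_mean k a z| `^ s <=
    N%:R `^ s * \sum_z fdiff k a z `^ s.
  have /le_trans := line_mean_powR_le k (fdiff k a) s1.
  move=> /(_ (\sum_z fdiff k a z `^ s)) H.
  apply: (@le_trans _ _ (N%:R `^ s * \sum_z `|line_mean k (fdiff k a) z| `^ s)).
    rewrite mulr_sumr; apply: ler_sum => z _; rewrite -powRM//.
    apply: le_powR2 => //; rewrite (le_trans (sub_line_mean_le _ _ _))//.
    rewrite /line_mean normrM norm_invN mulrCA.
    by rewrite divff ?pnatr_eq0// mulr1 ler_norm.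
  rewrite ler_wpM2l ?powR_ge0// H//; apply: ler_sum => z _.
  by rewrite ger0_norm// fdiff_ge0.
have H2 : \sum_z `|line_mean k a z - line_mean k (line_means r a) z| `^ s <=
    (2 `^ s) ^+ size r * (N%:R `^ s * \sum_(i <- r) \sum_z fdiff i a z `^ s).
  apply: le_trans IH.
  apply: le_trans (line_mean_powR_le k (fun z => a z - line_means r a z) s1).
  rewrite le_eqVlt; apply/orP; left; apply/eqP; apply: eq_bigr => z _.
  by rewrite /line_mean /line_sum sumrB mulrBl.
apply: (@le_trans _ _ (\sum_z 2 `^ s * (`|a z - line_mean k a z| `^ s +
    `|line_mean k a z - line_mean k (line_means r a) z| `^ s))).
  apply: ler_sum => z _; rewrite -[X in `|X| `^ _](subrKA (line_mean k a z)).
  apply: le_trans (powR_addr_le s0 _ _) => //.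
  by apply: le_powR2 => //; rewrite ler_normD.
rewrite -mulr_sumr big_split/= big_cons exprS -mulrA ler_wpM2l ?powR_ge0//.
rewrite (le_trans (lerD H1 H2))// !mulrDr lerD2r.
rewrite ler_peMl ?mulr_ge0 ?powR_ge0 ?sumr_ge0// => [z _|].
  by rewrite powR_ge0.
rewrite exprn_ege1//.
have := ler_powR (ler1n R 2) s0; rewrite powRr0; exact.
Qed.

Lemma grid_poincare s a : 1 <= s ->
  \sum_z `|a z - grid_mean a| `^ s <=
  (2 `^ s) ^+ n * (N%:R `^ s * \sum_z \sum_i fdiff i a z `^ s).
Proof.
move=> s1; have := grid_poincare_seq (enum 'I_n) a s1.
rewrite size_enum_ord big_enum/= [in leRHS]exchange_big/=.
by apply: le_trans; apply: ler_sum => z _; rewrite line_means_all.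
Qed.

End grid.

Lemma fdiff_subr (R : realType) (n M : nat) i (a : {ffun 'I_n -> 'I_M.+1} -> R) c :
  fdiff i (fun z => a z - c) = fdiff i a.
Proof.
apply/funext => z; rewrite /fdiff; case: ifP => // _; congr `|_|; ring.
Qed.

(** The unit shift in direction [i] is injective on the nodes that it keeps in the grid. *)
Lemma sum_shift_le (R : realType) (n M : nat) i (F : {ffun 'I_n -> 'I_M.+1} -> R) :
  (forall z, 0 <= F z) ->
  \sum_(z : {ffun 'I_n -> 'I_M.+1} | ((z i).+1 < M.+1)%N) F (upd z i (inord (z i).+1)) <= \sum_z F z.
Proof.
move=> F0; pose A := finset (fun z : {ffun 'I_n -> 'I_M.+1} => ((z i).+1 < M.+1)%N).
pose h z := @upd n M z i (inord (z i).+1).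
rewrite (eq_bigl [in A]) => [|z]; last by rewrite inE.
rewrite -(big_imset (h := h))/=; last first.
  move=> z z'; rewrite !inE => zi z'i /ffunP hh; apply/ffunP => j.
  have := hh j; rewrite !ffunE; case: eqP => // ->.
  by move=> /(congr1 (@nat_of_ord _)); rewrite !inordK// => -[] /val_inj.
by rewrite [leRHS](bigID [in h @: A]%SET)/= lerDl sumr_ge0.
Qed.

(** * Discrete Sobolev-Poincaré inequality for 1 <= s < n *)

Section grid_sobolev.
Context {R : realType} (n : nat) (s : R).
Hypotheses (n2 : (2 <= n)%N) (s1 : 1 <= s) (sn : s < n%:R).
Local Notation sstar := (n%:R * s / (n%:R - s)).
Local Notation gam := (s * n.-1%:R / (n%:R - s)).

Let nE : n.-1%:R = n%:R - 1 :> R.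
Proof. by rewrite -subn1 natrB// ltnW. Qed.
Let ns0 : n%:R - s != 0. Proof. by rewrite subr_eq0 gt_eqF. Qed.
Let nsp : 0 < n%:R - s. Proof. by rewrite subr_gt0. Qed.
Let s0 : 0 < s. Proof. by rewrite (lt_le_trans _ s1). Qed.
Let sn0 : s != 0. Proof. by rewrite gt_eqF. Qed.
Let n1p : 0 < n%:R - 1 :> R. Proof. by rewrite subr_gt0 ltr1n. Qed.
Let n0 : n%:R != 0 :> R. Proof. by rewrite pnatr_eq0; case: n n2. Qed.
Let np : 0 < n%:R :> R. Proof. by rewrite ltr0n; case: n n2. Qed.

(** The exponent [gam] satisfies gam n/(n-1) = [sstar] and (gam - 1) s = (s - 1) [sstar]; by the
    second identity this is Young's inequality with exponents s/(s-1) and s. *)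
Lemma sstar_young (x d th : R) : 0 <= x -> 0 <= d -> 0 < th ->
  x `^ (gam - 1) * d <= th * x `^ sstar + th `^ (- (s - 1)) * d `^ s.
Proof.
move=> x0 d0 th0; have t01 : 0 < s^-1 <= 1 by rewrite invr_gt0 s0 invf_le1.
have := powR_young_eps (powR_ge0 x sstar) (powR_ge0 d s) t01 th0.
rewrite -!powRrM divff// powRr1//.
have -> : sstar * (1 - s^-1) = gam - 1 by rewrite nE; field; rewrite ns0 sn0.
by have -> : (1 - s^-1) / s^-1 = s - 1 by field; rewrite sn0.
Qed.

Lemma gam_ge1 : 1 <= gam.
Proof.
rewrite ler_pdivlMr// mul1r nE mulrBr mulr1 lerD2r ler_peMl// ltW//.
Qed.

Lemma fdiff_powR_le (M : nat) (b : {ffun 'I_n -> 'I_M.+1} -> R) i th z : 0 < th ->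
  fdiff i (fun z => `|b z| `^ gam) z <=
  gam * (th * (if ((z i).+1 < M.+1)%N then
                 `|b (upd z i (inord (z i).+1))| `^ sstar else 0) +
         th * `|b z| `^ sstar + 2 * (th `^ (- (s - 1)) * fdiff i b z `^ s)).
Proof.
move=> th0; rewrite /fdiff; have g1 := gam_ge1.
have g0 : 0 < gam by rewrite (lt_le_trans _ g1).
case: ifP => _; last first.
  rewrite (powR0 sn0) !mulr0 addr0 add0r (mulr_ge0 (ltW g0))// mulr_ge0 ?powR_ge0//.
  exact: ltW.
set y := upd _ _ _.
apply: le_trans (powR_sub_le g1 (normr_ge0 _) (normr_ge0 _)) _.
rewrite -mulrA (ler_wpM2l (ltW g0))//.
have d0 := normr_ge0 (b y - b z).
apply: (@le_trans _ _ ((`|b y| `^ (gam - 1) + `|b z| `^ (gam - 1)) * `|b y - b z|)).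
  by rewrite ler_wpM2l ?addr_ge0 ?powR_ge0// ler_dist_dist.
have := sstar_young (normr_ge0 (b y)) d0 th0.
have := sstar_young (normr_ge0 (b z)) d0 th0.
rewrite mulrDl mulr_natl mulr2n; set A := th * _; set B := th * _; set D := th `^ _ * _.
lra.
Qed.

(** Apply [grid_sobolev1] to |b|^gam, where b is a minus its mean. The differences, and the mean
    term |b|^(gam-1) (|b|/N), are split by [sstar_young]; [grid_poincare] compensates the factor
    1/N. The parameter [th] is left free. *)
Lemma grid_sobolev_poincare_theta (M : nat) (a : {ffun 'I_n -> 'I_M.+1} -> R) K th :
  0 < th -> \sum_z \sum_i fdiff i a z `^ s <= K ->
  \sum_z `|a z - grid_mean a| `^ sstar <= ((2 * n%:R * gam + 1 + 2 * gam + (2 `^ s) ^+ n) *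
        (th * \sum_z `|a z - grid_mean a| `^ sstar + th `^ (- (s - 1)) * K))
        `^ (n%:R / n.-1%:R).
Proof.
move=> th0 DK; pose b z := a z - grid_mean a.
rewrite -/(b _); set X := \sum_z `|b z| `^ sstar; set C := (2 * _ * _ + _ + _ + _).
have g1 := gam_ge1; have g0 : 0 < gam by rewrite (lt_le_trans _ g1).
pose D := \sum_z \sum_i fdiff i a z `^ s.
have X0 : 0 <= X by apply: sumr_ge0 => z _; rewrite powR_ge0.
have T0 : 0 <= th `^ (- (s - 1)) by rewrite powR_ge0.
have XE : X = \sum_z `| `|b z| `^ gam| `^ (n%:R / n.-1%:R).
  apply: eq_bigr => z _; rewrite [`| _ `^ _|]ger0_norm ?powR_ge0// -powRrM; congr (_ `^ _).
  by rewrite nE; field; rewrite ns0 gt_eqF.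
rewrite [leLHS]XE; apply: le_trans (grid_sobolev1 (fun z => `|b z| `^ gam) n2) _.
apply: le_powR2; first by rewrite divr_ge0.
  apply: sumr_ge0 => z _; rewrite addr_ge0//; apply: sumr_ge0 => i _.
  exact: fdiff_ge0.
rewrite big_split/=.
set gm := gam in g1 g0 C *.
have H1 : \sum_z \sum_i fdiff i (fun z => `|b z| `^ gam) z <=
    \sum_(i < n) gm * (2 * (th * X)) + 2 * gm * (th `^ (- (s - 1)) * D).
  have -> : 2 * gm * (th `^ (- (s - 1)) * D) =
      \sum_i 2 * gm * (th `^ (- (s - 1)) * \sum_z fdiff i a z `^ s).
    by rewrite /D exchange_big/= -mulr_sumr -mulr_sumr.
  rewrite exchange_big/= -big_split/=.
  apply: ler_sum => i _.
  rewrite (le_trans (ler_sum _ (fun z _ => fdiff_powR_le b i z th0)))//.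
  rewrite -mulr_sumr -/gm -[2 * gm]mulrC -(mulrA gm) -mulrDr (ler_wpM2l (ltW g0))//.
  rewrite !big_split/= -!mulr_sumr -big_mkcond/= -mulrDr lerD//; last first.
    rewrite /b fdiff_subr mulrCA mulrA.
    by rewrite le_eqVlt; apply/orP; left; apply/eqP; ring.
  rewrite mulrCA (ler_wpM2l (ltW th0))// [2 * X](mulrDl 1 1) mul1r lerD2r.
  by apply: (@sum_shift_le _ _ _ i (fun z => `|b z| `^ sstar)) => z; rewrite powR_ge0.
have N0 : 0 < M.+1%:R :> R by [].
have H2 : \sum_z `| `|b z| `^ gam| / M.+1%:R <=
    th * X + th `^ (- (s - 1)) * ((2 `^ s) ^+ n * D).
  have := grid_poincare a s1; rewrite -/D mulrCA => P.
  apply: (@le_trans _ _ (\sum_z (th * `|b z| `^ sstar +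
      th `^ (- (s - 1)) * (`|b z| / M.+1%:R) `^ s))).
    apply: ler_sum => z _; apply: le_trans (sstar_young (normr_ge0 (b z))
      (divr_ge0 (normr_ge0 (b z)) (ltW N0)) th0).
    rewrite [`| _ `^ _|]ger0_norm ?powR_ge0// mulrA ler_wpM2r//.
    have [->|bz] := eqVneq (b z) 0.
      by rewrite normr0 powR0 ?gt_eqF// mulr0.
    rewrite -[X in _ <= _ * X]powRr1// -powRD ?subrK//.
    by rewrite normr_eq0 bz implybT.
  rewrite big_split/= -!mulr_sumr lerD2l ler_wpM2l//.
  under eq_bigr => z _ do rewrite powRM ?invr_ge0// powRV//.
  rewrite -mulr_suml ler_pdivrMr ?powR_gt0//.
  by rewrite mulrC.
rewrite -mulr_suml in H2 *.
apply: le_trans (lerD H1 H2) _.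
rewrite sumr_const card_ord -[_ *+ n]mulr_natl.
have KD0 : 0 <= th `^ (- (s - 1)) * K - th `^ (- (s - 1)) * D.
  by rewrite -mulrBr mulr_ge0// subr_ge0.
have X0' : 0 <= th * X by rewrite mulr_ge0// ltW.
have D0 : 0 <= th `^ (- (s - 1)) * D.
  rewrite mulr_ge0//; apply: sumr_ge0 => z _.
  by apply: sumr_ge0 => i _; rewrite powR_ge0.
have E0 : 0 <= (2 `^ s) ^+ n :> R by rewrite exprn_ge0// powR_ge0.
rewrite /C (mulrCA (th `^ _) ((2 `^ s) ^+ n)) mulrDr.
have nn : 0 <= n%:R :> R by [].
clear -g0 E0 KD0 X0' D0 nn.
move: g0 E0 KD0 X0' D0 nn.
move: (th * X) (th `^ _ * K) (th `^ _ * D) gm ((2 `^ s) ^+ n) (n%:R).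
move=> x k d g E n' g0 E0 kd x0 d0 nn.
have k0 : 0 <= k by lra.
have h1 : 0 <= (2 * g + E) * x by rewrite mulr_ge0// addr_ge0// mulr_ge0// ltW.
have h2 : 0 <= (2 * (n' * g) + 1) * k.
  by rewrite mulr_ge0// addr_ge0// mulr_ge0// mulr_ge0// ltW.
have h3 : 0 <= (2 * g + E) * (k - d).
  by rewrite mulr_ge0// addr_ge0// mulr_ge0// ltW.
lra.
Qed.

(** [C] is chosen before [M], which is what allows the mesh to tend to 0. *)
Lemma grid_sobolev_poincare : exists2 C, 0 < C &
  forall (M : nat) (a : {ffun 'I_n -> 'I_M.+1} -> R) K, 0 < K ->
  \sum_z \sum_i fdiff i a z `^ s <= K ->
  \sum_z `|a z - grid_mean a| `^ sstar <= C * K `^ (n%:R / (n%:R - s)).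
Proof.
pose C1 := 2 * n%:R * gam + 1 + 2 * gam + (2 `^ s) ^+ n.
have g0 : 0 < gam by rewrite (lt_le_trans _ gam_ge1).
have C10 : 0 < C1.
  have E0 : 0 <= (2 `^ s) ^+ n :> R by rewrite exprn_ge0// powR_ge0.
  have ng0 : 0 <= n%:R * gam by rewrite mulr_ge0// ltW.
  rewrite /C1 -(mulrA 2) -addrA ltr_wpDr ?addr_ge0 ?(mulr_ge0 _ (ltW g0))//.
  by rewrite ltr_wpDl// mulr_ge0.
exists ((2 * C1) `^ (n%:R * s / (n%:R - s))); first by rewrite powR_gt0// mulr_gt0.
move=> M a K K0 DK; set X := \sum_z _.
have : 0 <= X by apply: sumr_ge0 => z _; rewrite powR_ge0.
rewrite le_eqVlt => /predU1P[<-|X0]; first by rewrite mulr_ge0// powR_ge0.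
(* This value makes both terms equal to K^(1/s) X^(1-1/s). As s < n, the exponent (n-1)/n exceeds 1
   - 1/s, so the power of [X] on the right can be divided out. *)
pose th := (K / X) `^ s^-1.
have th0 : 0 < th by rewrite powR_gt0// divr_gt0.
have := grid_sobolev_poincare_theta th0 DK; rewrite -/X -/C1.
have e1 : th * X = K `^ s^-1 * X `^ (1 - s^-1).
  rewrite /th powRM ?invr_ge0 ?(ltW K0) ?(ltW X0)// -mulrA; congr (_ * _).
  rewrite powRV ?(ltW X0)// -powRN -[X in _ * X]powRr1 ?(ltW X0)//.
  by rewrite -powRD ?(gt_eqF X0) ?implybT// addrC.
have e2 : th `^ (- (s - 1)) * K = K `^ s^-1 * X `^ (1 - s^-1).
  rewrite /th -powRrM powRM ?invr_ge0 ?(ltW K0) ?(ltW X0)// mulrAC.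
  congr (_ * _).
    rewrite -[X in _ * X]powRr1 ?(ltW K0)// -powRD ?(gt_eqF K0) ?implybT//.
    by congr (_ `^ _); field.
  by rewrite powRV ?(ltW X0)// -powRN; congr (_ `^ _); field.
rewrite e1 e2 -mulr2n -[_ *+ 2]mulr_natl mulrA [C1 * 2]mulrC => H.
set A := K `^ s^-1 in H *.
have A0 : 0 <= A by rewrite powR_ge0.
have CA : 0 <= 2 * C1 by rewrite mulr_ge0// ltW.
pose e := n%:R * s / (n%:R - s).
have e0 : 0 <= e by rewrite /e !mulr_ge0 ?invr_ge0 ?ltW.
have {}H : X `^ ((n%:R - 1) / n%:R) <= 2 * C1 * (A * X `^ (1 - s^-1)).
  have e'0 : 0 <= (n%:R - 1) / n%:R :> R by rewrite divr_ge0// ltW.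
  have := le_powR2 e'0 (ltW X0) H.
  rewrite -powRrM nE.
  have -> : n%:R / (n%:R - 1) * ((n%:R - 1) / n%:R) = 1 :> R.
    by field; rewrite n0 gt_eqF.
  by rewrite powRr1 //; exact: mulr_ge0 CA (mulr_ge0 A0 (powR_ge0 _ _)).
have {}H : X `^ ((n%:R - 1) / n%:R - (1 - s^-1)) <= 2 * C1 * A.
  by rewrite powRB ?(gt_eqF X0) ?implybT// ler_pdivrMr ?powR_gt0// -(mulrA (2 * C1)).
have := le_powR2 e0 (powR_ge0 _ _) H.
rewrite -powRrM powRM// /A -powRrM.
have -> : ((n%:R - 1) / n%:R - (1 - s^-1)) * e = 1.
  by rewrite /e; field; rewrite n0 sn0 ns0.
have -> : s^-1 * e = n%:R / (n%:R - s).
  by rewrite /e; field; rewrite sn0 ns0.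
by rewrite powRr1// ltW.
Qed.

End grid_sobolev.

(** * Lebesgue measure of cubes *)

Section box_cover.
Context {R : realType}.
Local Open Scope ereal_scope.

(** Gives the lower bound on the volume of a covered cube. Freeze the last coordinate, apply the
    induction hypothesis to the boxes that meet this slice, and integrate over the coordinate with
    one-dimensional Lebesgue measure. Points are infinite sequences so that their type is the same
    in all dimensions. *)
Lemma box_cover_volume (n : nat) (p q : R) (L : \bar R) (a b : nat -> nat -> R)
    (c : nat -> \bar R) : (p < q)%R -> 0 <= L -> (forall k, 0 <= c k) ->
  (forall x : nat -> R, (forall i, p < x i <= q)%R ->
     L <= \sum_(k <oo) c k *
            (\prod_(i < n) \1_(`]a k i, b k i]) (x i) : R)%:E) ->
  L * ((q - p) ^+ n)%:E <=
  \sum_(k <oo) c k * (\prod_(i < n) Num.max 0 (b k i - a k i))%:E.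
Proof.
move=> pq L0; elim: n c => [|n IH] c c0 H.
  rewrite expr0 mule1; have := H (fun=> q).
  rewrite pq lexx/= => /(_ (fun=> isT)) /le_trans; apply.
  apply: lee_nneseries => [k _ _|k _]; last by rewrite !big_ord0.
  by apply: mule_ge0 => //; rewrite lee_fin prodr_ge0.
pose V k := (\prod_(i < n) Num.max 0 (b k i - a k i))%R.
have V0 k : (0 <= V k)%R by apply: prodr_ge0 => i _; rewrite le_max lexx.
have step t : `]p, q]%classic t -> L * ((q - p) ^+ n)%:E <=
    \sum_(k <oo) (c k * (V k)%:E) * (\1_(`]a k n, b k n]%classic) t)%:E.
  rewrite /= in_itv/= => pt.
  have c1 k : 0 <= c k * (\1_(`]a k n, b k n]%classic) t)%:E.
    by rewrite mule_ge0// lee_fin.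
  apply: le_trans (IH _ c1 _) _ => [x px|].
    have := H (fun i => if i == n then t else x i).
    move=> /(_ _)/le_trans; apply=> [i|]; first by case: ifP.
    apply: lee_nneseries => [k _ _|k _].
      by apply: mule_ge0 => //; rewrite lee_fin prodr_ge0.
    rewrite big_ord_recr/= eqxx -muleA -EFinM mulrC.
    rewrite lee_wpmul2l// lee_fin ler_wpM2l// le_eqVlt.
    by apply/orP; left; apply/eqP; apply: eq_bigr => i _; rewrite ltn_eqF.
  apply: lee_nneseries => [k _ _|k _].
    by apply: mule_ge0 => //; rewrite lee_fin; exact: V0.
  by rewrite -!muleA [(V k)%:E * _]muleC.
pose D := `]p, q]%classic.
have mD : measurable (D : set R) by exact: measurable_itv.
have mf k : measurable_fun D
    (fun t => (c k * (V k)%:E) * (\1_(`]a k n, b k n]%classic) t)%:E).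
  apply: emeasurable_funM; first exact: measurable_cst.
  by apply/measurable_EFinP; exact: measurable_indic.
have qpn : (0 <= (q - p) ^+ n)%R by rewrite exprn_ge0// subr_ge0 ltW.
have : \int[lebesgue_measure]_(t in D) (cst (L * ((q - p) ^+ n)%:E) t) <=
  \int[lebesgue_measure]_(t in D)
    \sum_(k <oo) (c k * (V k)%:E) * (\1_(`]a k n, b k n]%classic) t)%:E.
  apply: ge0_le_integral => //.
  - by move=> t _; rewrite mule_ge0.
  - apply: ge0_emeasurable_sum => [k t Dt _|k _]; last exact: mf.
    by rewrite !mule_ge0// lee_fin.
have muD : lebesgue_measure D = (q - p)%:E.
  by rewrite /D lebesgue_measure_itv/= lte_fin pq EFinB.
rewrite integral_cst//= muD -muleA -EFinM -exprSr => /le_trans; apply.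
rewrite integral_nneseries//; last by move=> k t _; rewrite !mule_ge0// lee_fin.
apply: lee_nneseries => [k _ _|k _].
  by apply: integral_ge0 => t _; rewrite !mule_ge0// lee_fin.
rewrite ge0_integralZl//; last 2 first.
- by apply/measurable_EFinP; exact: measurable_indic.
- by rewrite mule_ge0// lee_fin.
rewrite integral_indic// big_ord_recr/= EFinM muleA lee_wpmul2l//.
  by rewrite mule_ge0// lee_fin.
apply: (@le_trans _ _ (lebesgue_measure `]a k n, b k n]%classic)).
  by apply: le_measure; rewrite ?inE//; exact: measurableI.
rewrite lebesgue_measure_itv/= lte_fin; case: ifPn => ab.
  by rewrite -EFinB lee_fin le_max lexx orbT.
by rewrite lee_fin le_max lexx.
Qed.

End box_cover.

(** * Dilations and Lebesgue outer measure *)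

Section outer.
Context {R : realType} {n : nat}.
Local Notation V := 'rV[R]_n.
Local Open Scope ereal_scope.
Implicit Types (A X : set V).

Lemma lebesgue_outer_le A (c : nat -> option (V * V)) :
  A `<=` \bigcup_k box (c k) ->
  lebesgue_outer A <= \sum_(k <oo) box_volume (c k).
Proof. by move=> Ac; apply: ereal_inf_lbound; exists c. Qed.

Lemma lebesgue_outer_box_le (c : option (V * V)) :
  lebesgue_outer (box c) <= box_volume c.
Proof.
pose c' (k : nat) : option (V * V) := if k is 0%N then c else None.
have : lebesgue_outer (box c) <= \sum_(k <oo) box_volume (c' k).
  by apply: lebesgue_outer_le => x cx; exists 0%N.
move=> /le_trans; apply.
rewrite (@nneseriesD1 _ _ 0%N)// => [|k _]; last exact: box_volume_ge0.
by rewrite eseries0 ?adde0// => -[].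
Qed.

(** With r = 1/h it carries the cube of corner [z] and side h to the unit cube. *)
Definition shrink (r : R) (z y : V) : V := r *: (y - z).

Lemma shrinkE r z y i : shrink r z y ord0 i = (r * (y ord0 i - z ord0 i))%R.
Proof. by rewrite !mxE. Qed.

Lemma shrinkVK (r : R) z y : r != 0%R ->
  shrink r z (shrink r^-1 (- (r *: z)) y) = y.
Proof.
move=> r0; apply/rowP => i; rewrite !mxE opprK mulrBr mulrA divff// mul1r.
by rewrite addrK.
Qed.

Let shrink_box (r : R) (z : V) (c : option (V * V)) : option (V * V) :=
  omap (fun ab => (r^-1 *: ab.1 + z, r^-1 *: ab.2 + z))%R c.

Let preimage_shrink_box r z c : (0 < r)%R ->
  shrink r z @^-1` box c = box (shrink_box r z c).
Proof.
move=> r0; case: c => [[a b]|]; last by rewrite preimage_set0.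
apply/seteqP; split => x /= H i; move: (H i); rewrite !mxE /=;
  by rewrite -ltrBrDr -lerBlDr ltr_pdivrMl// ler_pdivlMl.
Qed.

Let shrink_box_volume r z c : (0 < r)%R ->
  box_volume (shrink_box r z c) = (r ^- n)%:E * box_volume c.
Proof.
move=> r0; case: c => [[a b]|]/=; last by rewrite mule0.
rewrite -EFinM -exprVn -[in X in (_ ^+ X)%R](card_ord n) -prodr_const.
rewrite -big_split/=; congr EFin; apply: eq_bigr => i _.
rewrite !mxE maxr_pMr ?invr_ge0 ?ltW// mulr0; congr Num.max.
by rewrite mulrBr opprD addrACA subrr addr0.
Qed.

Let le_lebesgue_outer_shrink r z A : (0 < r)%R ->
  lebesgue_outer (shrink r z @^-1` A) <= (r ^- n)%:E * lebesgue_outer A.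
Proof.
move=> r0; have rn0 : (0 < r ^+ n)%R by rewrite exprn_gt0.
rewrite -lee_pdivrMl ?invr_gt0// invrK.
apply: le_ereal_inf_tmp => _ [c Ac <-].
rewrite -lee_pdivlMl// -nneseriesZl; last by move=> k _; exact: box_volume_ge0.
under eq_eseriesr => k _ do rewrite -(shrink_box_volume z)//.
apply: lebesgue_outer_le => x /= /Ac[k _ ck]; exists k => //.
by rewrite -preimage_shrink_box.
Qed.

(** Preimages of boxes are boxes, which gives one inequality; the other is the same one for the
    inverse dilation. *)
Lemma lebesgue_outer_shrink r z A : (0 < r)%R ->
  lebesgue_outer (shrink r z @^-1` A) = (r ^- n)%:E * lebesgue_outer A.
Proof.
move=> r0; apply/eqP; rewrite eq_le le_lebesgue_outer_shrink//=.
have rn0 : (0 < r ^+ n)%R by rewrite exprn_gt0.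
have ri0 : (0 < r^-1)%R by rewrite invr_gt0.
have := @le_lebesgue_outer_shrink r^-1%R (- (r *: z)) (shrink r z @^-1` A) ri0.
rewrite exprVn invrK -lee_pdivrMl// -comp_preimage.
rewrite (_ : _ \o _ = id)//; apply/funext => y /=.
by rewrite shrinkVK// gt_eqF.
Qed.

End outer.

Lemma maxr_split (R : realDomainType) (a b t : R) :
  Num.max 0 (Num.min b t - a) + Num.max 0 (b - Num.max a t) =
  Num.max 0 (b - a).
Proof.
by have [bt|tb] := leP b t; have [at_|ta] := leP a t; rewrite !maxEle;
  repeat (case: ifPn; rewrite -?ltNge => ?); lra.
Qed.

(** * Measurability and volume of half-spaces, boxes and cubes *)

Section lebesgue_theory.
Context {R : realType} {n : nat}.
Local Notation V := 'rV[R]_n.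
Local Notation lambda := (@lebesgue R n).
Local Open Scope ereal_scope.
Implicit Types (A X : set V).

Let setc (a : V) (i : 'I_n) (t : R) : V :=
  (\row_j (if j == i then t else a ord0 j))%R.

(** A hyperplane cuts each box of a cover into two boxes whose volumes add up, so the Carathéodory
    inequality holds cover by cover. *)
Lemma measurable_halfspace (i : 'I_n) (t : R) :
  measurable [set x : V | (x ord0 i <= t)%R].
Proof.
apply: le_caratheodory_measurable => X.
set H := [set x | _].
pose cl (c : option (V * V)) : option (V * V) :=
  omap (fun ab => (ab.1, setc ab.2 i (Num.min (ab.2 ord0 i) t))) c.
pose cr (c : option (V * V)) : option (V * V) :=
  omap (fun ab => (setc ab.1 i (Num.max (ab.1 ord0 i) t), ab.2)) c.
have clP c : box c `&` H `<=` box (cl c).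
  case: c => [[a b]|]/= x []//= xab xt j; rewrite !mxE.
  have /andP[-> xb] := xab j; case: eqP => [ji|//].
  by rewrite le_min ji xt -ji xb.
have crP c : box c `&` ~` H `<=` box (cr c).
  case: c => [[a b]|]/= x []//= xab /negP; rewrite -ltNge => xt j; rewrite !mxE.
  have /andP[xa ->] := xab j; case: eqP => [ji|]; last by rewrite xa.
  by rewrite gt_max ji xt -ji xa.
have volE c : box_volume (cl c) + box_volume (cr c) = box_volume c.
  case: c => [[a b]|]/=; last by rewrite adde0.
  rewrite -EFinD; congr (_%:E).
  rewrite [X in (X + _)%R](bigD1 i)//= [X in (_ + X)%R](bigD1 i)//=.
  rewrite [RHS](bigD1 i)//= !mxE eqxx.
  rewrite (eq_bigr (fun j => Num.max 0 (b ord0 j - a ord0 j)))%R; last first.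
    by move=> j ji; rewrite !mxE (negbTE ji).
  rewrite [X in (_ + _ * X)%R](eq_bigr (fun j => Num.max 0 (b ord0 j - a ord0 j)))%R; last first.
    by move=> j ji; rewrite !mxE (negbTE ji).
  rewrite -mulrDl; congr (_ * _)%R.
  exact: maxr_split.
apply: le_ereal_inf_tmp => _ [c Xc <-].
under eq_eseriesr => k _ do rewrite -volE.
rewrite nneseriesD; [|by move=> k _ _; exact: box_volume_ge0..].
apply: leeD; apply: lebesgue_outer_le => x [/Xc[k _ ck] xH]; exists k => //.
  exact: clP.
exact: crP.
Qed.

Lemma measurable_coord (i : 'I_n) : measurable_fun setT (fun x : V => x ord0 i).
Proof.
apply: (measurability _ (RGenOInfty.measurableE R)) => _ [_ [t ->] <-].
rewrite setTI (_ : _ @^-1` _ = ~` [set x : V | (x ord0 i <= t)%R]).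
  exact/measurableC/measurable_halfspace.
apply/seteqP; split=> x /=; rewrite in_itv/= andbT.
  by rewrite ltNge => /negP.
by move=> /negP; rewrite -ltNge.
Qed.

Lemma measurable_box (c : option (V * V)) : measurable (box c).
Proof.
case: c => [[a b]|]; last exact: measurable0.
rewrite (_ : box _ = \bigcap_(i in setT) [set x : V | (a ord0 i < x ord0 i <= b ord0 i)%R]).
  apply: fin_bigcap_measurable => // i _.
  rewrite (_ : mkset _ = (fun x : V => x ord0 i) @^-1` `]a ord0 i, b ord0 i]).
    by rewrite -[X in measurable X]setTI; exact: measurable_coord.
  by apply/seteqP; split => x /=; rewrite in_itv.
by apply/seteqP; split => x H i //=; exact: H.
Qed.

(** A dilation multiplies the outer measure by a constant and every test set is a preimage, so the
    Carathéodory criterion is preserved. *)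
Lemma measurable_shrink (r : R) (z : V) : (0 < r)%R ->
  measurable_fun setT (shrink r z).
Proof.
move=> r0 _ A mA; rewrite setTI; apply: le_caratheodory_measurable => X.
have [Y ->] : exists Y, X = shrink r z @^-1` Y.
  exists (shrink r^-1%R (- (r *: z)) @^-1` X).
  rewrite -comp_preimage (_ : _ \o _ = id)//; apply/funext => y /=.
  by apply/rowP => i; rewrite !mxE opprK mulrBr subrK mulrA mulVf ?mul1r// gt_eqF.
rewrite preimage_setC -(preimage_setI _ Y A) -(preimage_setI _ Y (~` A)).
have E B := lebesgue_outer_shrink z B r0.
have AY := mA Y.
have := E (Y `&` A); have := E (Y `&` ~` A); have := E Y => /= -> -> ->.
by rewrite -ge0_muleDr ?lebesgue_outer_ge0//; rewrite /= in AY; rewrite -AY.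
Qed.

(** Half-open, so that the cells of a subdivision form a partition. *)
Definition cube (z : V) (h : R) : set V := box (Some (z, z + const_mx h)%R).

Lemma cubeE z h y :
  cube z h y = (forall i, (z ord0 i < y ord0 i <= z ord0 i + h)%R).
Proof.
by rewrite /cube /=; apply/propeqP; split => H i; have := H i; rewrite !mxE.
Qed.

Lemma measurable_cube z h : measurable (cube z h).
Proof. exact: measurable_box. Qed.

Lemma lebesgue_unit_cube : lambda (cube 0%R 1%R) = 1.
Proof.
apply/eqP; rewrite eq_le; apply/andP; split.
  apply: le_trans (lebesgue_outer_box_le _) _; rewrite /= lee_fin.
  by rewrite big1// => i _; rewrite !mxE subr0 add0r maxEle ler01.
apply: le_ereal_inf_tmp => _ [c Xc <-].
pose e (k i : nat) (j : 'I_n) := nat_of_ord j == i.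
pose crd (x : V) (i : nat) : R := if insub i is Some j then x ord0 j else 0%R.
have crdE x (j : 'I_n) : crd x j = x ord0 j by rewrite /crd valK.
pose a k := if c k is Some ab then crd ab.1 else fun=> 0%R.
pose b k := if c k is Some ab then crd ab.2 else fun=> 0%R.
(* The option is read as a boolean: weight 1 for a genuine box and 0 for the empty one. *)
pose w k : \bar R := (c k)%:R%:E.
have := @box_cover_volume R n 0 1 1 a b w ltr01 lee01 _ _.
rewrite subr0 expr1n mule1.
move=> /(_ _ _)/le_trans; apply.
- by move=> k; rewrite lee_fin.
- move=> x x01.
  have /Xc[k _ ck] : cube 0%R 1%R (\row_(i < n) x i)%R.
    by rewrite cubeE => i; rewrite !mxE add0r.
  rewrite (@nneseriesD1 _ _ k)//; last first.
    move=> j _; apply: mule_ge0; rewrite lee_fin//.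
    by apply: prodr_ge0.
  rewrite -[leLHS]adde0; apply: leeD; last first.
    apply: nneseries_ge0 => j _ _; apply: mule_ge0; rewrite lee_fin//.
    by apply: prodr_ge0.
  move: ck; rewrite /w /a /b; case: (c k) => [[p q]|//] /= ck.
  rewrite mul1e lee_fin big1// => i _; rewrite !crdE indicE mem_set//= in_itv/=.
  by have := ck i; rewrite !mxE.
apply: lee_nneseries => k _; first by rewrite mule_ge0// lee_fin// prodr_ge0// => i _; rewrite le_max lexx.
rewrite /w /a /b; case: (c k) => [[p q]|]/=; last by rewrite mul0e.
by rewrite mul1e; under eq_bigr => i _ do rewrite !crdE.
Qed.

Lemma lebesgue_cube z h : (0 < h)%R -> lambda (cube z h) = (h ^+ n)%:E.
Proof.
move=> h0; have hi0 : (0 < h^-1)%R by rewrite invr_gt0.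
have -> : cube z h = shrink h^-1%R z @^-1` cube 0%R 1%R.
  apply/funext => y; rewrite /preimage /= !cubeE; apply/propeqP; split => H i; have := H i;
  rewrite !mxE add0r pmulr_rgt0// subr_gt0 -ler_pdivlMl// ?invrK mulr1 lerBlDl//.
have E := lebesgue_outer_shrink z (cube 0%R 1%R) hi0.
have U : lebesgue_outer (cube 0%R 1%R) = 1 := lebesgue_unit_cube.
by rewrite U mule1 exprVn invrK in E; exact: E.
Qed.

Lemma ge0_integral_shrink (r : R) (z : V) (f : V -> R) : (0 < r)%R ->
  measurable_fun setT f -> (forall x, (0 <= f x)%R) ->
  \int[lambda]_x (f (shrink r z x))%:E = (r ^- n)%:E * \int[lambda]_x (f x)%:E.
Proof.
move=> r0 mf f0.
have rn0 : (0 <= r ^- n)%R by rewrite invr_ge0 exprn_ge0// ltW.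
have mphi := measurable_shrink z r0.
have := @ge0_integral_pushforward _ _ V V R (shrink r z) mphi lambda setT
  (EFin \o f) measurableT.
rewrite preimage_setT => <-; last 2 first.
- exact/measurable_EFinP.
- by move=> x _; rewrite lee_fin.
rewrite -[(r ^- n)%:E]/((NngNum rn0)%:num%:E) -ge0_integral_mscale//; last 2 first.
- exact/measurable_EFinP.
- by move=> x _; rewrite lee_fin.
apply: eq_measure_integral => A mA _.
by rewrite /pushforward /mscale/= [LHS]lebesgue_outer_shrink.
Qed.

Lemma hyperplane_null (i : 'I_n) (t : R) z h : (0 < h)%R ->
  lambda ([set x : V | x ord0 i = t] `&` cube z h) = 0.
Proof.
move=> h0; apply/eqP; rewrite eq_le measure_ge0 andbT.
apply/lee_addgt0Pr => e e0; rewrite add0e.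
(* Thickness for which the slab over a face of the cube has volume [e]. *)
pose d := (e / h ^+ n.-1)%R.
have hn0 : (0 < h ^+ n.-1)%R by rewrite exprn_gt0.
have d0 : (0 < d)%R by rewrite divr_gt0.
pose c : option (V * V) := Some (setc z i (t - d), setc (z + const_mx h) i t).
apply: (@le_trans _ _ (lambda (box c))).
  apply: le_outer_measure => x [/= xt]; rewrite cubeE => xz j; rewrite !mxE.
  by case: eqP => [->|_]; rewrite ?mxE// xt lexx ltrBlDr ltrDl d0.
apply: le_trans (lebesgue_outer_box_le _) _; rewrite /= lee_fin (bigD1 i)//=.
rewrite !mxE eqxx opprB addrC subrK max_r ?(ltW d0)//.
rewrite (eq_bigr (fun=> h)) => [|j ji]; last first.
  by rewrite !mxE (negbTE ji) [(z _ _ + h)%R]addrC addrK max_r// ltW.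
by rewrite prodr_const cardC1 card_ord /d divfK// gt_eqF.
Qed.

End lebesgue_theory.

(** * A smooth bump and its averaging kernel *)

Section flat_exp.
Context {R : realType}.
Implicit Types (t x : R).

(** The powers 1/t^k are included because the derivative of each member is a combination of two
    others. *)
Definition flat_exp (k : nat) t : R :=
  if 0 < t then t^-1 ^+ k * expR (- t^-1) else 0.

Lemma flat_exp_ge0 k t : 0 <= flat_exp k t.
Proof.
rewrite /flat_exp; case: ifP => // t0.
by rewrite mulr_ge0 ?expR_ge0// exprn_ge0// invr_ge0 ltW.
Qed.

Lemma flat_exp_gt0 k t : 0 < t -> 0 < flat_exp k t.
Proof. by move=> t0; rewrite /flat_exp t0 mulr_gt0 ?expR_gt0// exprn_gt0// invr_gt0. Qed.

Lemma flat_exp_le0 k t : t <= 0 -> flat_exp k t = 0.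
Proof. by rewrite /flat_exp ltNge => ->. Qed.

Lemma flat_exp_le k t : flat_exp k t <= k`!%:R.
Proof.
rewrite /flat_exp; case: ifP => // t0.
have x0 : 0 <= t^-1 by rewrite invr_ge0 ltW.
rewrite expRN ler_pdivrMr ?expR_gt0// mulrC.
case: k => [|k].
  rewrite expr0 fact0 mulr1 (le_trans _ (expR_ge1Dx _))// lerDl//.
rewrite -ler_pdivrMr ?ltr0n ?fact_gt0//.
by rewrite (le_trans _ (expR_ge1Dxn k x0))// lerDr.
Qed.

Lemma flat_expS k t : flat_exp k t = t * flat_exp k.+1 t.
Proof.
rewrite /flat_exp; case: ifP => t0; last by rewrite mulr0.
by rewrite exprS !mulrA divff ?mul1r // gt_eqF.
Qed.

Lemma flat_exp_le_norm k t : flat_exp k t <= k.+1`!%:R * `|t|.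
Proof.
have [t0|t0] := leP t 0; first by rewrite flat_exp_le0// mulr_ge0.
by rewrite flat_expS gtr0_norm// mulrC ler_wpM2r ?flat_exp_le// ltW.
Qed.

Lemma flat_exp_homo k : k = 0%N -> {homo flat_exp k : x y / x <= y}.
Proof.
move=> -> x y xy; have [x0|x0] := leP x 0.
  by rewrite flat_exp_le0// flat_exp_ge0.
have y0 := lt_le_trans x0 xy.
rewrite /flat_exp x0 y0 !expr0 !mul1r ler_expR lerN2 lef_pV2//.
Qed.

Definition dflat_exp k t : R := flat_exp k.+2 t - k%:R * flat_exp k.+1 t.

(** At 0 the difference quotient is [flat_exp k.+1], which tends to 0 by [flat_exp_le_norm];
    elsewhere the function is locally elementary. *)
Lemma is_derive_flat_exp k t : is_derive t (1 : R) (flat_exp k) (dflat_exp k t).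
Proof.
have [t0|t0|->] := ltgtP t 0.
- have E : {near t, cst 0 =1 flat_exp k}.
    by near=> x; rewrite flat_exp_le0 ?ltW//; near: x; exact: lt_nbhsl.
  rewrite /dflat_exp !flat_exp_le0 ?ltW// mulr0 subr0.
  apply: DeriveDef; first exact: near_eq_derivable E (derivable_cst _ _ _).
  by rewrite -(near_eq_derive _ E) derive_cst.
- have E : {near t, (fun x => x^-1) ^+ k * (expR \o (- (fun x => x^-1))) =1 flat_exp k}.
    near=> x; have x0 : 0 < x by near: x; exact: lt_nbhsr.
    by rewrite /flat_exp x0 exprfctE.
  have tn0 : t != 0 by rewrite gt_eqF.
  have dV : is_derive t (1 : R) (fun x => x^-1) (- t ^- 2 *: 1).
    exact: (@is_deriveV R id t 1 1 tn0 (is_derive_id _ _)).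
  have H := is_deriveM (is_deriveX k dV)
    (@is_derive1_comp R expR (- (fun x : R => x^-1)) t _ _
       (is_derive_expR (- t^-1)) (is_deriveN dV)).
  apply: DeriveDef; first exact: near_eq_derivable E (@ex_derive _ _ _ _ _ _ _ H).
  rewrite -(near_eq_derive _ E) (@derive_val _ _ _ _ _ _ _ H).
  rewrite /dflat_exp /flat_exp t0 /= /GRing.scale/= mulr1.
  have -> : ((fun x : R => x^-1) ^+ k) t = t^-1 ^+ k by rewrite exprfctE.
  have -> : expR ((- (fun x : R => x^-1)) t) = expR (- t^-1) by [].
  case: k {E H} => [|k]; rewrite !exprS ?expr0 /=; first by field.
  by move: (t^-1 ^+ k) (expR _) => y e; field.
- rewrite /dflat_exp !flat_exp_le0// mulr0 subr0.
  have H : h^-1 *: (flat_exp k (h *: (1:R) + 0) - flat_exp k 0) @[h --> 0^'] --> (0 : R).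
    apply/cvgr0Pnorm_le => e e0; near=> h.
    have hn0 : h != 0 by near: h; exact: nbhs_dnbhs_neq.
    rewrite addr0 (flat_exp_le0 _ (lexx 0)) subr0 /GRing.scale/= mulr1.
    rewrite flat_expS mulrA mulVf// mul1r ger0_norm ?flat_exp_ge0//.
    rewrite (le_trans (flat_exp_le_norm _ _))// -ler_pdivlMl ?ltr0n ?fact_gt0//.
    near: h; apply: dnbhs0_le; rewrite mulr_gt0// invr_gt0 ltr0n fact_gt0//.
  by apply: DeriveDef; [apply/cvg_ex; exists 0 | exact/cvg_lim].
Unshelve. all: by end_near. Qed.

End flat_exp.

(** * A class of smooth functions stable under partial derivatives *)

Section smooth_class.
Context {R : realType} {n : nat}.
Local Notation V := 'rV[R]_n.
Local Notation e_ i := (delta_mx ord0 i : V).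
Implicit Types (f g : V -> R) (i j : 'I_n) (x : V).

(** [smooth] concerns all iterated partial derivatives, so it is proved through a class of
    differentiable functions that contains its own partial derivatives. *)
Inductive flat_exp_fun : (V -> R) -> Prop :=
| flat_exp_fun_cst c : flat_exp_fun (fun=> c)
| flat_exp_fun_coord j : flat_exp_fun (fun x => x ord0 j)
| flat_exp_fun_add f g : flat_exp_fun f -> flat_exp_fun g ->
    flat_exp_fun (fun x => f x + g x)
| flat_exp_fun_mul f g : flat_exp_fun f -> flat_exp_fun g ->
    flat_exp_fun (fun x => f x * g x)
| flat_exp_fun_comp k f : flat_exp_fun f ->
    flat_exp_fun (fun x => flat_exp k (f x)).

Let growth_rate_coord i (g : R -> R) x :
  (fun h : R => h^-1 *: (((fun y : V => g (y ord0 i)) \o shift x) (h *: e_ i) -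
                         g (x ord0 i))) =
  (fun h => h^-1 *: ((g \o shift (x ord0 i)) (h *: (1 : R)) - g (x ord0 i))).
Proof. by apply/funext => h /=; rewrite !mxE !eqxx. Qed.

Lemma derivable_coord1 i (g : R -> R) x : derivable g (x ord0 i) 1 ->
  derivable (fun y : V => g (y ord0 i)) x (e_ i).
Proof. by rewrite /derivable growth_rate_coord. Qed.

Lemma derive_coord1 i (g : R -> R) x :
  'D_(e_ i) (fun y : V => g (y ord0 i)) x = 'D_1 g (x ord0 i).
Proof. by rewrite /derive growth_rate_coord. Qed.

Lemma derive_invariant i f x : (forall h, f (h *: e_ i + x) = f x) ->
  derivable f x (e_ i) /\ 'D_(e_ i) f x = 0.
Proof.
move=> fx; have E : (fun h : R => h^-1 *: ((f \o shift x) (h *: e_ i) - f x)) = cst 0.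
  by apply/funext => h /=; rewrite fx subrr scaler0.
by split; rewrite /derivable /derive E; [exact: is_cvg_cst | exact: lim_cst].
Qed.

Lemma flat_exp_fun_smooth1 f : flat_exp_fun f ->
  (forall x, differentiable f x) /\ forall i, flat_exp_fun (partial i f).
Proof.
elim=> {f} [c|j|f g _ [df Pf] _ [dg Pg]|f g Sf [df Pf] Sg [dg Pg]|k f Sf [df Pf]].
- split=> [x|i]; first exact: differentiable_cst.
  rewrite (_ : partial i _ = fun=> 0); first exact: flat_exp_fun_cst.
  by apply/funext => x; exact: derive_cst.
- split=> [x|i]; first exact: differentiable_coord.
  have [->|ij] := eqVneq i j.
    rewrite (_ : partial j _ = fun=> 1); first exact: flat_exp_fun_cst.
    by apply/funext => x; rewrite /partial (derive_coord1 _ id) derive_id.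
  rewrite (_ : partial i _ = fun=> 0); first exact: flat_exp_fun_cst.
  apply/funext => x; apply: (derive_invariant _).2 => h.
  by rewrite !mxE eqxx/= eq_sym (negbTE ij) mulr0 add0r.
- split=> [x|i]; first exact: differentiableD.
  rewrite (_ : partial i _ = fun x => partial i f x + partial i g x).
    exact: flat_exp_fun_add.
  by apply/funext => x; apply: deriveD; exact: diff_derivable.
- split=> [x|i]; first exact: differentiableM.
  rewrite (_ : partial i _ = fun x => f x * partial i g x + g x * partial i f x).
    by apply: flat_exp_fun_add; exact: flat_exp_fun_mul.
  by apply/funext => x; apply: deriveM; exact: diff_derivable.
- have dE t : differentiable (flat_exp k : R -> R) t.
    by apply/derivable1_diffP; exact: (@ex_derive _ _ _ _ _ _ _ (is_derive_flat_exp k t)).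
  split=> [x|i]; first exact: differentiable_comp.
  rewrite (_ : partial i _ = fun x => partial i f x *
      (flat_exp k.+2 (f x) + (- k%:R) * flat_exp k.+1 (f x))).
    apply: flat_exp_fun_mul => //; apply: flat_exp_fun_add.
      exact: flat_exp_fun_comp.
    apply: flat_exp_fun_mul; [exact: flat_exp_fun_cst|exact: flat_exp_fun_comp].
  apply/funext => x; rewrite /partial deriveE; last exact: differentiable_comp.
  rewrite (diff_comp (df x) (dE (f x)))/= -(deriveE _ (df x)).
  rewrite deriv1E; last exact: (@ex_derive _ _ _ _ _ _ _ (is_derive_flat_exp k _)).
  by rewrite derive1E (@derive_val _ _ _ _ _ _ _ (is_derive_flat_exp k (f x))) mulNr.
Qed.

Lemma flat_exp_fun_smooth f : flat_exp_fun f -> smooth f.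
Proof.
move=> Sf s; have Sg : flat_exp_fun (foldr partial f s).
  by elim: s => //= i s IH; exact: (flat_exp_fun_smooth1 IH).2.
have [dg _] := flat_exp_fun_smooth1 Sg.
split=> [x|x i]; first exact: differentiable_continuous.
exact: diff_derivable.
Qed.

Lemma flat_exp_fun_prod (r : seq 'I_n) (P : pred 'I_n) (F : 'I_n -> V -> R) :
  (forall i, flat_exp_fun (F i)) ->
  flat_exp_fun (fun x => \prod_(i <- r | P i) F i x).
Proof.
move=> SF; elim: r => [|i r IH].
  rewrite (_ : (fun _ => _) = fun=> 1); first exact: flat_exp_fun_cst.
  by apply/funext => x; rewrite big_nil.
rewrite (_ : (fun _ => _) = if P i then fun x => F i x * \prod_(i <- r | P i) F i x
  else fun x => \prod_(i <- r | P i) F i x).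
  by case: ifP => // _; exact: flat_exp_fun_mul.
by apply/funext => x; rewrite big_cons; case: ifP.
Qed.

End smooth_class.

(** * A bump function with an explicit primitive *)

Section bump.
Context {R : realType}.
Implicit Types (t : R).

(** Nonpositive for t <= 0 and constant for t >= 1, so [step] rises smoothly from 0 to a constant
    over the unit interval. Its derivative [bump] thus has a primitive built from [flat_exp]. *)
Definition step_arg t : R := flat_exp 0 1 - flat_exp 0 (1 - t).

Definition step t : R := flat_exp 0 (step_arg t).

Definition bump t : R := flat_exp 2 (step_arg t) * flat_exp 2 (1 - t).

(** A primitive of [bump] minus its unit translate that vanishes outside (0, 2). *)
Definition hat t : R := step t - step (t - 1).

Lemma is_derive_step t : is_derive t (1 : R) step (bump t).
Proof.
have d1 : is_derive t (1 : R) (fun s => 1 - s) (-1).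
  have := is_deriveB (is_derive_cst (1 : R) t 1) (is_derive_id t (1 : R)).
  by rewrite sub0r.
have d2 : is_derive t (1 : R) step_arg (flat_exp 2 (1 - t)).
  have d := @is_derive1_comp R (flat_exp 0) (fun s => 1 - s) t _ _
    (is_derive_flat_exp 0 (1 - t)) d1.
  have := is_deriveB (is_derive_cst (flat_exp 0 1 : R) t 1) d.
  by rewrite /dflat_exp mul0r subr0 mulrN1 sub0r opprK.
have := @is_derive1_comp R (flat_exp 0) step_arg t _ _
  (is_derive_flat_exp 0 (step_arg t)) d2.
by rewrite /dflat_exp mul0r subr0.
Qed.

Lemma step_arg_le0 t : t <= 0 -> step_arg t <= 0.
Proof.
by move=> t0; rewrite subr_le0; apply: flat_exp_homo => //; rewrite lerDl oppr_ge0.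
Qed.

Lemma step_ge0 t : 0 <= step t. Proof. exact: flat_exp_ge0. Qed.

Lemma step_le1 t : step t <= 1. Proof. exact: (flat_exp_le 0). Qed.

Lemma step0 t : t <= 0 -> step t = 0.
Proof. by move=> t0; rewrite /step flat_exp_le0// step_arg_le0. Qed.

Lemma step1 t : 1 <= t -> step t = step 1.
Proof.
by move=> t1; rewrite /step /step_arg !(flat_exp_le0 _ (_ : 1 - _ <= 0))// subr_le0.
Qed.

Lemma bump_ge0 t : 0 <= bump t.
Proof. by rewrite mulr_ge0 ?flat_exp_ge0. Qed.

Lemma bump_le4 t : bump t <= 4.
Proof.
have -> : 4 = 2`!%:R * 2`!%:R :> R by rewrite -natrM.
by rewrite ler_pM ?flat_exp_ge0 ?flat_exp_le.
Qed.

Lemma bump_gt0 t : 0 < t < 1 -> 0 < bump t.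
Proof.
move=> /andP[t0 t1]; rewrite mulr_gt0// flat_exp_gt0 ?subr_gt0//.
rewrite /flat_exp ltr01 !subr_gt0 t1 !expr0 !mul1r ltr_expR ltrN2.
by rewrite invr1 invf_gt1 ?subr_gt0// gtrBl.
Qed.

Lemma bump_neq0 t : bump t != 0 -> 0 < t < 1.
Proof.
apply: contraR; rewrite negb_and -!leNgt => /orP[t0|t1].
  by rewrite /bump flat_exp_le0 ?mul0r// step_arg_le0.
by rewrite /bump (flat_exp_le0 2 (_ : 1 - t <= 0)) ?mulr0// subr_le0.
Qed.

Lemma hat_le1 t : `|hat t| <= 1.
Proof.
have := step_ge0 t; have := step_le1 t; have := step_ge0 (t - 1).
have := step_le1 (t - 1); rewrite /hat ler_norml.
by move: (step t) (step (t - 1)) => a b *; apply/andP; split; lra.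
Qed.

Lemma hat_neq0 t : hat t != 0 -> 0 < t < 2.
Proof.
apply: contraR; rewrite negb_and -!leNgt => /orP[t0|t1].
  by rewrite /hat !step0 ?subrr//; lra.
by rewrite /hat !(@step1 _) ?subrr//; lra.
Qed.

Lemma continuous_flat_exp k : continuous (flat_exp k : R -> R).
Proof.
move=> t; apply/differentiable_continuous/derivable1_diffP.
exact: (@ex_derive _ _ _ _ _ _ _ (is_derive_flat_exp k t)).
Qed.

Let measurable_flat_exp1 k :
  measurable_fun setT (fun t : R => flat_exp k (1 - t)).
Proof.
have m1 : measurable_fun setT (fun t : R => 1 - t).
  by apply: measurable_funB; [exact: measurable_cst|exact: measurable_id].
have mE : measurable_fun setT (flat_exp k : R -> R).
  by apply: continuous_measurable_fun; exact: continuous_flat_exp.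
exact: (measurableT_comp mE m1).
Qed.

Lemma measurable_step_arg : measurable_fun setT step_arg.
Proof. by apply: measurable_funB => //; exact: measurable_cst. Qed.

Lemma measurable_step : measurable_fun setT step.
Proof.
apply: measurableT_comp measurable_step_arg.
by apply: continuous_measurable_fun; exact: continuous_flat_exp.
Qed.

Lemma measurable_hat : measurable_fun setT hat.
Proof.
apply: measurable_funB; first exact: measurable_step.
apply: measurableT_comp measurable_step _.
by apply: measurable_funB; [exact: measurable_id|exact: measurable_cst].
Qed.

Lemma measurable_bump : measurable_fun setT bump.
Proof.
apply: measurable_funM.
  apply: measurableT_comp measurable_step_arg.
  by apply: continuous_measurable_fun; exact: continuous_flat_exp.
exact: measurable_flat_exp1.
Qed.

End bump.

(** * The averaging kernel of a cube and the potential of a difference of kernels *)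

Section kernel.
Context {R : realType} {n : nat}.
Local Notation V := 'rV[R]_n.
Local Notation lambda := (@lebesgue R n).
Local Notation e_ i := (delta_mx ord0 i : V).
Implicit Types (u f : V -> R) (y z : V) (i j : 'I_n).

Definition eta y : R := \prod_j bump (y ord0 j).

Definition kernel h z y : R := eta (shrink h^-1 z y).

(** The kernel with its [i]-th bump replaced by h times [hat]: the [i]-th derivative is then the
    kernel of the cube minus that of its neighbour in direction [i]. *)
Definition potential h z i y : R :=
  h * hat (shrink h^-1 z y ord0 i) *
  \prod_(j | j != i) bump (shrink h^-1 z y ord0 j).

Lemma eta_ge0 y : 0 <= eta y.
Proof. by apply: prodr_ge0 => j _; exact: bump_ge0. Qed.

Lemma prod_bump_le (P : pred 'I_n) y : \prod_(j | P j) bump (y ord0 j) <= 4 ^+ n.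
Proof.
apply: (@le_trans _ _ (\prod_(j | P j) 4)).
  by apply: ler_prod => j _; rewrite bump_ge0 bump_le4.
rewrite prodr_const; apply: ler_weXn2l; first by lra.
by rewrite -[leqRHS]card_ord max_card.
Qed.

Lemma eta_le y : eta y <= 4 ^+ n. Proof. exact: prod_bump_le. Qed.

Lemma eta_neq0 y : eta y != 0 -> forall j, 0 < y ord0 j < 1.
Proof. by move=> /prodf_neq0 H j; exact/bump_neq0/H. Qed.

Lemma measurable_eta : measurable_fun setT eta.
Proof.
apply: measurable_prod => j _; apply: measurableT_comp measurable_bump _.
exact: measurable_coord.
Qed.

Lemma measurable_kernel h z : 0 < h -> measurable_fun setT (kernel h z).
Proof.
move=> h0; apply: measurableT_comp measurable_eta _.
by apply: measurable_shrink; rewrite invr_gt0.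
Qed.

Lemma measurable_potential h z i : 0 < h -> measurable_fun setT (potential h z i).
Proof.
move=> h0.
have mc j : measurable_fun setT (fun y : V => shrink h^-1 z y ord0 j).
  apply: (measurableT_comp (measurable_coord j)).
  by apply: measurable_shrink; rewrite invr_gt0.
apply: measurable_funM.
  apply: measurable_funM; first exact: measurable_cst.
  exact: (measurableT_comp measurable_hat (mc i)).
under eq_fun do rewrite big_mkcond/=.
apply: measurable_prod => j _; case: (j != i).
  exact: (measurableT_comp measurable_bump (mc j)).
exact: measurable_cst.
Qed.

Lemma kernel_ge0 h z y : 0 <= kernel h z y. Proof. exact: eta_ge0. Qed.

Lemma kernel_le h z y : kernel h z y <= 4 ^+ n. Proof. exact: eta_le. Qed.

Lemma kernel_neq0 h z y : 0 < h -> kernel h z y != 0 -> cube z h y.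
Proof.
move=> h0 /eta_neq0 H; rewrite cubeE => j; have := H j.
rewrite !mxE pmulr_rgt0 ?invr_gt0// subr_gt0 ltr_pdivrMl// mulr1 => /andP[-> /=].
by rewrite ltrBlDl => /ltW.
Qed.

Lemma potential_le h z i y : 0 < h -> `|potential h z i y| <= h * 4 ^+ n.
Proof.
move=> h0; rewrite !normrM (gtr0_norm h0) -mulrA ler_wpM2l ?(ltW h0)//.
rewrite -[leRHS]mul1r ler_pM//; first exact: hat_le1.
rewrite ger0_norm ?prod_bump_le// prodr_ge0// => j _.
exact: bump_ge0.
Qed.

Lemma potential_neq0 h z i y : 0 < h -> potential h z i y != 0 ->
  (0 < shrink h^-1 z y ord0 i < 2) /\
  (forall j, j != i -> 0 < shrink h^-1 z y ord0 j < 1).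
Proof.
move=> h0; rewrite !mulf_eq0 !negb_or => /andP[/andP[_ /hat_neq0 Hi] /prodf_neq0 H].
by split => // j ji; exact/bump_neq0/H.
Qed.

Lemma potential_support h z i y : 0 < h -> potential h z i y != 0 ->
  (cube z h `|` cube (z + h *: e_ i) h) y.
Proof.
move=> h0 /(potential_neq0 h0)[+ Hj]; rewrite !mxE => /andP[yi0 yi2].
move: yi0; rewrite pmulr_rgt0 ?invr_gt0// subr_gt0 => yi0.
move: yi2; rewrite ltr_pdivrMl// => yi2.
have Hj' j : j != i -> z ord0 j < y ord0 j <= z ord0 j + h.
  move=> /Hj; rewrite !mxE pmulr_rgt0 ?invr_gt0// subr_gt0 ltr_pdivrMl// mulr1.
  by move=> /andP[-> /=]; rewrite ltrBlDl => /ltW.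
have [yi|yi] := leP (y ord0 i) (z ord0 i + h); [left|right]; rewrite cubeE => j.
  have [->|/Hj'//] := eqVneq j i; rewrite yi0//.
rewrite !mxE eqxx/=; have [->|ji] := eqVneq j i.
  by rewrite mulr1 yi/=; move: yi2; lra.
by rewrite mulr0 addr0 Hj'.
Qed.

Lemma partial_potential h z i y : 0 < h ->
  partial i (potential h z i) y = kernel h z y - kernel h (z + h *: e_ i) y.
Proof.
move=> h0; have hn0 : h != 0 by rewrite gt_eqF.
pose g1 (t : R) := h * hat (h^-1 * (t - z ord0 i)).
pose f1 (y : V) := g1 (y ord0 i).
pose f2 (y : V) := \prod_(j | j != i) bump (shrink h^-1 z y ord0 j).
have dl (c t : R) : is_derive t (1 : R) (fun s => h^-1 * (s - c)) h^-1.
  have := is_deriveZ h^-1 (is_deriveB (is_derive_id t (1 : R)) (is_derive_cst (c : R) t 1)).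
  by rewrite subr0 /GRing.scale/= mulr1.
have eq_is_derive (f g : R -> R) (t d : R) : is_derive t (1 : R) f d ->
    (forall s, g s = f s) -> is_derive t (1 : R) g d.
  by move=> fd /funext ->.
have dg1 t : is_derive t (1 : R) g1
    (bump (h^-1 * (t - z ord0 i)) - bump (h^-1 * (t - z ord0 i) - 1)).
  have d1 := @is_derive1_comp R step _ t _ _ (is_derive_step _) (dl (z ord0 i) t).
  have d2 := @is_derive1_comp R step _ t _ _ (is_derive_step _) (dl (z ord0 i + h) t).
  have gen (a b : R) : h *: (a / h - b / h : R) = a - b.
    by rewrite /GRing.scale/= -mulrBl mulrCA divff// mulr1.
  have := is_deriveZ h (is_deriveB d1 d2); rewrite gen => d12.
  have E s : h^-1 * (s - (z ord0 i + h)) = h^-1 * (s - z ord0 i) - 1.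
    by rewrite opprD addrA mulrBr mulVf.
  rewrite E in d12; refine (eq_is_derive _ _ _ _ d12 _) => s.
  by rewrite /g1 /hat -E.
have f2i s : f2 (s *: e_ i + y) = f2 y.
  apply: eq_bigr => j ji; congr bump.
  by rewrite !mxE eqxx/= (negbTE ji) mulr0 add0r.
have [df2 Df2] := derive_invariant f2i.
have df1 : derivable f1 y (e_ i).
  apply: derivable_coord1; exact: (@ex_derive _ _ _ _ _ _ _ (dg1 _)).
have Df1 : 'D_(e_ i) f1 y = bump (h^-1 * (y ord0 i - z ord0 i)) -
    bump (h^-1 * (y ord0 i - z ord0 i) - 1).
  by rewrite derive_coord1 (@derive_val _ _ _ _ _ _ _ (dg1 _)).
have -> : potential h z i = f1 * f2.
  by apply/funext => x; rewrite /potential /f1 /g1 !mxE.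
rewrite /partial (deriveM df1 df2) Df1 Df2 scaler0 add0r.
rewrite -[_ *: _]/(f2 y * _).
rewrite /kernel /eta [X in _ = X - _](bigD1 i)//= [X in _ = _ - X](bigD1 i)//=.
rewrite [X in _ = _ - _ * X](_ : _ = f2 y); last first.
  apply: eq_bigr => j ji; congr bump.
  by rewrite !mxE eqxx/= (negbTE ji) mulr0 addr0.
rewrite -mulrBl mulrC -/(f2 y); congr (_ * _).
rewrite !mxE !eqxx mulr1; congr (_ - bump _).
by field.
Qed.

(** Every factor lies in the class [flat_exp_fun], and the support is inside the closed cube of side
    2 h. *)
Lemma potential_test h z i : 0 < h -> test_function (potential h z i).
Proof.
move=> h0; split.
  have Sc j : flat_exp_fun (fun y : V => shrink h^-1 z y ord0 j).
    rewrite (_ : (fun _ => _) = fun y : V => h^-1 * (y ord0 j + (- z ord0 j))).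
      apply: flat_exp_fun_mul; first exact: flat_exp_fun_cst.
      by apply: flat_exp_fun_add; [exact: flat_exp_fun_coord|exact: flat_exp_fun_cst].
    by apply/funext => y; rewrite !mxE.
  have Sadd f c : flat_exp_fun f -> flat_exp_fun (fun y : V => f y + c).
    by move=> Sf; apply: flat_exp_fun_add => //; exact: flat_exp_fun_cst.
  have Sopp f c : flat_exp_fun f -> flat_exp_fun (fun y : V => c - f y).
    move=> Sf; rewrite (_ : (fun _ => _) = fun y => c + (-1) * f y).
      apply: flat_exp_fun_add; first exact: flat_exp_fun_cst.
      by apply: flat_exp_fun_mul => //; exact: flat_exp_fun_cst.
    by apply/funext => y; rewrite mulN1r.
  have Sarg f : flat_exp_fun f -> flat_exp_fun (fun y : V => step_arg (f y)).
    by move=> Sf; apply: (Sopp _ (flat_exp 0 1)); apply: flat_exp_fun_comp; exact: Sopp.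
  have Sstep f : flat_exp_fun f -> flat_exp_fun (fun y : V => step (f y)).
    by move=> Sf; apply: flat_exp_fun_comp; exact: Sarg.
  have Sbump f : flat_exp_fun f -> flat_exp_fun (fun y : V => bump (f y)).
    move=> Sf; apply: flat_exp_fun_mul; apply: flat_exp_fun_comp; first exact: Sarg.
    exact: Sopp.
  apply: flat_exp_fun_smooth; apply: flat_exp_fun_mul; last first.
    by apply: flat_exp_fun_prod => j; exact: Sbump.
  apply: flat_exp_fun_mul; first exact: flat_exp_fun_cst.
  rewrite (_ : (fun _ => _) = fun y : V => step (shrink h^-1 z y ord0 i) +
      (-1) * step (shrink h^-1 z y ord0 i + (-1))).
    apply: flat_exp_fun_add; first exact: Sstep.
    by apply: flat_exp_fun_mul; [exact: flat_exp_fun_cst|exact/Sstep/Sadd].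
  by apply/funext => y; rewrite /hat mulN1r.
pose B := [set y : V | forall j, `[z ord0 j, z ord0 j + 2 * h]%classic (y ord0 j)].
have cB : compact B.
  by apply: (@rV_compact _ _ (fun j => `[z ord0 j, z ord0 j + 2 * h]%classic)) => j;
    exact: segment_compact.
apply: (subclosed_compact (@closed_closure _ _) cB).
have clB : closed B by exact: (compact_closed (@norm_hausdorff _ _) cB).
have -> : B = closure B by exact/closure_id.
apply: closure_subset => y /= /(potential_neq0 h0)[Hi Hj] j.
have : 0 < shrink h^-1 z y ord0 j < 2.
  by have [->//|/Hj/andP[-> /=]] := eqVneq j i; lra.
rewrite !mxE /= in_itv/= pmulr_rgt0 ?invr_gt0// subr_gt0 ltr_pdivrMl//.
by move=> /andP[/ltW -> /=]; rewrite ltrBlDl mulrC => /ltW.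
Qed.

End kernel.

(** * Convergence of integrals *)

Lemma cvg_norm_powR (R : realType) (x : nat -> R) (l t : R) : 1 <= t ->
  x @ \oo --> l -> (fun k => `|x k| `^ t) @ \oo --> `|l| `^ t.
Proof.
move=> t1 xl; have t0 : 0 <= t - 1 by rewrite subr_ge0.
pose C := t * ((`|l| + 1) `^ (t - 1) + `|l| `^ (t - 1)).
have C0 : 0 <= C by rewrite mulr_ge0 ?(le_trans _ t1)// addr_ge0// powR_ge0.
apply/cvgrPdist_le => e e0.
have e1 : 0 < Num.min 1 (e / (C + 1)).
  by rewrite lt_min ltr01 divr_gt0// ltr_wpDl.
move/cvgrPdist_le : xl => /(_ _ e1); apply: filterS => k.
rewrite le_min => /andP[k1 ke].
have xk : `|x k| <= `|l| + 1.
  by rewrite -[x k](subKr l) (le_trans (ler_normB _ _))// lerD2l.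
apply: le_trans (powR_sub_le t1 (normr_ge0 _) (normr_ge0 _)) _.
apply: (@le_trans _ _ (C * `|l - x k|)).
  rewrite ler_pM ?mulr_ge0 ?addr_ge0 ?powR_ge0 ?(le_trans _ t1)//.
    rewrite addrC ler_wpM2l ?(le_trans _ t1)// lerD2r le_powR2//.
  exact: ler_dist_dist.
apply: (@le_trans _ _ (C * (e / (C + 1)))); first by rewrite ler_wpM2l.
rewrite mulrCA ler_piMr ?(ltW e0)// ler_pdivrMr ?ltr_wpDl// mul1r.
by rewrite lerDl.
Qed.

Lemma cvg_series_norm (R : realType) (x : nat -> R) :
  (\sum_(k <oo) `|x k|%:E < +oo)%E -> cvgn (series (fun k => `|x k|)).
Proof.
move=> xoo; apply: nondecreasing_is_cvgn.
  by apply/nondecreasing_seqP => k; rewrite seriesSr lerDl.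
exists (fine (\sum_(k <oo) `|x k|%:E)%E) => _ [k _ <-].
rewrite -lee_fin fineK; last first.
  by rewrite ge0_fin_numE//; apply: nneseries_ge0 => i _ _; rewrite lee_fin.
rewrite /series/= -sumEFin; apply: (@nneseries_lim_ge _ (fun k => `|x k|%:E)) => i _ _.
by rewrite lee_fin.
Qed.

Section measure_lemmas.
Context d (T : measurableType d) (R : realType) (mu : {measure set T -> \bar R}).
Variables (D : set T) (mD : measurable D).
Implicit Types (f : nat -> T -> R) (l : T -> R).
Local Open Scope ereal_scope.

(** The sum of the moduli has a finite integral, hence is finite almost everywhere. *)
Lemma summable_ae f : (forall k, measurable_fun D (f k)) ->
  \sum_(k <oo) \int[mu]_(x in D) `|f k x|%:E < +oo ->
  {ae mu, forall x, D x -> \sum_(k <oo) `|f k x|%:E < +oo}.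
Proof.
move=> mf foo.
have mnf k : measurable_fun D (fun x => `|f k x|%:E).
  by apply/measurable_EFinP; apply: measurableT_comp (mf k).
have s0 x : 0 <= \sum_(k <oo) `|f k x|%:E.
  by apply: nneseries_ge0 => k _ _; rewrite lee_fin.
have intg : mu.-integrable D (fun x => \sum_(k <oo) `|f k x|%:E).
  apply/integrableP; split.
    by apply: ge0_emeasurable_sum => [k x Dx _|k _]; [rewrite lee_fin|exact: mnf].
  under eq_integral => x _ do rewrite gee0_abs//.
  by rewrite integral_nneseries// => k x _; rewrite lee_fin.
apply: filterS (integrable_ae mD intg) => x + Dx => /(_ Dx).
by rewrite ge0_fin_numE.
Qed.

Lemma fatou_powR f l (t : R) (K : \bar R) : (1 <= t)%R ->
  (forall k, measurable_fun D (f k)) -> measurable_fun D l ->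
  {ae mu, forall x, D x -> f ^~ x @ \oo --> l x} ->
  (forall k, \int[mu]_(x in D) (`|f k x| `^ t)%:E <= K) ->
  \int[mu]_(x in D) (`|l x| `^ t)%:E <= K.
Proof.
move=> t1 mf ml fl fK.
have mpow (g : T -> R) : measurable_fun D g ->
    measurable_fun D (fun x => (`|g x| `^ t)%:E).
  move=> mg; apply/measurable_EFinP.
  apply: (measurableT_comp (measurable_powR t)).
  exact: measurableT_comp mg.
have pow0 (g : T -> R) x : 0 <= (`|g x| `^ t)%:E by rewrite lee_fin powR_ge0.
have [N [mN muN subN]] := fl.
have mDN : measurable (D `\` N) by exact: measurableD.
rewrite (ge0_negligible_integral mN mD (mpow _ ml) _ muN)//.
have lE x : (D `\` N) x ->
    limn_einf (fun k => (`|f k x| `^ t)%:E) = (`|l x| `^ t)%:E.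
  move=> [Dx Nx]; have fx : f ^~ x @ \oo --> l x.
    by apply: contrapT => nfx; apply: Nx; apply: subN => /(_ Dx).
  by apply: (cvg_limn_einf_sup _).1; apply: cvg_EFin; [exact: nearW|exact: cvg_norm_powR].
have mDf k : measurable_fun (D `\` N) (fun x => (`|f k x| `^ t)%:E).
  by apply: measurable_funS (mpow _ (mf k)).
have := @fatou _ _ _ mu _ mDN (fun k x => (`|f k x| `^ t)%:E) mDf
  (fun k x _ => pow0 _ _).
rewrite (eq_integral (fun x => (`|l x| `^ t)%:E)); last first.
  by move=> x; rewrite inE => /lE.
move=> /le_trans; apply; rewrite limn_einf_lim.
apply: lime_le; first exact: is_cvg_einfs.
near=> k; apply: (@le_trans _ _ (\int[mu]_(x in D `\` N) (`|f k x| `^ t)%:E)).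
  by apply: ereal_inf_lbound; exists k => /=.
apply: le_trans (fK k); apply: ge0_subset_integral => //.
exact: mpow (mf k).
Unshelve. all: by end_near. Qed.

End measure_lemmas.

(** * Local averages and weak gradients *)

Lemma integral_support d (T : measurableType d) (R : realType)
    (mu : {measure set T -> \bar R}) (D : set T) (f : T -> \bar R) :
  measurable D -> (forall x, ~ D x -> f x = 0%E) ->
  (\int[mu]_x f x = \int[mu]_(x in D) f x)%E.
Proof.
move=> mD f0; rewrite [RHS]integral_mkcond; apply: eq_integral => x _.
by rewrite patchE; case: ifPn => //; rewrite notin_setE => /f0.
Qed.

Section norm_integrals.
Context d (T : measurableType d) (R : realType) (mu : {measure set T -> \bar R}).
Variables (D : set T) (mD : measurable D).
Implicit Types f g : T -> R.

Lemma measurable_normE f : measurable_fun D f ->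
  measurable_fun D (fun x => `|f x|%:E).
Proof.
by move=> mf; apply/measurable_EFinP; exact: measurableT_comp.
Qed.

Lemma integral_normZl f (k : R) : measurable_fun D f -> 0 <= k ->
  (\int[mu]_(x in D) (k * `|f x|)%:E = k%:E * \int[mu]_(x in D) `|f x|%:E)%E.
Proof.
move=> mf k0; under eq_integral => x _ do rewrite EFinM.
rewrite ge0_integralZl//; first exact: measurable_normE.
Qed.

Lemma le_integral_norm f g : measurable_fun D f -> measurable_fun D g ->
  (forall x, D x -> `|f x| <= g x) ->
  (\int[mu]_(x in D) `|f x|%:E <= \int[mu]_(x in D) (g x)%:E)%E.
Proof.
move=> mf mg fg; apply: ge0_le_integral.
- exact: mD.
- by move=> x _; rewrite lee_fin.
- exact: measurable_normE.
- exact/measurable_EFinP.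
- by move=> x Dx; rewrite lee_fin fg.
Qed.

End norm_integrals.

Lemma EFin_divr (R : realType) (a m : R) :
  (a / m)%:E = ((m^-1)%:E * a%:E)%E.
Proof. by rewrite -EFinM mulrC. Qed.

Section averages.
Context {R : realType} {n : nat}.
Local Notation V := 'rV[R]_n.
Local Notation lambda := (@lebesgue R n).
Local Notation e_ i := (delta_mx ord0 i : V).
Implicit Types (u f : V -> R) (y z : V) (i j : 'I_n).

Lemma L1loc_integrable_cube f z h : L1loc lambda f ->
  lambda.-integrable (cube z h) (EFin \o f).
Proof.
move=> [mf Kf]; apply/integrableP; split.
  by apply/measurable_EFinP; exact: measurable_funTS.
pose B := [set y : V | forall j, `[z ord0 j, z ord0 j + h]%classic (y ord0 j)].
have cB : compact B.
  by apply: (@rV_compact _ _ (fun j => `[z ord0 j, z ord0 j + h]%classic)) => j;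
    exact: segment_compact.
apply: le_lt_trans (Kf _ cB); apply: ge0_subset_integral.
- exact: measurable_cube.
- rewrite (_ : B = \bigcap_(j in setT) (fun y : V => y ord0 j) @^-1` `[z ord0 j, z ord0 j + h]%classic).
    apply: fin_bigcap_measurable => // j _.
    by rewrite -[X in measurable X]setTI; apply: measurable_coord.
  by apply/seteqP; split=> y H j; [move=> _; exact: H|exact: H].
- by apply/measurable_EFinP; apply: measurableT_comp => //; exact: measurable_funTS.
- by move=> y _; rewrite lee_fin.
- by move=> y; rewrite cubeE => H j /=; rewrite in_itv/=; have /andP[/ltW -> ->] := H j.
Qed.

Definition eta_mass : R := fine (\int[lambda]_y (eta y)%:E).

Let eta_support y : ~ cube 0 1 y -> (eta y)%:E = 0%E :> \bar R.
Proof.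
move=> H; congr EFin; apply/eqP; apply: contra_notT H => /eta_neq0 H.
by rewrite cubeE => j; have /andP[y0 /ltW y1] := H j; rewrite !mxE add0r y0.
Qed.

Lemma integral_etaE : (\int[lambda]_y (eta y)%:E = eta_mass%:E)%E.
Proof.
rewrite fineK// ge0_fin_numE; last first.
  by apply: integral_ge0 => y _; rewrite lee_fin eta_ge0.
rewrite (integral_support lambda (measurable_cube 0 1) eta_support).
apply: (@le_lt_trans _ _ (\int[lambda]_(y in cube 0 1) (cst (4 ^+ n)%:E y))%E).
  apply: ge0_le_integral.
  - exact: measurable_cube.
  - by move=> y _; rewrite lee_fin eta_ge0.
  - by apply/measurable_EFinP; apply: measurable_funTS; exact: measurable_eta.
  - exact: measurable_cst.
  - by move=> y _; rewrite lee_fin eta_le.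
rewrite integral_cst/=; last exact: measurable_cube.
have -> : lebesgue (cube 0 1) = 1%E := lebesgue_unit_cube.
by rewrite mule1 ltry.
Qed.

(** [eta] is positive on the cube (1/4, 3/4]^n, which has positive measure. *)
Lemma eta_mass_gt0 : 0 < eta_mass.
Proof.
have e0 : (0 <= \int[lambda]_y (eta y)%:E)%E.
  by apply: integral_ge0 => y _; rewrite lee_fin eta_ge0.
rewrite -lte_fin -integral_etaE lt0e e0 andbT; apply/eqP => int0.
pose C : set V := cube (const_mx 4^-1) 2^-1.
have mC : measurable C := measurable_cube _ _.
have C0 : (0 < lambda C)%E.
  by rewrite lebesgue_cube ?lte_fin ?exprn_gt0// invr_gt0.
have : (\int[lambda]_(y in C) `|(eta y)%:E| = 0)%E.
  apply/eqP; rewrite eq_le integral_ge0// andbT -int0.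
  under eq_integral => y _ do rewrite gee0_abs ?lee_fin ?eta_ge0//.
  apply: ge0_subset_integral.
  - exact: mC.
  - exact: measurableT.
  - by apply/measurable_EFinP; exact: measurable_eta.
  - by move=> y _; rewrite lee_fin eta_ge0.
  - exact: subsetT.
move=> /(ae_eq_integral_abs lambda mC _).1 => /(_ _)[].
  by apply/measurable_EFinP; apply: measurable_funTS; exact: measurable_eta.
move=> N [mN N0 subN].
have : (lambda C <= lambda N)%E.
  apply: le_measure; rewrite ?inE// => y Cy; apply: subN => /(_ Cy) /= /eqP.
  rewrite eqe; apply/negP; rewrite gt_eqF// prodr_gt0// => j _; apply: bump_gt0.
  by move: Cy; rewrite /C cubeE => /(_ j); rewrite !mxE; lra.
by rewrite N0 leNgt C0.
Qed.

Lemma integral_kernel h z : 0 < h ->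
  (\int[lambda]_(y in cube z h) (kernel h z y)%:E = (h ^+ n * eta_mass)%:E)%E.
Proof.
move=> h0; have hi0 : 0 < h^-1 by rewrite invr_gt0.
rewrite -(integral_support lambda (measurable_cube z h)); last first.
  move=> y H; congr EFin; apply/eqP; apply: contra_notT H.
  exact: kernel_neq0.
rewrite (ge0_integral_shrink z hi0 measurable_eta eta_ge0) integral_etaE.
by rewrite exprVn invrK.
Qed.

Definition avg u h z : R :=
  (\int[lambda]_(y in cube z h) (u y * kernel h z y)) / (h ^+ n * eta_mass).

Lemma integrable_kernel u h z : 0 < h ->
  lambda.-integrable (cube z h) (EFin \o u) ->
  lambda.-integrable (cube z h) (EFin \o (fun y => u y * kernel h z y)).
Proof.
move=> h0 iu; have mC := measurable_cube z h.
apply: (le_integrable mC _ _ (integrableZl mC (4 ^+ n) iu)).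
  apply/measurable_EFinP; apply: measurable_funM.
    by apply/measurable_EFinP; exact: measurable_int iu.
  by apply: measurable_funTS; exact: measurable_kernel.
move=> y _ /=; rewrite lee_fin !normrM [in leRHS]ger0_norm ?exprn_ge0//.
by rewrite mulrC ler_wpM2r// ger0_norm ?kernel_ge0 ?kernel_le.
Qed.

Lemma avg_mass_gt0 h : 0 < h -> 0 < h ^+ n * eta_mass.
Proof. by move=> h0; rewrite mulr_gt0 ?eta_mass_gt0// exprn_gt0. Qed.

Lemma avg_le u h z : 0 < h -> lambda.-integrable (cube z h) (EFin \o u) ->
  (`|avg u h z|%:E <=
   (4 ^+ n / (h ^+ n * eta_mass))%:E * \int[lambda]_(y in cube z h) `|u y|%:E)%E.
Proof.
move=> h0 iu; have mC := measurable_cube z h.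
have m0 := avg_mass_gt0 h0.
rewrite /avg normrM (gtr0_norm (_ : 0 < (h ^+ n * eta_mass)^-1)) ?invr_gt0//.
rewrite !EFin_divr -muleA; apply: lee_wpmul2l; first by rewrite lee_fin invr_ge0 ltW.
rewrite EFin_normr_Rintegral//; last exact: integrable_kernel.
apply: le_trans (le_abse_integral _ mC (measurable_int _ (integrable_kernel h0 iu))) _.
have mu_ : measurable_fun (cube z h) u.
  by apply/measurable_EFinP; exact: measurable_int iu.
rewrite -integral_normZl ?exprn_ge0//.
have mk : measurable_fun (cube z h) (fun y => u y * kernel h z y).
  by apply: measurable_funM => //; apply: measurable_funTS; exact: measurable_kernel.
apply: (le_integral_norm lambda mC mk) => [|y _].
  apply: measurable_funM; first exact: measurable_cst.
  exact: measurableT_comp.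
 rewrite normrM mulrC ler_wpM2r//.
by rewrite ger0_norm ?kernel_ge0 ?kernel_le.
Qed.

Lemma avgB u f h z : 0 < h -> lambda.-integrable (cube z h) (EFin \o u) ->
  lambda.-integrable (cube z h) (EFin \o f) ->
  avg (fun y => u y - f y) h z = avg u h z - avg f h z.
Proof.
move=> h0 iu if_; rewrite /avg -mulrBl -RintegralB; first last.
- exact: integrable_kernel.
- exact: integrable_kernel.
- exact: measurable_cube.
by congr (_ / _); apply: eq_Rintegral => y _; rewrite mulrBl.
Qed.

Lemma avg_cst u c h z : 0 < h -> (forall y, cube z h y -> u y = c) ->
  avg u h z = c.
Proof.
move=> h0 uc; have m0 := avg_mass_gt0 h0.
have -> : avg u h z =
    (\int[lambda]_(y in cube z h) (c * kernel h z y)) / (h ^+ n * eta_mass).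
  by congr (_ / _); apply: eq_Rintegral => y; rewrite inE => /uc ->.
have E : \int[lambda]_(y in cube z h) (kernel h z y) = h ^+ n * eta_mass.
  by rewrite /Rintegral integral_kernel.
have ik : lambda.-integrable (cube z h) (EFin \o kernel h z).
  apply/integrableP; split.
    by apply/measurable_EFinP/measurable_funTS; exact: measurable_kernel.
  under eq_integral => y _ do rewrite gee0_abs ?lee_fin ?kernel_ge0//.
  by rewrite integral_kernel// ltry.
rewrite RintegralZl//; last exact: measurable_cube.
by rewrite E mulfK// gt_eqF.
Qed.

(** The two kernels differ by a partial derivative of [potential], so the weak gradient turns the
    difference of the averages into an integral of the [i]-th component of [g] against a function
    bounded by h 4^n and supported in the two cubes. *)
Lemma avg_diff_le u (g : V -> V) h z i : 0 < h -> L1loc lambda u ->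
  is_weak_grad u g ->
  (`|avg u h z - avg u h (z + h *: e_ i)|%:E <=
   (h * 4 ^+ n / (h ^+ n * eta_mass))%:E *
   (\int[lambda]_(y in cube z h) `|g y ord0 i|%:E +
    \int[lambda]_(y in cube (z + h *: e_ i) h) `|g y ord0 i|%:E))%E.
Proof.
move=> h0 lu ug; set z' := z + h *: e_ i; have m0 := avg_mass_gt0 h0.
have mC := measurable_cube z h; have mC' := measurable_cube z' h.
have [lg /(_ _ (potential_test z i h0))] := ug i.
set gi := fun x => g x ord0 i => wk.
have mgi : measurable_fun setT gi := lg.1.
have iT (x : V) : lambda.-integrable setT (EFin \o (fun y => u y * kernel h x y)).
  have mCx := measurable_cube x h.
  have := integrable_kernel h0 (L1loc_integrable_cube x h lu).
  rewrite integrable_mkcond//; apply: eq_integrable => // y _.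
  rewrite patchE; case: ifPn => //; rewrite notin_setE => H /=.
  suff -> : kernel h x y = 0 by rewrite mulr0.
  by apply/eqP; apply: contra_notT H; exact: kernel_neq0.
have cE x : \int[lambda]_(y in cube x h) (u y * kernel h x y) =
    \int[lambda]_y (u y * kernel h x y).
  rewrite /Rintegral (integral_support lambda (measurable_cube x h))//.
  move=> y H /=; suff -> : kernel h x y = 0 by rewrite mulr0.
  by apply/eqP; apply: contra_notT H; exact: kernel_neq0.
rewrite /avg -mulrBl normrM.
rewrite (gtr0_norm (_ : 0 < (h ^+ n * eta_mass)^-1)) ?invr_gt0//.
rewrite !EFin_divr -muleA; apply: lee_wpmul2l; first by rewrite lee_fin invr_ge0 ltW.
rewrite !cE -RintegralB// EFin_normr_Rintegral//; last first.
  have := integrableB measurableT (iT z) (iT z').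
  by apply: eq_integrable.
rewrite (eq_integral (fun x => (u x * partial i (potential h z i) x)%:E)); last first.
  by move=> y _; rewrite partial_potential// mulrBr.
rewrite wk abseN.
have mp : measurable_fun setT (fun x => gi x * potential h z i x).
  by apply: measurable_funM; [exact: mgi|exact: measurable_potential].
have mpE : measurable_fun setT (EFin \o (fun x => gi x * potential h z i x)).
  exact/measurable_EFinP.
apply: le_trans (le_abse_integral _ measurableT mpE) _.
pose U := cube z h `|` cube z' h.
have mU : measurable U by exact: measurableU.
rewrite (integral_support lambda mU); last first.
  move=> y H /=; suff -> : potential h z i y = 0 by rewrite mulr0 normr0.
  by apply/eqP; apply: contra_notT H; exact: potential_support.
have mag D : measurable_fun D (fun y => `|gi y|%:E).
  by apply/measurable_EFinP; apply: measurableT_comp => //; exact: measurable_funTS.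
have hn : 0 <= h * 4 ^+ n by rewrite mulr_ge0 ?exprn_ge0// ltW.
rewrite -/gi; apply: (@le_trans _ _ (\int[lambda]_(y in U) ((h * 4 ^+ n) * `|gi y|)%:E)%E).
  apply: (le_integral_norm lambda mU (measurable_funTS mp)) => [|y _].
  - apply: measurable_funM; first exact: measurable_cst.
    by apply: measurableT_comp => //; exact: measurable_funTS.
  - by rewrite normrM mulrC ler_wpM2r// potential_le.
rewrite integral_normZl//; last exact: measurable_funTS.
rewrite lee_wpmul2l ?lee_fin//.
rewrite (_ : U = cube z h `|` (cube z' h `\` cube z h)); last by rewrite setUDr setDv setD0.
have mD : measurable (cube z' h `\` cube z h) by exact: measurableD.
have disj : [disjoint cube z h & cube z' h `\` cube z h].
  by apply/disj_setPS => y [? []].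
have ag0 y : (cube z h `|` (cube z' h `\` cube z h)) y -> (0 <= `|gi y|%:E)%E.
  by rewrite lee_fin.
rewrite (ge0_integral_setU lambda mC mD (mag _) ag0 disj).
rewrite leeD2l//; apply: ge0_subset_integral.
- exact: mD.
- exact: mC'.
- exact: mag.
- by move=> y _; rewrite lee_fin.
- exact: subDsetl.
Qed.

End averages.

(** * Subdivision of a cube into cells and averages over the cells *)

Section cells.
Context {R : realType} {n : nat} (q : 'rV[R]_n) (L : R) (M : nat).
Hypothesis L0 : 0 < L.
Local Notation V := 'rV[R]_n.
Local Notation lambda := (@lebesgue R n).
Local Notation grid := {ffun 'I_n -> 'I_M.+1}.
Implicit Types (z : grid) (f : V -> R) (y : V).

Definition mesh : R := L / M.+1%:R.
Local Notation h := mesh.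

Definition corner z : V := q + h *: (\row_j (z j)%:R).

Definition cell z : set V := cube (corner z) h.

Lemma mesh_gt0 : 0 < h. Proof. by rewrite divr_gt0. Qed.

Lemma meshE : h * M.+1%:R = L. Proof. by rewrite divfK// pnatr_eq0. Qed.

Lemma cellE z y : cell z y =
  (forall j, q ord0 j + h * (z j)%:R < y ord0 j <= q ord0 j + h * (z j).+1%:R).
Proof.
have E j : corner z ord0 j = q ord0 j + h * (z j)%:R by rewrite !mxE.
have E' j : corner z ord0 j + h = q ord0 j + h * (z j).+1%:R.
  by rewrite E -natr1 mulrDr mulr1 addrA.
by rewrite /cell cubeE; apply/propeqP; split => H j; have := H j; rewrite E' E.
Qed.

Lemma measurable_cell z : measurable (cell z).
Proof. exact: measurable_cube. Qed.

Lemma corner_upd z i : ((z i).+1 < M.+1)%N ->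
  corner (upd z i (inord (z i).+1)) = corner z + h *: delta_mx ord0 i.
Proof.
move=> zi; apply/rowP => j; rewrite !mxE eqxx/= ffunE -addrA -mulrDr.
congr (_ + _ * _); have [->|ji] := eqVneq j i; last by rewrite addr0.
by rewrite inordK// -natr1.
Qed.

Lemma cell_inj z z' y : cell z y -> cell z' y -> z = z'.
Proof.
have hp := mesh_gt0.
rewrite !cellE => H H'; apply/ffunP => j; apply/val_inj/eqP => /=.
wlog zz' : z z' H H' / (z j < z' j)%N.
  move=> W; have [lt|gt|//] := ltngtP (z j) (z' j).
    by have /eqP E := W z z' H H' lt; rewrite E ltnn in lt.
  by have /eqP E := W z' z H' H gt; rewrite E ltnn in gt.
have /andP[_ y1] := H j; have /andP[y2 _] := H' j.
have := lt_le_trans y2 y1; rewrite ltrD2l ltr_pM2l// ltr_nat ltnS.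
by rewrite leqNgt zz'.
Qed.

Lemma cell_sub z : cell z `<=` cube q L.
Proof.
have hp := mesh_gt0.
move=> y; rewrite cellE cubeE => H j; have /andP[y1 y2] := H j.
apply/andP; split.
  by apply: le_lt_trans y1; rewrite lerDl mulr_ge0// ltW.
by apply: le_trans y2 _; rewrite lerD2l -meshE ler_pM2l// ler_nat.
Qed.

Lemma cell_cover y : cube q L y -> exists z, cell z y.
Proof.
have hp := mesh_gt0; rewrite cubeE => H.
have ex j : exists k : 'I_M.+1,
    q ord0 j + h * k%:R < y ord0 j <= q ord0 j + h * k.+1%:R.
  have /andP[y1 y2] := H j.
  (* The index is the least [k] whose upper face is not below y; minimality gives the strict
     inequality at the lower face. *)
  have exk : exists k, y ord0 j <= q ord0 j + h * k.+1%:R.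
    by exists M; rewrite meshE.
  have := ex_minnP exk; case=> k ky kmin.
  have kM : (k < M.+1)%N by rewrite ltnS kmin// meshE.
  exists (Ordinal kM); rewrite /= ky andbT.
  case: k ky kmin kM => [|k] ky kmin kM; first by rewrite mulr0 addr0.
  by rewrite ltNge; apply/negP => /kmin; rewrite ltnn.
have [z zP] := choice ex.
by exists (finfun z); rewrite cellE => j; rewrite ffunE.
Qed.

Lemma integral_cells f : measurable_fun (cube q L) f ->
  (\int[lambda]_(y in cube q L) (f y)%:E =
   \sum_z \int[lambda]_(y in cell z) (f y)%:E)%E.
Proof.
move=> mf.
have QE : cube q L = \big[setU/set0]_(z <- index_enum grid) cell z.
  rewrite -bigcup_seq; apply/seteqP; split => [y /cell_cover[z zy]|y [z _]].
    by exists z => //=; rewrite mem_index_enum.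
  exact: cell_sub.
have tI : trivIset [set` index_enum grid] cell.
  by move=> z z' _ _ [y [zy z'y]]; exact: cell_inj zy z'y.
rewrite [in LHS]QE; apply: integral_bigsetU_EFin.
- exact: measurable_cell.
- exact: index_enum_uniq.
- exact: tI.
- by rewrite -QE; exact/measurable_EFinP.
Qed.

Definition grid_avg f z : R := avg f h (corner z).

Definition step_avg f y : R := \sum_z grid_avg f z * \1_(cell z) y.

Lemma step_avgE f z y : cell z y -> step_avg f y = grid_avg f z.
Proof.
move=> zy; rewrite /step_avg; move: (grid_avg f) => a.
rewrite (bigD1 z) //= indicE (mem_set zy) mulr1 big1 ?addr0// => z' z'z.
suff cz' : ~ cell z' y by rewrite indicE (memNset cz') mulr0.
by move=> z'y; move/eqP : z'z; apply; exact: cell_inj z'y zy.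
Qed.

Lemma measurable_step_avg f : measurable_fun setT (step_avg f).
Proof.
apply: measurable_sum => z; apply: measurable_funM; first exact: measurable_cst.
exact/measurable_indic/measurable_cell.
Qed.

Lemma integral_step_avg f (phi : R -> R) : measurable_fun setT phi ->
  (\int[lambda]_(y in cube q L) (phi (step_avg f y))%:E =
   (h ^+ n * \sum_z phi (grid_avg f z))%:E)%E.
Proof.
move=> mphi; rewrite integral_cells; last first.
  by apply: (measurableT_comp mphi); apply: measurable_funTS; exact: measurable_step_avg.
rewrite mulr_sumr -sumEFin; apply: eq_bigr => z _.
rewrite (eq_integral (cst (phi (grid_avg f z))%:E)) => [|y]; last first.
  by rewrite inE => /step_avgE ->.
rewrite integral_cst/=; last exact: measurable_cell.
have -> : lebesgue (cell z) = (h ^+ n)%:E := lebesgue_cube _ mesh_gt0.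
by rewrite -EFinM mulrC.
Qed.

Lemma integrable_cell f z : lambda.-integrable (cube q L) (EFin \o f) ->
  lambda.-integrable (cell z) (EFin \o f).
Proof.
apply: integrableS; [exact: measurable_cube|exact: measurable_cell|].
exact: cell_sub.
Qed.

(** The volume of a cell cancels the normalisation of the average, so the constant does not depend
    on [M]. *)
Lemma step_avg_contraction f : lambda.-integrable (cube q L) (EFin \o f) ->
  (\int[lambda]_(y in cube q L) `|step_avg f y|%:E <=
   (4 ^+ n / @eta_mass R n)%:E * \int[lambda]_(y in cube q L) `|f y|%:E)%E.
Proof.
move=> intf; have hp := mesh_gt0; have hn0 : 0 < h ^+ n by rewrite exprn_gt0.
have mf : measurable_fun (cube q L) f by apply/measurable_EFinP; exact: measurable_int intf.
rewrite (integral_step_avg f (phi := fun t => `|t|))//.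
rewrite (@integral_cells (fun y => `|f y|) (measurableT_comp _ mf))//.
rewrite ge0_sume_distrr => [|z _]; last by apply: integral_ge0 => y _; rewrite lee_fin.
rewrite mulr_sumr -sumEFin; apply: lee_sum => z _.
have := avg_le hp (integrable_cell z intf).
move=> /(lee_wpmul2l (_ : (0 <= (h ^+ n)%:E)%E)).
rewrite lee_fin => /(_ (ltW hn0)); rewrite -EFinM muleA -EFinM.
suff -> : h ^+ n * (4 ^+ n / (h ^+ n * @eta_mass R n)) = 4 ^+ n / @eta_mass R n by [].
by field; rewrite !gt_eqF// eta_mass_gt0.
Qed.

Lemma step_avgB f g y : lambda.-integrable (cube q L) (EFin \o f) ->
  lambda.-integrable (cube q L) (EFin \o g) ->
  step_avg (fun y => f y - g y) y = step_avg f y - step_avg g y.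
Proof.
move=> intf intg; rewrite /step_avg -sumrB; apply: eq_bigr => z _.
rewrite -mulrBl; congr (_ * _); apply: avgB; first exact: mesh_gt0.
  exact: integrable_cell.
exact: integrable_cell.
Qed.

Lemma integrable_step_avg f : lambda.-integrable (cube q L) (EFin \o step_avg f).
Proof.
apply/integrableP; split.
  by apply/measurable_EFinP/measurable_funTS; exact: measurable_step_avg.
by rewrite (integral_step_avg f (phi := fun t => `|t|))// ltry.
Qed.

Lemma grid_mean_avg f :
  L ^+ n * grid_mean (grid_avg f) = \int[lambda]_(y in cube q L) (step_avg f y).
Proof.
rewrite /Rintegral (integral_step_avg f (phi := id))//= /grid_mean mulrCA -meshE.
by rewrite exprMn -natrX mulrC mulfK// pnatr_eq0 expn_eq0.
Qed.

End cells.

(** The inverse of 1 plus the sum of the inverses works, also for an empty index type. *)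
Lemma finite_pos_lbound (R : realFieldType) (I : finType) (F : I -> R) :
  (forall i, 0 < F i) -> exists2 d : R, 0 < d & forall i, d <= F i.
Proof.
move=> F0; have S0 : 0 <= \sum_i (F i)^-1 by apply: sumr_ge0 => i _; rewrite invr_ge0 ltW.
exists (1 + \sum_i (F i)^-1)^-1; first by rewrite invr_gt0 ltr_pwDl.
move=> i; rewrite -[leRHS]invrK lef_pV2 ?posrE ?invr_gt0// ?ltr_pwDl//.
rewrite (bigD1 i)//= addrCA lerDl addr_ge0// sumr_ge0// => j _.
by rewrite invr_ge0 ltW.
Qed.

Lemma cvge0P (R : realType) (u : nat -> \bar R) : (forall k, (0 <= u k)%E) ->
  u @ \oo --> 0%E <->
  (forall e : R, 0 < e -> exists k0, forall k, (k0 <= k)%N -> (u k <= e%:E)%E).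
Proof.
move=> u0; split=> [/fine_cvgP[uf uc] e e0|H].
  move/cvgrPdist_le : uc => /(_ _ e0) uc.
  have [k0 _ H] := filterI uf uc; exists k0 => k /H /= [fk].
  by rewrite sub0r normrN ger0_norm ?fine_ge0// -lee_fin fineK.
apply/fine_cvgP; split.
  have [k0 H1] := H _ ltr01; exists k0 => // k /H1 uk.
  by rewrite ge0_fin_numE// (le_lt_trans uk)// ltry.
apply/cvgrPdist_le => e e0; have [k0 H1] := H _ e0; exists k0 => // k /= /H1 uk.
rewrite sub0r normrN ger0_norm ?fine_ge0// -lee_fin fineK//.
by rewrite ge0_fin_numE// (le_lt_trans uk)// ltry.
Qed.

(** * Step averages converge in L^1 *)

Section step_avg_convergence.
Import HBSimple.
Context {R : realType} {n : nat} (q : 'rV[R]_n) (L : R).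
Hypothesis L0 : 0 < L.
Local Notation V := 'rV[R]_n.
Local Notation lambda := (@lebesgue R n).
Local Notation Q := (cube q L).
Local Notation C := (4 ^+ n / @eta_mass R n).
Implicit Types (f g : V -> R) (x y : V) (A : set V).

Let mQ : measurable Q. Proof. exact: measurable_cube. Qed.

Let C0 : 0 <= C.
Proof. by rewrite divr_ge0 ?exprn_ge0// ltW// eta_mass_gt0. Qed.

Let muQ : lambda Q = (L ^+ n)%:E. Proof. exact: lebesgue_cube. Qed.

Let err M f := (\int[lambda]_(y in Q) `|step_avg q L M f y - f y|%:E)%E.

(** This class is enlarged from indicators of finite unions of boxes to those of measurable sets,
    then to simple functions and to all of L^1(Q). *)
Let good f := lambda.-integrable Q (EFin \o f) /\
  forall e : R, 0 < e -> exists M0, forall M, (M0 <= M)%N -> (err M f <= e%:E)%E.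

Let mint f : lambda.-integrable Q (EFin \o f) -> measurable_fun Q f.
Proof. by move=> /measurable_int /measurable_EFinP. Qed.

Let mstep M f : measurable_fun Q (step_avg q L M f).
Proof. by apply: measurable_funTS; exact: measurable_step_avg. Qed.

Let int_le2 (a b c : V -> R) : measurable_fun Q a -> measurable_fun Q b ->
  measurable_fun Q c -> (forall y, Q y -> `|a y| <= `|b y| + `|c y|) ->
  (\int[lambda]_(y in Q) `|a y|%:E <=
   \int[lambda]_(y in Q) `|b y|%:E + \int[lambda]_(y in Q) `|c y|%:E)%E.
Proof.
move=> ma mb mc abc.
have nb (f : V -> R) x : Q x -> (0 <= `|f x|%:E)%E by rewrite lee_fin.
rewrite -(ge0_integralD lambda mQ (nb b) (measurable_normE mb) (nb c)
  (measurable_normE mc)).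
apply: (le_integral_norm lambda mQ ma (g := fun y => `|b y| + `|c y|)); last exact: abc.
by apply: measurable_funD; [exact: measurableT_comp mb|exact: measurableT_comp mc].
Qed.

(** By [step_avg_contraction] the class is closed under L^1 limits. The error splits into the
    average of f - g, the error of g, and g - f, whence the divisor 2 + C. *)
Let good_approx f : lambda.-integrable Q (EFin \o f) ->
  (forall e, 0 < e -> exists2 g, good g &
     (\int[lambda]_(y in Q) `|f y - g y|%:E <= e%:E)%E) -> good f.
Proof.
move=> intf H; split=> // e e0; have mf := mint intf.
have e1 : 0 < e / (2 + C) by rewrite divr_gt0// ltr_wpDr.
have [g [intg gg] fg] := H _ e1; have mg := mint intg.
have [M0 gM] := gg _ e1; exists M0 => M /gM {}gM; rewrite /err.
have mfg : measurable_fun Q (fun y => f y - g y) by exact: measurable_funB.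
have msfg : measurable_fun Q (fun y => step_avg q L M f y - step_avg q L M g y).
  by apply: measurable_funB; exact: mstep.
have msg : measurable_fun Q (fun y => step_avg q L M g y - g y).
  by apply: measurable_funB => //; exact: mstep.
have msf : measurable_fun Q (fun y => step_avg q L M f y - f y).
  by apply: measurable_funB => //; exact: mstep.
have msfgg : measurable_fun Q (fun y => step_avg q L M g y - f y).
  by apply: measurable_funB => //; exact: mstep.
apply: le_trans (int_le2 msf msfg msfgg _) _.
  by move=> y _; rewrite -[X in `|X| <= _](subrKA (step_avg q L M g y)) ler_normD.
have intfg : lambda.-integrable Q (EFin \o (fun y => f y - g y)).
  by apply: eq_integrable (integrableB mQ intf intg).
have h1 : (\int[lambda]_(y in Q) `|step_avg q L M f y - step_avg q L M g y|%:E <=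
    (C * (e / (2 + C)))%:E)%E.
  under eq_integral => y _ do rewrite -(step_avgB M L0 y intf intg).
  rewrite EFinM; apply: le_trans (step_avg_contraction M L0 intfg) _.
  by rewrite lee_wpmul2l ?lee_fin.
have h2 : (\int[lambda]_(y in Q) `|step_avg q L M g y - f y|%:E <=
    (2 * (e / (2 + C)))%:E)%E.
  rewrite mulr_natl mulr2n EFinD; apply: le_trans (leeD gM fg).
  apply: (int_le2 msfgg msg mfg) => y _; rewrite (distrC (f y)).
  by rewrite -[X in `|X| <= _](subrKA (g y)) ler_normD.
apply: le_trans (leeD h1 h2) _; rewrite -EFinD lee_fin -mulrDl addrC.
by rewrite mulrC divfK// gt_eqF// ltr_wpDr.
Qed.

Let goodB f g : good f -> good g -> good (fun y => f y - g y).
Proof.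
move=> [intf Hf] [intg Hg].
have intfg : lambda.-integrable Q (EFin \o (fun y => f y - g y)).
  by apply: eq_integrable (integrableB mQ intf intg).
split=> // e e0; have e2 : 0 < e / 2 by rewrite divr_gt0.
have [M1 H1] := Hf _ e2; have [M2 H2] := Hg _ e2.
exists (maxn M1 M2) => M; rewrite geq_max => /andP[/H1 {}H1 /H2 {}H2].
rewrite (splitr e) EFinD; apply: le_trans (leeD H1 H2).
apply: int_le2.
- by apply: measurable_funB; [exact: mstep|exact: mint].
- by apply: measurable_funB; [exact: mstep|exact: mint].
- by apply: measurable_funB; [exact: mstep|exact: mint].
move=> y _; rewrite (step_avgB M L0 y intf intg).
have -> : step_avg q L M f y - step_avg q L M g y - (f y - g y) =
  (step_avg q L M f y - f y) - (step_avg q L M g y - g y) by ring.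
exact: ler_normB.
Qed.

(** Expresses, through small sup-norm balls, that the boundary of [A] is negligible in [Q]. *)
Definition loc_const A :=
  {ae lambda, forall x, Q x -> exists2 d : R, 0 < d &
     forall y, (forall j, `|y ord0 j - x ord0 j| < d) -> (A y <-> A x)}.

Let loc_constU A B : loc_const A -> loc_const B -> loc_const (A `|` B).
Proof.
rewrite /loc_const; apply: filterS2 => x HA HB Qx; have [d1 d10 H1] := HA Qx.
have [d2 d20 H2] := HB Qx; exists (Num.min d1 d2); first by rewrite lt_min d10.
move=> y yx; have yA : A y <-> A x.
  by apply: H1 => j; have := yx j; rewrite lt_min => /andP[].
have yB : B y <-> B x.
  by apply: H2 => j; have := yx j; rewrite lt_min => /andP[].
by split => -[/yA|/yB] ?; [left|right|left|right].
Qed.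

Let ae_coord_neq i (t : R) : {ae lambda, forall x, Q x -> x ord0 i != t}.
Proof.
exists ([set x : V | x ord0 i = t] `&` Q); split.
- apply: measurableI; last exact: mQ.
  rewrite (_ : mkset _ = (fun x : V => x ord0 i) @^-1` [set t])//.
  by rewrite -[X in measurable X]setTI; apply: measurable_coord.
- exact: hyperplane_null.
- move=> x /= /not_implyP[Qx /negP]; rewrite negbK => /eqP xt.
  by split.
Qed.

(** A point on none of the hyperplanes that bear the faces stays on the same side of each under a
    small displacement. *)
Let loc_const_box c : loc_const (box c).
Proof.
case: c => [[a b]|]; last by rewrite /loc_const; apply: aeW => x _; exists 1.
have H i : {ae lambda, forall x, Q x -> x ord0 i != a ord0 i /\ x ord0 i != b ord0 i}.
  by apply: filterS2 (ae_coord_neq i (a ord0 i)) (ae_coord_neq i (b ord0 i)) => x + + Qx;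
    move=> /(_ Qx) ? /(_ Qx) ?.
have {}H : {ae lambda, forall x, forall i, Q x ->
    x ord0 i != a ord0 i /\ x ord0 i != b ord0 i}.
  by apply: filter_forall => i; exact: H.
rewrite /loc_const; apply: filterS H => x xab Qx.
have pa i : 0 < `|x ord0 i - a ord0 i|.
  by have [H _] := xab i Qx; rewrite normr_gt0 subr_eq0.
have [d1 d10 H1] := finite_pos_lbound pa.
have pb i : 0 < `|x ord0 i - b ord0 i|.
  by have [_ H] := xab i Qx; rewrite normr_gt0 subr_eq0.
have [d2 d20 H2] := finite_pos_lbound pb.
exists (Num.min d1 d2); first by rewrite lt_min d10.
have side (s t u d : R) : `|t - s| < d -> d <= `|s - u| -> (u < t) = (u < s).
  move=> ts su; have := lt_le_trans ts su.
  rewrite ltr_norml; have [us|us] := ltP u s.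
    by rewrite ger0_norm ?subr_ge0 ?(ltW us)// => /andP[? ?]; lra.
  rewrite ler0_norm ?subr_le0// => /andP[? ?].
  by apply/negbTE; rewrite -leNgt; lra.
move=> y yx; split => H i; have := H i; have := yx i; rewrite lt_min => /andP[y1 y2];
  rewrite (side _ _ _ _ y1 (H1 i)) !leNgt (side _ _ _ _ y2 (H2 i))//.
Qed.

Let loc_const_boxes (c : nat -> option (V * V)) K :
  loc_const (\bigcup_(k in `I_K) box (c k)).
Proof.
rewrite bigcup_mkord; elim: K => [|K IH].
  by rewrite big_ord0 /loc_const; apply: aeW => x _; exists 1.
by rewrite big_ord_recr/=; apply: loc_constU.
Qed.

Let grid_avg_bound f (B : R) M (z : {ffun 'I_n -> 'I_M.+1}) :
  lambda.-integrable Q (EFin \o f) ->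
  (forall y, `|f y| <= B) -> `|grid_avg q L f z| <= C * B.
Proof.
move=> intf fB; have h0 := mesh_gt0 M L0.
have hn0 : 0 < mesh L M ^+ n by rewrite exprn_gt0.
have intc := integrable_cell L0 z intf.
have mcell : measurable (cell q L z) := measurable_cell q L z.
have mfc : measurable_fun (cell q L z) f by apply/measurable_EFinP; exact: measurable_int intc.
have /= := avg_le h0 intc.
have : (\int[lambda]_(y in cell q L z) `|f y|%:E <= (B * mesh L M ^+ n)%:E)%E.
  apply: le_trans (le_integral_norm lambda mcell mfc (measurable_cst B) (fun y _ => fB y)) _.
  have /= -> := integral_cst lambda mcell B%:E.
  have -> : lebesgue (cell q L z) = (mesh L M ^+ n)%:E := lebesgue_cube _ h0.
  by rewrite EFinM.
have D0 : (0 <= (4 ^+ n / (mesh L M ^+ n * @eta_mass R n))%:E)%E.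
  by rewrite lee_fin divr_ge0 ?exprn_ge0// mulr_ge0// ltW// eta_mass_gt0.
move=> /(lee_wpmul2l D0) H1 H2; have := le_trans H2 H1.
rewrite -EFinM lee_fin; congr (_ <= _).
by field; rewrite !gt_eqF// eta_mass_gt0.
Qed.

(** Near almost every point the function is constant, so the step average equals it once the mesh is
    below [d]; the averages are bounded and dominated convergence applies. *)
Let good_loc_const A (k : R) : measurable A -> loc_const A ->
  good (fun y => k * \1_A y).
Proof.
move=> mA lA; set f := fun y : V => _.
have mf : measurable_fun setT f.
  by apply: measurable_funM; [exact: measurable_cst|exact: measurable_indic].
have fB y : `|f y| <= `|k|.
  rewrite /f normrM indicE; case: (_ \in _); rewrite ?normr1 ?mulr1// normr0 mulr0//.
have intcst (B : R) : lambda.-integrable Q (EFin \o cst B).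
  apply/integrableP; split; first exact/measurable_EFinP/measurable_cst.
  have /= -> := integral_cst lambda mQ `|B|%:E.
  have -> : lebesgue Q = (L ^+ n)%:E := muQ.
  by rewrite -EFinM ltry.
have intf : lambda.-integrable Q (EFin \o f).
  apply: (le_integrable mQ _ _ (intcst `|k|)).
    by apply/measurable_EFinP; exact: measurable_funTS.
  by move=> y _; rewrite lee_fin/= normr_id.
split=> // e e0.
have msE M : measurable_fun Q (EFin \o step_avg q L M f).
  by apply/measurable_EFinP; exact: mstep.
have cvgT : {ae lambda, forall x, Q x ->
    (EFin \o (fun M => step_avg q L M f x)) @ \oo --> (f x)%:E}.
  rewrite /loc_const in lA; apply: filterS lA => x lA Qx.
  have [d d0 fd] := lA Qx; apply: cvg_near_cst.
  have [M0 M0L] : exists M0 : nat, L / d < M0%:R.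
    by exists (Num.bound (L / d)); apply: archi_boundP; rewrite divr_ge0// ltW.
  exists M0 => // M /= M0M; congr EFin.
  have h0 := mesh_gt0 M L0.
  have hd : mesh L M < d.
    rewrite ltr_pdivrMr// mulrC -ltr_pdivrMr// (lt_le_trans M0L)// ler_nat.
    exact: leq_trans M0M (leqnSn _).
  have [z zx] := cell_cover M L0 Qx; rewrite (step_avgE L0 f zx).
  apply: avg_cst => // y zy; rewrite /f; congr (_ * _).
  have Ayx : A y <-> A x.
    apply: fd => j; have := zx; have := zy; rewrite /cell !cubeE => /(_ j) + /(_ j).
    by move=> /andP[y1 y2] /andP[x1 x2]; rewrite ltr_norml; lra.
  rewrite !indicE; have [Ax|nAx] := pselect (A x).
    by rewrite !mem_set//; exact/Ayx.
  by rewrite !memNset// => /Ayx.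
have dom : {ae lambda, forall x, forall M, Q x ->
    (`|(EFin \o step_avg q L M f) x| <= (EFin \o cst (C * `|k|)%R) x)%E}.
  apply: aeW => x M Qx; have [z zx] := cell_cover M L0 Qx.
  by rewrite /= (step_avgE L0 f zx) lee_fin; exact: grid_avg_bound.
have mfQ : measurable_fun Q (EFin \o f).
  by apply/measurable_EFinP; exact: measurable_funTS.
have [_ cv _] := dominated_convergence mQ msE mfQ cvgT (intcst _) dom.
have e0' M : (0 <= err M f)%E by apply: integral_ge0 => y _; rewrite lee_fin.
exact: (cvge0P e0').1.
Qed.

(** By definition of the outer measure, A within Q is covered by boxes with little excess, and
    finitely many of them exhaust the cover up to a small measure. *)
Let good_indic A (k : R) : measurable A -> good (fun y => k * \1_A y).
Proof.
move=> mA; set f := fun y : V => _.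
have mf : measurable_fun setT f.
  by apply: measurable_funM; [exact: measurable_cst|exact: measurable_indic].
have int_indic B : measurable B -> lambda.-integrable Q (EFin \o (fun y => k * \1_B y)).
  move=> mB; apply/integrableP; split.
    apply/measurable_EFinP/measurable_funTS.
    by apply: measurable_funM; [exact: measurable_cst|exact: measurable_indic].
  have mk : measurable_fun Q (fun y : V => k * \1_B y).
    apply: measurable_funTS.
    by apply: measurable_funM; [exact: measurable_cst|exact: measurable_indic].
  apply: le_lt_trans (le_integral_norm lambda mQ mk (measurable_cst `|k|) _) _.
    move=> y _; rewrite normrM indicE; case: (_ \in _) => /=.
      by rewrite normr1 mulr1.
    by rewrite normr0 mulr0.
  have /= -> := integral_cst lambda mQ `|k|%:E.
  have -> : lebesgue Q = (L ^+ n)%:E := muQ.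
  by rewrite -EFinM ltry.
apply: good_approx; first exact: int_indic.
move=> e e0; pose A' := A `&` Q.
have mA' : measurable A' by exact: measurableI.
have A'fin : (lambda A' \is a fin_num)%E.
  rewrite ge0_fin_numE ?measure_ge0//; apply: (@le_lt_trans _ _ (lambda Q)).
    by apply: le_outer_measure; exact: subIsetr.
  by rewrite muQ ltry.
pose e1 := e / (2 * (`|k| + 1)).
have e10 : 0 < e1 by rewrite divr_gt0// mulr_gt0// ltr_wpDl.
have [_ [c A'c <-] cA'] := lb_ereal_inf_adherent e10 A'fin.
pose U := \bigcup_j box (c j); pose UK K := \bigcup_(j in `I_K) box (c j).
have mU : measurable U by apply: bigcup_measurable => j _; exact: measurable_box.
have mUK K : measurable (UK K) by apply: bigcup_measurable => j _; exact: measurable_box.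
have UA' : (lambda U <= lambda A' + e1%:E)%E.
  apply: le_trans (ltW cA'); apply: lebesgue_outer_le.
  exact: subset_refl.
have Ufin : (lambda U < +oo)%E.
  by apply: le_lt_trans UA' _; rewrite -(fineK A'fin) -EFinD ltry.
have UDA' : (lambda (U `\` A') <= e1%:E)%E.
  rewrite measureD// (setIidr A'c) leeBlDr//.
  by rewrite addeC.
have [K UKU] : exists K, (lambda (U `\` UK K) <= e1%:E)%E.
  have UKc : (lambda \o UK) @ \oo --> lambda U.
    have -> : U = \bigcup_K UK K.
      apply/seteqP; split => [y [j _ cy]|y [K _ [j _ cy]]]; last by exists j.
      by exists j.+1 => //; exists j => //=.
    apply: nondecreasing_cvg_mu => //.
      by apply: bigcup_measurable => j _; exact: mUK.
    move=> K K' KK'; apply/subsetPset => y [j /= jK cy]; exists j => //=.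
    exact: leq_trans jK KK'.
  have Ufn : (lambda U \is a fin_num)%E by rewrite ge0_fin_numE ?measure_ge0.
  have UKsub K : UK K `<=` U by move=> y [j _ cy]; exists j.
  have UKfn K : (lambda (UK K) \is a fin_num)%E.
    rewrite ge0_fin_numE ?measure_ge0//; apply: le_lt_trans Ufin.
    by apply: le_outer_measure; exact: UKsub.
  rewrite -(fineK Ufn) in UKc; move: UKc => /fine_cvgP[_ /cvgrPdist_le cv].
  have [K _ /(_ K (leqnn K)) /= H] := cv _ e10.
  have E : (lambda (U `\` UK K) = lambda U - lambda (UK K))%E.
    by rewrite -[in RHS](setIidr (@UKsub K)); exact: measureD.
  exists K; rewrite E -(fineK Ufn) -(fineK (UKfn K)) -EFinB lee_fin.
  by rewrite (le_trans (ler_norm _)).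
exists (fun y => k * \1_(UK K) y); first by apply: good_loc_const => //; exact: loc_const_boxes.
have mfg : measurable_fun Q (fun y => f y - k * \1_(UK K) y).
  apply: measurable_funB; first exact: measurable_funTS.
  apply: measurable_funTS.
  by apply: measurable_funM; [exact: measurable_cst|exact: measurable_indic].
have m1 : measurable_fun Q (fun y : V => k * \1_(U `\` A') y).
  apply: measurable_funTS; apply: measurable_funM; first exact: measurable_cst.
  by apply: measurable_indic; exact: measurableD.
have m2 : measurable_fun Q (fun y : V => k * \1_(U `\` UK K) y).
  apply: measurable_funTS; apply: measurable_funM; first exact: measurable_cst.
  by apply: measurable_indic; exact: measurableD.
apply: le_trans (int_le2 mfg m1 m2 _) _.
  move=> y Qy; rewrite /f -mulrBr !normrM -mulrDr ler_wpM2l// !indicE.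
  have [Ay|nAy] := pselect (A y).
    have Uy : U y by apply: A'c; split.
    have -> : (y \in A) = true by rewrite mem_set.
    have [Ky|nKy] := pselect (UK K y).
      by rewrite (mem_set Ky) subrr normr0 addr_ge0.
    have -> : (y \in UK K) = false by rewrite memNset.
    have -> : (y \in U `\` UK K) = true by rewrite mem_set.
    by rewrite subr0 lerDr.
  have -> : (y \in A) = false by rewrite memNset.
  have [Ky|nKy] := pselect (UK K y).
    have -> : (y \in U `\` A') = true.
      by rewrite mem_set//; split; [case: Ky => j _ cy; exists j|move=> [] /nAy].
    by rewrite (mem_set Ky) sub0r normrN lerDl.
  by rewrite (memNset nKy) subrr normr0 addr_ge0.
have intE B : measurable B -> (lambda B <= e1%:E)%E ->
    (\int[lambda]_(y in Q) `|k * \1_B y|%:E <= (e / 2)%:E)%E.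
  move=> mB Be.
  apply: (@le_trans _ _ (`|k|%:E * lambda B)%E).
    under eq_integral => y _ do rewrite normrM.
    have mi : measurable_fun Q (\1_B : V -> R).
      by apply: measurable_funTS; exact: measurable_indic.
    rewrite (integral_normZl lambda mQ mi (normr_ge0 k)).
    rewrite lee_wpmul2l ?lee_fin//.
    under eq_integral => y _ do rewrite ger0_norm//.
    rewrite (integral_indic lambda mQ mB).
    by apply: le_outer_measure; exact: subIsetl.
  apply: (@le_trans _ _ (`|k|%:E * e1%:E)%E); first by rewrite lee_wpmul2l ?lee_fin.
  have k1 : 0 < `|k| + 1 by rewrite ltr_wpDl.
  rewrite -EFinM lee_fin.
  have -> : `|k| * e1 = e / 2 * (`|k| / (`|k| + 1)).
    by rewrite /e1; field; rewrite gt_eqF.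
  by rewrite ler_piMr ?divr_ge0 ?(ltW e0)// ler_pdivrMr// mul1r lerDl.
rewrite (splitr e) EFinD; apply: leeD; apply: intE.
- exact: measurableD.
- exact: UDA'.
- exact: measurableD.
- exact: UKU.
Qed.

Let good_sum (s : seq R) (A : R -> set V) : (forall r, measurable (A r)) ->
  good (fun y => \sum_(r <- s) r * \1_(A r) y).
Proof.
move=> mA; elim: s => [|r s IH].
  have := good_indic 0 (A := set0) measurable0.
  congr good; apply/funext => y; by rewrite big_nil mul0r.
have g0 : good (fun y => 0 * \1_(set0 : set V) y) by exact: good_indic measurable0.
have := goodB (good_indic r (mA r)) (goodB g0 IH).
by congr good; apply/funext => y; rewrite big_cons mul0r sub0r opprK.
Qed.

Lemma step_avg_cvg f : lambda.-integrable Q (EFin \o f) ->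
  (fun M => \int[lambda]_(y in Q) `|step_avg q L M f y - f y|%:E)%E @ \oo --> 0%E.
Proof.
move=> intf.
suff [_ H] : good f.
  by apply/cvge0P => [M|]; [apply: integral_ge0 => y _; rewrite lee_fin|exact: H].
apply: good_approx => // e e0.
have [g [intg _ cv]] := approximation_sfun_integrable mQ intf.
have ge0 k : (0 <= \int[lambda]_(z in Q) `|(f z)%:E - (g k z)%:E|)%E.
  by apply: integral_ge0.
have [k0 H] := (cvge0P ge0).1 cv _ e0.
exists (g k0); last exact: H.
rewrite (_ : (g k0 : V -> R) = fun y => \sum_(r <- finmap.enum_fset (fset_set (range (g k0))))
    r * \1_(g k0 @^-1` [set r]) y).
  by apply: good_sum => r; exact: measurable_sfunP.
by apply/funext => y; rewrite fimfunE fsbig_finite.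
Qed.

End step_avg_convergence.

(** * Sobolev and Poincare inequalities on cubes *)

Section measure_limits.
Context d (T : measurableType d) (R : realType) (mu : {measure set T -> \bar R}).
Variables (D : set T) (mD : measurable D).
Implicit Types (f : nat -> T -> R) (l : T -> R).

Lemma measurable_norm_powR l (t : R) : measurable_fun D l ->
  measurable_fun D (fun x => `|l x| `^ t).
Proof.
move=> ml; apply: (measurableT_comp (measurable_powR t)).
exact: measurableT_comp ml.
Qed.

Lemma fast_sum_lty (u : nat -> \bar R) : (forall k, 0 <= u k)%E ->
  (forall k, u k <= (1 / (2 ^ k.+1)%:R)%:E)%E -> (\sum_(k <oo) u k < +oo)%E.
Proof.
move=> u0 ule; apply: (@le_lt_trans _ _ (\sum_(k <oo) (0 + (1 / (2 ^ k.+1)%:R : R)%:E))%E).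
  by apply: lee_nneseries => [k _ _|k _]; rewrite ?add0e.
apply: (le_lt_trans (@epsilon_trick R (fun=> 0%E) 1 xpredT _ _)) => //.
by rewrite eseries0// add0e ltry.
Qed.

(** The errors are summable in L^1, hence summable almost everywhere, hence tend to 0 there. *)
Lemma fast_cvg_ae f l : (forall k, measurable_fun D (f k)) -> measurable_fun D l ->
  (forall k, (\int[mu]_(x in D) `|f k x - l x|%:E <= (1 / (2 ^ k.+1)%:R)%:E)%E) ->
  {ae mu, forall x, D x -> f ^~ x @ \oo --> l x}.
Proof.
move=> mf ml fl.
have mfl k : measurable_fun D (fun x => f k x - l x) by exact: measurable_funB.
have i0 k : (0 <= \int[mu]_(x in D) `|f k x - l x|%:E)%E.
  by apply: integral_ge0 => x _; rewrite lee_fin.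
have := summable_ae (mu:=mu) mD mfl (fast_sum_lty i0 fl).
apply: filterS => x H Dx.
have /cvg_series_norm/normed_cvg/cvg_series_cvg_0 := H Dx.
move=> H0.
have : (fun k => l x + (f k x - l x)) @ \oo --> l x + 0.
  by apply: cvgD; [exact: cvg_cst|exact: H0].
have -> : (fun k => l x + (f k x - l x)) = f ^~ x.
  by apply/funext => k; rewrite addrC subrK.
by rewrite addr0.
Qed.

End measure_limits.

(** The inner 2 offsets the constant of [powR_addr_le], the outer 2 counts each cell also as a
    neighbour, and the rest comes from [avg_diff_le]. *)
Definition grad_cst (R : realType) n (s : R) : R :=
  (2 * 4 ^+ n / @eta_mass R n) `^ s * 2.

Lemma grad_cst_gt0 (R : realType) n (s : R) : 0 < grad_cst n s.
Proof. by rewrite mulr_gt0// powR_gt0// divr_gt0 ?eta_mass_gt0// mulr_gt0 ?exprn_gt0. Qed.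

Section cube_inequalities.
Context {R : realType} {n : nat} (q : 'rV[R]_n) (L : R).
Hypothesis L0 : 0 < L.
Local Notation V := 'rV[R]_n.
Local Notation lambda := (@lebesgue R n).
Local Notation Q := (cube q L).
Implicit Types (u : V -> R) (g : V -> V) (i : 'I_n) (M : nat) (s t : R).

Definition cube_mean u : R := (\int[lambda]_(y in Q) u y) / L ^+ n.

Let mQ : measurable Q. Proof. exact: measurable_cube. Qed.
Let Ln0 : 0 < L ^+ n. Proof. by rewrite exprn_gt0. Qed.

Lemma grid_mean_cvg u M : lambda.-integrable Q (EFin \o u) ->
  ((L ^+ n * `|grid_mean (grid_avg q L u (M := M)) - cube_mean u|)%:E <=
   \int[lambda]_(y in Q) `|step_avg q L M u y - u y|%:E)%E.
Proof.
move=> iu; have is_ := integrable_step_avg q M L0 u.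
have ib : lambda.-integrable Q (EFin \o (fun y => step_avg q L M u y - u y)).
  have H := integrableB mQ is_ iu; exact: H.
have E : L ^+ n * `|grid_mean (grid_avg q L u (M := M)) - cube_mean u| =
    `|\int[lambda]_(y in Q) (step_avg q L M u y - u y)|.
  rewrite -[X in X * _](gtr0_norm Ln0) -normrM mulrBr (grid_mean_avg q M L0).
  rewrite /cube_mean mulrCA divff ?mulr1; last by rewrite gt_eqF.
  by rewrite (RintegralB mQ is_ iu).
rewrite E (EFin_normr_Rintegral mQ ib).
have /= H := le_abse_integral lambda mQ (measurable_int _ ib); exact: H.
Qed.

(** Along meshes with L^1 errors at most 2^(-k-1) the step averages converge almost everywhere and
    the grid means converge to the mean over the cube; Fatou's lemma concludes. *)
Lemma cube_limit u t (K : R) : 1 <= t -> lambda.-integrable Q (EFin \o u) ->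
  (forall M, mesh L M ^+ n *
     \sum_z `|grid_avg q L u (M := M) z - grid_mean (grid_avg q L u (M := M))| `^ t <= K) ->
  (\int[lambda]_(y in Q) (`|u y - cube_mean u| `^ t)%:E <= K%:E)%E.
Proof.
move=> t1 iu uK.
have mu_ : measurable_fun Q u by apply/measurable_EFinP; exact: measurable_int iu.
have e0 M : (0 <= \int[lambda]_(y in Q) `|step_avg q L M u y - u y|%:E)%E.
  by apply: integral_ge0 => y _; rewrite lee_fin.
have cv := (cvge0P e0).1 (step_avg_cvg L0 iu).
have pk k : 0 < 1 / (2 ^ k.+1)%:R :> R by rewrite divr_gt0// ltr0n expn_gt0.
have [N NP] : {N : nat -> nat & forall k,
    (\int[lambda]_(y in Q) `|step_avg q L (N k) u y - u y|%:E <=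
     (1 / (2 ^ k.+1)%:R)%:E)%E}.
  apply: (@choice _ _ (fun k N => (\int[lambda]_(y in Q) `|step_avg q L N u y - u y|%:E <=
     (1 / (2 ^ k.+1)%:R)%:E)%E)) => k.
  by have [k0 H] := cv _ (pk k); exists k0; exact: H.
pose m k := grid_mean (grid_avg q L u (M := N k)).
have ms k : measurable_fun Q (step_avg q L (N k) u).
  by apply: measurable_funTS; exact: measurable_step_avg.
have mm : m @ \oo --> cube_mean u.
  apply/cvgrPdist_le => e e0'.
  have he : 0 < L ^+ n * e by rewrite mulr_gt0.
  have [k0 k0P] : exists k0 : nat, 1 / (L ^+ n * e) < k0%:R.
    by exists (Num.bound (1 / (L ^+ n * e))); apply: archi_boundP; rewrite divr_ge0// ltW.
  exists k0 => // k /= k0k; rewrite distrC.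
  have := le_trans (grid_mean_cvg (N k) iu) (NP k).
  rewrite lee_fin => H; rewrite -(ler_pM2l Ln0); apply: (le_trans H).
  rewrite ler_pdivrMr ?ltr0n ?expn_gt0// mulrC -ler_pdivrMr//.
  apply: (le_trans (ltW k0P)); rewrite ler_nat; apply: (leq_trans k0k).
  exact: ltnW (ltnW (ltn_expl k.+1 (isT : (1 < 2)%N))).
have ae1 := fast_cvg_ae mQ ms mu_ NP.
apply: (fatou_powR mQ t1 (f := fun k y => step_avg q L (N k) u y - m k)).
- by move=> k; apply: measurable_funB => //; exact: measurable_cst.
- by apply: measurable_funB => //; exact: measurable_cst.
- by apply: filterS ae1 => y H Qy; apply: cvgB => //; exact: H.
- move=> k.
  rewrite (integral_step_avg q (N k) L0 u (phi := fun x => `|x - m k| `^ t)).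
    by rewrite lee_fin; exact: uK.
  apply: (measurableT_comp (measurable_powR t)); apply: measurableT_comp => //.
  by apply: measurable_funB; [exact: measurable_id|exact: measurable_cst].
Qed.

Lemma average_fractionE (a b c e x y : R) : y == 0 = false -> c == 0 = false ->
  x * e / (y * c) * (y * a + y * b) = 2 * e / c * x / 2 * (a + b).
Proof. by move=> y0 c0; field; rewrite y0 c0. Qed.

Lemma average_powR_le (s a h c d x : R) : 0 <= s -> 0 <= a -> 0 <= h ->
  0 <= c -> 0 <= d -> 0 <= x -> x <= a * h / 2 * (c + d) ->
  x `^ s <= (a * h) `^ s * (c `^ s + d `^ s).
Proof.
move=> s0 a0 h0 c0 d0 x0 H; apply: le_trans (le_powR2 s0 x0 H) _.
have ah : 0 <= a * h by rewrite mulr_ge0.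
have cd : 0 <= c + d by rewrite addr_ge0.
rewrite -mulrA powRM ?mulr_ge0//; apply: ler_wpM2l; first exact: powR_ge0.
rewrite powRM//; apply: le_trans (ler_wpM2l (powR_ge0 _ _) (powR_addr_le s0 c0 d0)) _.
by rewrite mulrA -powRM// mulVf// powR1 mul1r.
Qed.

Section gradient.
Variables (u : V -> R) (g : V -> V) (s K0 : R).
Hypotheses (lu : L1loc lambda u) (ug : is_weak_grad u g) (s1 : 1 <= s).
Hypothesis gK : (\sum_(i < n) \int[lambda]_(y in Q) (`|g y ord0 i| `^ s)%:E <= K0%:E)%E.

Local Notation Cg := (grad_cst n s).

Let s0 : 0 <= s. Proof. exact: le_trans s1. Qed.

Let cell_mean M i (z : {ffun 'I_n -> 'I_M.+1}) : R :=
  fine (\int[lambda]_(y in cell q L z) `|g y ord0 i|%:E)%E / mesh L M ^+ n.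

Let cell_mean_ge0 M i (z : {ffun 'I_n -> 'I_M.+1}) : 0 <= cell_mean i z.
Proof.
rewrite divr_ge0 ?exprn_ge0// ?(ltW (mesh_gt0 M L0))// fine_ge0//.
by apply: integral_ge0 => y _; rewrite lee_fin.
Qed.

Let mg i D : measurable_fun D (fun y => g y ord0 i).
Proof. by apply: measurable_funTS; have [[]] := ug i. Qed.

Let cell_fin M i (z : {ffun 'I_n -> 'I_M.+1}) :
  (\int[lambda]_(y in cell q L z) `|g y ord0 i|%:E =
   (mesh L M ^+ n * cell_mean i z)%:E)%E.
Proof.
have h0 := mesh_gt0 M L0.
rewrite /cell_mean mulrCA divff ?mulr1 ?gt_eqF ?exprn_gt0// fineK//.
rewrite ge0_fin_numE; last by apply: integral_ge0 => y _; rewrite lee_fin.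
have [lg _] := ug i.
have := L1loc_integrable_cube (corner q L z) (mesh L M) lg.
by move=> /integrableP[_].
Qed.

(** Jensen's inequality on a cell, by integrating the tangent inequality at the mean [m]. *)
Let jensen_cell M i (z : {ffun 'I_n -> 'I_M.+1}) :
  ((mesh L M ^+ n * cell_mean i z `^ s)%:E <=
   \int[lambda]_(y in cell q L z) (`|g y ord0 i| `^ s)%:E)%E.
Proof.
have h0 := mesh_gt0 M L0; have hn0 : 0 < mesh L M ^+ n by rewrite exprn_gt0.
have mC : measurable (cell q L z) := measurable_cell q L z.
set m := cell_mean i z; have m0 : 0 <= m := cell_mean_ge0 i z.
set J := (\int[lambda]_(y in cell q L z) (`|g y ord0 i| `^ s)%:E)%E.
have J0 : (0 <= J)%E by apply: integral_ge0 => y _; rewrite lee_fin powR_ge0.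
have mpow := measurable_norm_powR (D := cell q L z) s (@mg i _).
have H : ((s * m `^ (s - 1) * (mesh L M ^+ n * m))%:E <=
    J + ((s - 1) * m `^ s * mesh L M ^+ n)%:E)%E.
  rewrite EFinM -cell_fin.
  rewrite -(integral_normZl lambda mC (@mg i _)) ?mulr_ge0 ?powR_ge0//.
  have -> : ((s - 1) * m `^ s * mesh L M ^+ n)%:E =
      (\int[lambda]_(y in cell q L z) ((s - 1) * m `^ s)%:E)%E.
    have /= -> := integral_cst lambda mC ((s - 1) * m `^ s)%:E.
    have -> : lebesgue (cell q L z) = (mesh L M ^+ n)%:E := lebesgue_cube _ h0.
    by rewrite -EFinM.
  have c0 : 0 <= (s - 1) * m `^ s by rewrite mulr_ge0 ?powR_ge0// subr_ge0.
  have mpowE : measurable_fun (cell q L z) (fun y => (`|g y ord0 i| `^ s)%:E).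
    exact/measurable_EFinP.
  have mcE : measurable_fun (cell q L z) (fun y => ((s - 1) * m `^ s)%:E).
    exact/measurable_EFinP/measurable_cst.
  rewrite -(ge0_integralD lambda mC _ mpowE _ mcE); last 2 first.
  - by move=> y _; rewrite lee_fin powR_ge0.
  - by move=> y _; rewrite lee_fin.
  apply: ge0_le_integral.
  - exact: mC.
  - by move=> y _; rewrite lee_fin !mulr_ge0 ?powR_ge0.
  - apply/measurable_EFinP; apply: measurable_funM; first exact: measurable_cst.
    exact: measurableT_comp (@mg i _).
  - exact: emeasurable_funD.
  - by move=> y _; rewrite -EFinD lee_fin mulrAC; exact: powR_tangent.
have E : s * m `^ (s - 1) * (mesh L M ^+ n * m) = s * m `^ s * mesh L M ^+ n.
  have [->|mn0] := eqVneq m 0.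
    by rewrite !mulr0 powR0 ?mulr0 ?mul0r// gt_eqF// (lt_le_trans _ s1).
  have -> : m `^ s = m `^ (s - 1) * m.
    by rewrite -[X in _ * X](powRr1 m0) -powRD ?subrK// mn0 implybT.
  by ring.
rewrite E in H.
have [Joo|Jfin] := eqVneq J +oo%E; first by rewrite Joo leey.
have JE : J = (fine J)%:E by rewrite fineK// ge0_fin_numE// ltey.
move: H; rewrite JE -EFinD !lee_fin.
by move: (fine J) (m `^ s) (mesh L M ^+ n) => a b c; lra.
Qed.

(** From weak gradient to discrete energy: [avg_diff_le] bounds each difference by the means of the
    gradient component over two adjacent cells, [jensen_cell] bounds the powers of these means, and
    each cell is used at most twice per direction. *)
Lemma sum_fdiff_le M :
  \sum_z \sum_i fdiff i (grid_avg q L u (M := M)) z `^ s <=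
  Cg * (mesh L M `^ s / mesh L M ^+ n) * K0.
Proof.
have h0 := mesh_gt0 M L0; have hn0 : 0 < mesh L M ^+ n by rewrite exprn_gt0.
have m0 := @eta_mass_gt0 R n.
set h := mesh L M in h0 hn0 *.
pose A := 2 * 4 ^+ n / @eta_mass R n.
have A0 : 0 <= A by rewrite divr_ge0 ?mulr_ge0 ?exprn_ge0// ltW.
have step1 i (z : {ffun 'I_n -> 'I_M.+1}) :
    fdiff i (grid_avg q L u (M := M)) z `^ s <=
    (A * h) `^ s * (cell_mean i z `^ s +
      (if ((z i).+1 < M.+1)%N then cell_mean i (upd z i (inord (z i).+1)) `^ s else 0)).
  rewrite /fdiff; case: ifP => zi; last first.
    by rewrite powR0 ?mulr_ge0 ?addr_ge0 ?powR_ge0// gt_eqF// (lt_le_trans _ s1).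
  set z' := upd _ _ _.
  have ccE : corner q L z' = corner q L z + h *: delta_mx ord0 i by exact: corner_upd.
  have := avg_diff_le (corner q L z) i h0 lu ug.
  rewrite -ccE -[cube (corner q L z) h]/(cell q L z) -[cube (corner q L z') h]/(cell q L z').
  rewrite (cell_fin i z) (cell_fin i z').
  rewrite -EFinD -EFinM lee_fin => H.
  have H' : `|grid_avg q L u z' - grid_avg q L u z| <=
      A * h / 2 * (cell_mean i z + cell_mean i z').
    have E' := average_fractionE (cell_mean i z) (cell_mean i z') (4 ^+ n) h (gt_eqF hn0) (gt_eqF m0).
    rewrite -/A in E'.
    rewrite -E' (distrC (grid_avg q L u z') (grid_avg q L u z)).
    exact: H.
  exact: (average_powR_le s0 A0 (ltW h0) (cell_mean_ge0 i z) (cell_mean_ge0 i z')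
    (normr_ge0 _) H').
have pow0 i (z : {ffun 'I_n -> 'I_M.+1}) : 0 <= cell_mean i z `^ s := powR_ge0 _ _.
have step2 i : ((\sum_(z : {ffun 'I_n -> 'I_M.+1}) h ^+ n * cell_mean i z `^ s)%:E <=
    \int[lambda]_(y in Q) (`|g y ord0 i| `^ s)%:E)%E.
  rewrite (integral_cells M L0 (measurable_norm_powR s (@mg i Q))) -sumEFin.
  by apply: lee_sum => z _; exact: jensen_cell.
have step3 : \sum_(i < n) \sum_(z : {ffun 'I_n -> 'I_M.+1}) h ^+ n * cell_mean i z `^ s <= K0.
  rewrite -lee_fin -sumEFin; apply: le_trans gK.
  by apply: lee_sum => i _; exact: step2.
have step4 i : \sum_z fdiff i (grid_avg q L u (M := M)) z `^ s <=
    (A * h) `^ s * (2 * \sum_(z : {ffun 'I_n -> 'I_M.+1}) cell_mean i z `^ s).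
  apply: le_trans (ler_sum _ (fun z _ => step1 i z)) _.
  rewrite -mulr_sumr ler_wpM2l ?powR_ge0// big_split/= mulr_natl mulr2n lerD2l.
  rewrite -big_mkcond/=.
  exact: sum_shift_le (pow0 i).
rewrite exchange_big/=; apply: le_trans (ler_sum _ (fun i _ => step4 i)) _.
rewrite -mulr_sumr -mulr_sumr; set S := \sum_(i < n) _.
have SE : h ^+ n * S <= K0.
  rewrite mulr_sumr; apply: le_trans _ step3.
  by apply: ler_sum => i _; rewrite mulr_sumr.
rewrite /grad_cst -/A powRM ?(ltW h0)//.
have c0 : 0 <= A `^ s * 2 * (h `^ s / h ^+ n).
  by rewrite !mulr_ge0 ?powR_ge0 ?invr_ge0 ?(ltW hn0).
apply: le_trans _ (ler_wpM2l c0 SE).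
rewrite le_eqVlt; apply/orP; left; apply/eqP.
have := gt_eqF hn0; move: (h ^+ n) (h `^ s) (A `^ s) => x y a x0.
by field; rewrite x0.
Qed.

Lemma grid_energy_ge0 : 0 <= K0.
Proof.
rewrite -lee_fin; apply: le_trans gK; apply: sume_ge0 => i _.
by apply: integral_ge0 => y _; rewrite lee_fin powR_ge0.
Qed.

(** The power h^s of the energy and the power N^s of [grid_poincare] combine into L^s, free of the
    mesh. *)
Lemma poincare_cube :
  (\int[lambda]_(y in Q) (`|u y - cube_mean u| `^ s)%:E <=
   ((2 `^ s) ^+ n * L `^ s * Cg * K0)%:E)%E.
Proof.
apply: (cube_limit s1 (L1loc_integrable_cube q L lu)) => M.
have h0 := mesh_gt0 M L0; have hn0 : 0 < mesh L M ^+ n by rewrite exprn_gt0.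
apply: le_trans (ler_wpM2l (ltW hn0) (grid_poincare _ s1)) _.
have := sum_fdiff_le M; move: (grad_cst n s) => c H.
have c0 : 0 <= mesh L M ^+ n * ((2 `^ s) ^+ n * M.+1%:R `^ s).
  by rewrite !mulr_ge0 ?powR_ge0 ?exprn_ge0 ?powR_ge0 ?(ltW h0).
rewrite !mulrA -(mulrA (mesh L M ^+ n)).
apply: le_trans (ler_wpM2l c0 H) _.
rewrite le_eqVlt; apply/orP; left; apply/eqP.
have -> : L `^ s = mesh L M `^ s * M.+1%:R `^ s.
  by rewrite -powRM ?meshE// (ltW h0).
have := gt_eqF hn0; move: (mesh L M ^+ n) (mesh L M `^ s) (M.+1%:R `^ s) => x y a x0.
by move: (_ ^+ n) => d; field; rewrite x0.
Qed.

End gradient.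

End cube_inequalities.

(** Scale invariance: the factor h^(s-n) of the discrete energy, raised to n/(n-s), is h^(-n) and
    cancels the cell volume. The constant thus depends neither on the mesh nor on the cube. *)
Lemma sobolev_poincare_cube (R : realType) (n : nat) (s : R) :
  (2 <= n)%N -> 1 <= s -> s < n%:R -> exists2 C : R, 0 < C &
  forall (q : 'rV[R]_n) (L : R) (u : 'rV[R]_n -> R) (g : 'rV[R]_n -> 'rV[R]_n) (K : R),
  0 < L -> L1loc (@lebesgue R n) u -> is_weak_grad u g -> 0 < K ->
  (\sum_(i < n) \int[@lebesgue R n]_(y in cube q L) (`|g y ord0 i| `^ s)%:E <= K%:E)%E ->
  (\int[@lebesgue R n]_(y in cube q L)
    (`|u y - cube_mean q L u| `^ (n%:R * s / (n%:R - s)))%:E <=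
   (C * K `^ (n%:R / (n%:R - s)))%:E)%E.
Proof.
move=> n2 s1 sn; have [C C0 CP] := grid_sobolev_poincare n2 s1 sn.
have c0 := grad_cst_gt0 n s; have ns0 : 0 < n%:R - s by rewrite subr_gt0.
exists (C * grad_cst n s `^ (n%:R / (n%:R - s))).
  by rewrite mulr_gt0// powR_gt0.
move=> q L u g K L0 lu ug K0 gK.
have t1 : 1 <= n%:R * s / (n%:R - s).
  rewrite ler_pdivlMr// mul1r; apply: (@le_trans _ _ n%:R).
    by rewrite gerBl (le_trans _ s1).
  by rewrite ler_peMr.
have iu := L1loc_integrable_cube q L lu.
apply: (@cube_limit R n q L L0 u _ _ t1 iu) => M.
have h0 := mesh_gt0 M L0; have hn0 : 0 < mesh L M ^+ n by rewrite exprn_gt0.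
have hs0 : 0 < mesh L M `^ s / mesh L M ^+ n by rewrite divr_gt0// powR_gt0.
have KM : 0 < grad_cst n s * (mesh L M `^ s / mesh L M ^+ n) * K
  by apply: mulr_gt0 K0; exact: mulr_gt0.
have H := sum_fdiff_le L0 lu ug s1 gK M.
have := CP M _ _ KM H.
move=> /(ler_wpM2l (ltW hn0))/le_trans; apply.
rewrite le_eqVlt; apply/orP; left; apply/eqP.
rewrite (powRM _ (mulr_ge0 (ltW c0) (ltW hs0)) (ltW K0)) (powRM _ (ltW c0) (ltW hs0)).
have -> : (mesh L M `^ s / mesh L M ^+ n) `^ (n%:R / (n%:R - s)) = (mesh L M ^+ n)^-1.
  rewrite -powR_mulrn ?(ltW h0)// -powRN -powRD ?(gt_eqF h0) ?implybT//.
  rewrite -powRrM; congr (_ `^ _).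
  by field; rewrite gt_eqF.
have := gt_eqF hn0; move: (mesh L M ^+ n) => x x0.
by move: (grad_cst n s `^ _) (K `^ _) => a b; field; rewrite x0.
Qed.

(** * Rellich compactness *)

(** A free ultrafilter replaces repeated extraction: all bounded sequences are Cauchy along it at
    once, and [ultra_subseq] extracts a genuine subsequence at the end. *)
Lemma ultra_nat : exists2 U : set_system nat, UltraFilter U & \oo `<=` U.
Proof. by have [U [UU U_oo]] := ultraFilterLemma eventually_filter; exists U. Qed.

Section ultra.
Variables (U : set_system nat) (UU : UltraFilter U) (Uoo : \oo `<=` U).

Lemma ultra_bounded_cauchy (R : realType) (a : nat -> R) (B e : R) :
  (forall k, `|a k| <= B) -> 0 < e ->
  exists2 A, U A & forall j k, A j -> A k -> `|a j - a k| <= e.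
Proof.
move=> aB e0.
have UB : (a @ U) `[- B, B]%classic.
  suff -> : (a @ U) `[- B, B]%classic = U setT by exact: filterT.
  congr U; apply/seteqP; split=> k // _.
  by rewrite /= in_itv/= -ler_norml; exact: aB.
have [p [_ ap]] := @segment_compact R (- B) B (a @ U) _ UB.
have pB : nbhs p (ball p (e / 2)) by apply: nbhsx_ballx; rewrite divr_gt0.
exists (a @^-1` ball p (e / 2)).
  have [//|UC] := in_ultra_setVsetC (a @^-1` ball p (e / 2)) UU.
  by have [x []] := ap (~` ball p (e / 2)) _ UC pB.
move=> j k; rewrite /ball/= => pj pk.
have := ler_normD (a j - p) (p - a k); rewrite addrA subrK => /le_trans; apply.
by rewrite distrC; lra.
Qed.

Lemma ultra_forall (I : finType) (P : I -> set nat) : (forall i, U (P i)) ->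
  U [set k | forall i, P i k].
Proof.
move=> UP; suff H (r : seq I) : U [set k | forall i, i \in r -> P i k].
  by apply: filterS (H (enum I)) => k Pk i; apply: Pk; rewrite mem_enum.
elim: r => [|i r IH]; first by apply: filterS filterT.
apply: filterS (filterI (UP i) IH) => k [Pi Pr] j.
by rewrite inE => /orP[/eqP ->|/Pr].
Qed.

(** Finite intersections of the given sets meet every tail, so an increasing choice of indices is
    possible, the [m]-th one in the first m + 1 sets. *)
Lemma ultra_subseq (A : nat -> set nat) : (forall m, U (A m)) ->
  exists2 s : nat -> nat, {homo s : i j / (i < j)%N} &
    forall i m, (i <= m)%N -> A i (s m).
Proof.
move=> UA.
have UB m : U [set k | forall i, (i <= m)%N -> A i k].
  elim: m => [|m IH]; first by apply: filterS (UA 0%N) => k Ak i; rewrite leqn0 => /eqP ->.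
  apply: filterS (filterI (UA m.+1) IH) => k [Am Ai] i.
  by rewrite leq_eqVlt ltnS => /orP[/eqP ->//|/Ai].
have [f fP] : {f : nat * nat -> nat & forall mN,
    (forall i, (i <= mN.1)%N -> A i (f mN)) /\ (mN.2 < f mN)%N}.
  apply: (@choice _ _ (fun mN k => (forall i, (i <= mN.1)%N -> A i k) /\ (mN.2 < k)%N)).
  move=> [m N] /=; have UN : U [set k | (N < k)%N] by apply: Uoo; exists N.+1.
  by have [k [Ak Nk]] := filter_ex (filterI (UB m) UN); exists k.
pose s := fix s m := if m is m'.+1 then f (m, s m') else f (0, 0)%N.
exists s.
  by apply: homo_ltn => [i j k|m]; [exact: ltn_trans|exact: (fP (m.+1, s m)).2].
by move=> i [|m] im; [have := (fP (0, 0)%N).1|have := (fP (m.+1, s m)).1]; apply.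
Qed.

End ultra.

(** Used cell by cell, with the means of [f1] and [f2] for [a] and [b]. *)
Lemma integral_norm_triangle d (T : measurableType d) (R : realType)
    (mu : {measure set T -> \bar R}) (D : set T) (f1 f2 : T -> R) (a b : R) :
  measurable D -> measurable_fun D f1 -> measurable_fun D f2 ->
  (\int[mu]_(x in D) `|f1 x - f2 x|%:E <=
   \int[mu]_(x in D) `|f1 x - a|%:E + \int[mu]_(x in D) `|f2 x - b|%:E +
   `|a - b|%:E * mu D)%E.
Proof.
move=> mD m1 m2.
have ma : measurable_fun D (fun x => f1 x - a).
  by apply: measurable_funB; [exact: m1|exact: measurable_cst].
have mb : measurable_fun D (fun x => f2 x - b).
  by apply: measurable_funB; [exact: m2|exact: measurable_cst].
have mc : measurable_fun D (fun=> `|a - b|) := measurable_cst _.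
have na : measurable_fun D (fun x => `|f1 x - a|) .
  exact: measurableT_comp ma.
have nb : measurable_fun D (fun x => `|f2 x - b|) .
  exact: measurableT_comp mb.
have nab : measurable_fun D (fun x => `|f1 x - a| + `|f2 x - b|) by exact: measurable_funD na nb.
have /= <- := integral_cst mu mD `|a - b|%:E.
have E1 : (\int[mu]_(x in D) (`|f1 x - a|%:E + `|f2 x - b|%:E) =
   \int[mu]_(x in D) `|f1 x - a|%:E + \int[mu]_(x in D) `|f2 x - b|%:E)%E.
  apply: ge0_integralD.
  - exact: mD.
  - by move=> x _; rewrite lee_fin.
  - exact/measurable_EFinP.
  - by move=> x _; rewrite lee_fin.
  - exact/measurable_EFinP.
rewrite -E1.
have E2 : (\int[mu]_(x in D) ((`|f1 x - a| + `|f2 x - b|)%:E + `|a - b|%:E) =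
   \int[mu]_(x in D) (`|f1 x - a| + `|f2 x - b|)%:E + \int[mu]_(x in D) `|a - b|%:E)%E.
  apply: ge0_integralD.
  - exact: mD.
  - by move=> x _; rewrite lee_fin addr_ge0.
  - exact/measurable_EFinP.
  - by move=> x _; rewrite lee_fin.
  - exact/measurable_EFinP.
rewrite -E2; apply: (le_integral_norm mu mD (g := fun x => `|f1 x - a| + `|f2 x - b| + `|a - b|)).
- exact: measurable_funB m1 m2.
- exact: measurable_funD nab mc.
- move=> x _.
  have -> : f1 x - f2 x = (f1 x - a) - (f2 x - b) + (a - b) by ring.
  by rewrite (le_trans (ler_normD _ _))// lerD2r ler_normB.
Qed.

Section rellich.
Context {R : realType} {n : nat} (q : 'rV[R]_n) (L : R).
Hypothesis L0 : 0 < L.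
Local Notation V := 'rV[R]_n.
Local Notation lambda := (@lebesgue R n).
Local Notation Q := (cube q L).

Let mQ : measurable Q. Proof. exact: measurable_cube. Qed.

Let c1 : R := (2 `^ 1) ^+ n * grad_cst n (1 : R).

Let c1_gt0 : 0 < c1.
Proof. by rewrite mulr_gt0 ?exprn_gt0 ?powR_gt0// grad_cst_gt0. Qed.

Lemma poincare_cube1 z (h : R) (u : V -> R) (g : V -> V) : 0 < h ->
  L1loc lambda u -> is_weak_grad u g ->
  (\int[lambda]_(y in cube z h) `|u y - cube_mean z h u|%:E <=
   (c1 * h)%:E * \sum_(i < n) \int[lambda]_(y in cube z h) `|g y ord0 i|%:E)%E.
Proof.
move=> h0 lu ug; set S := (\sum_(i < n) _)%E.
have S0 : (0 <= S)%E.
  by apply: sume_ge0 => i _; apply: integral_ge0 => y _; rewrite lee_fin.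
have Sfin : S \is a fin_num.
  rewrite ge0_fin_numE//; apply: lte_sum_pinfty => i _.
  by have /integrableP[_] := L1loc_integrable_cube z h (ug i).1.
have := @poincare_cube R n z h h0 u g 1 (fine S) lu ug (lexx _).
have E1 : (\sum_(i < n) \int[lambda]_(y in cube z h) (`|g y ord0 i| `^ 1)%:E <= (fine S)%:E)%E.
  rewrite fineK//; apply: lee_sum => i _; rewrite le_eqVlt; apply/orP; left; apply/eqP.
  by apply: eq_integral => y _; rewrite powRr1.
move=> /(_ E1); rewrite (powRr1 (ltW h0)).
have -> : (\int[lambda]_(y in cube z h) (`|u y - cube_mean z h u| `^ 1)%:E =
    \int[lambda]_(y in cube z h) `|u y - cube_mean z h u|%:E)%E.
  by apply: eq_integral => y _; rewrite powRr1.
move/le_trans; apply; rewrite -(fineK Sfin) -EFinM lee_fin /c1.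
rewrite le_eqVlt; apply/orP; left; apply/eqP.
by move: (grad_cst n 1) ((2 `^ 1) ^+ n) (fine S) => a b f /=; ring.
Qed.

Variables (u : nat -> V -> R) (g : nat -> V -> V) (K : R).
Hypotheses (lu : forall k, L1loc lambda (u k)) (ug : forall k, is_weak_grad (u k) (g k)).
Hypothesis gK : forall k, (\sum_(i < n) \int[lambda]_(y in Q) `|g k y ord0 i|%:E <= K%:E)%E.
Hypothesis uK : forall k, (\int[lambda]_(y in Q) `|u k y|%:E <= K%:E)%E.

Let K0 : 0 <= K.
Proof.
by rewrite -lee_fin (le_trans _ (uK 0))//; apply: integral_ge0 => y _; rewrite lee_fin.
Qed.

Let mu D k : measurable_fun D (u k).
Proof. by apply: measurable_funTS; have [] := lu k. Qed.

Let mg D k i : measurable_fun D (fun y => g k y ord0 i).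
Proof. by apply: measurable_funTS; have [[]] := ug k i. Qed.

Let cell_err M k : (\sum_(z : {ffun 'I_n -> 'I_M.+1}) \int[lambda]_(y in cell q L z)
    `|u k y - cube_mean (corner q L z) (mesh L M) (u k)|%:E <= (c1 * mesh L M * K)%:E)%E.
Proof.
have h0 := mesh_gt0 M L0; have ch : 0 <= c1 * mesh L M by rewrite mulr_ge0// ltW.
apply: (@le_trans _ _ (\sum_(z : {ffun 'I_n -> 'I_M.+1}) ((c1 * mesh L M)%:E *
    \sum_(i < n) \int[lambda]_(y in cell q L z) `|g k y ord0 i|%:E))%E).
  by apply: lee_sum => z _; exact: poincare_cube1 (ug k).
rewrite -ge0_sume_distrr; last first.
  move=> z _; apply: sume_ge0 => i _; apply: integral_ge0 => y _; by rewrite lee_fin.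
rewrite exchange_big/= [in leRHS]EFinM.
have chE : (0 <= (c1 * mesh L M)%:E)%E by rewrite lee_fin.

apply: (lee_wpmul2l chE).
apply: le_trans (gK k); apply: lee_sum => i _.
have mgi : measurable_fun Q (fun y => `|g k y ord0 i|).
  by apply: measurableT_comp; [exact: normr_measurable|exact: mg].
rewrite (integral_cells M L0 mgi); exact: lexx.
Qed.

Let cell_mean_le M k (z : {ffun 'I_n -> 'I_M.+1}) :
  `|cube_mean (corner q L z) (mesh L M) (u k)| <= K / mesh L M ^+ n.
Proof.
have h0 := mesh_gt0 M L0; have hn0 : 0 < mesh L M ^+ n by rewrite exprn_gt0.
rewrite /cube_mean normrM normfV (gtr0_norm hn0) ler_pM2r ?invr_gt0//.
have iu := L1loc_integrable_cube (corner q L z) (mesh L M) (lu k).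
have mC : measurable (cube (corner q L z) (mesh L M)) by exact: measurable_cube.
rewrite -lee_fin (EFin_normr_Rintegral mC iu).
apply: le_trans (le_abse_integral lambda mC (measurable_int _ iu)) _.
apply: le_trans (uK k); apply: ge0_subset_integral.
- exact: mC.
- exact: mQ.
- by apply/measurable_EFinP; apply: measurableT_comp; [exact: normr_measurable|exact: mu].
- by move=> y _; rewrite lee_fin.
- exact: cell_sub.
Qed.

(** Total boundedness: on a fine mesh [u j] and [u k] are close to their cell means by Poincaré's
    inequality, and these finitely many bounded means are Cauchy along [U]. The two oscillations get
    e/4 each, the means e/2. *)
Let ultra_L1 (U : set_system nat) (UU : UltraFilter U) (e : R) : 0 < e ->
  exists2 A, U A & forall j k, A j -> A k ->
    (\int[lambda]_(y in Q) `|u j y - u k y|%:E <= e%:E)%E.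
Proof.
(* With N + 1 cells per side the total oscillation c1 h K is at most e/4. *)
move=> e0; pose N := Num.bound (4 * c1 * L * K / e).
have NP : 4 * c1 * L * K / e < N.+1%:R.
  apply: lt_trans (_ : N%:R < _); last by rewrite ltr_nat.
  apply: archi_boundP; apply: divr_ge0 (ltW e0).
  exact: mulr_ge0 (mulr_ge0 (mulr_ge0 (ler0n _ 4) (ltW c1_gt0)) (ltW L0)) K0.
have h0 := mesh_gt0 N L0; set h := mesh L N in h0.
have err : c1 * h * K <= e / 4.
  have : 4 * c1 * L * K <= e * N.+1%:R by rewrite -ler_pdivrMl// mulrC ltW.
  rewrite -(meshE L N) -/h => H.
  have N0 : 0 < N.+1%:R :> R by rewrite ltr0n.
  rewrite -(ler_pM2r N0) -(ler_pM2r (ltr0Sn R 3)).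
  have E : 4 * c1 * (h * N.+1%:R) * K = c1 * h * K * N.+1%:R * 4.
    by ring.
  by rewrite -E; move: H; lra.
have Ln0 : 0 < 2 * L ^+ n by rewrite mulr_gt0// exprn_gt0.
have [A0 A0P] : {A : {ffun 'I_n -> 'I_N.+1} -> set nat & forall z, U (A z) /\ forall j k,
    A z j -> A z k -> `|cube_mean (corner q L z) h (u j) - cube_mean (corner q L z) h (u k)| <=
      e / (2 * L ^+ n)}.
  apply: (@choice _ _ (fun z A => U A /\ forall j k, A j -> A k ->
    `|cube_mean (corner q L z) h (u j) - cube_mean (corner q L z) h (u k)| <=
      e / (2 * L ^+ n))) => z.
  have [A UA AP] := ultra_bounded_cauchy UU (fun k => cell_mean_le k z) (divr_gt0 e0 Ln0).
  by exists A.
exists [set k | forall z, A0 z k].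
  by apply: ultra_forall => z; have [] := A0P z.
move=> j k Aj Ak.
have mjk : measurable_fun Q (fun y => `|u j y - u k y|).
  apply: measurableT_comp; first exact: normr_measurable.
  exact: measurable_funB (@mu Q j) (@mu Q k).
rewrite (integral_cells N L0 mjk).
have T (z : {ffun 'I_n -> 'I_N.+1}) := integral_norm_triangle lambda (cube_mean (corner q L z) h (u j))
   (cube_mean (corner q L z) h (u k)) (measurable_cell q L z) (@mu _ j) (@mu _ k).
apply: (@le_trans _ _ (\sum_(z : {ffun 'I_n -> 'I_N.+1})
  (\int[lambda]_(y in cell q L z) `|u j y - cube_mean (corner q L z) h (u j)|%:E +
   \int[lambda]_(y in cell q L z) `|u k y - cube_mean (corner q L z) h (u k)|%:E +
   `|cube_mean (corner q L z) h (u j) - cube_mean (corner q L z) h (u k)|%:E *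
     lambda (cell q L z)))%E).
  by apply: lee_sum => z _; exact: T.
rewrite big_split/= big_split/=.
have E : ((e%:E = (e / 4)%:E + (e / 4)%:E + (e / 2)%:E))%E.
  by rewrite -!EFinD; congr EFin; lra.
rewrite E; apply: leeD; first apply: leeD.
- by apply: le_trans (cell_err N j) _; rewrite lee_fin.
- by apply: le_trans (cell_err N k) _; rewrite lee_fin.
- apply: (@le_trans _ _ (\sum_(z : {ffun 'I_n -> 'I_N.+1}) (e / (2 * L ^+ n) * h ^+ n)%:E)%E).
    apply: lee_sum => z _.
    have -> : lebesgue (cell q L z) = (h ^+ n)%:E := lebesgue_cube _ h0.
    rewrite -EFinM lee_fin ler_pM2r ?exprn_gt0//.
    by have [_] := A0P z; apply; [exact: Aj|exact: Ak].
  rewrite sumEFin lee_fin sumr_const card_ffun !card_ord -[leLHS]mulr_natr natrX.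
  have hN : h ^+ n * N.+1%:R ^+ n = L ^+ n by rewrite -exprMn meshE.
  rewrite -(mulrA _ (h ^+ n)) hN le_eqVlt; apply/orP; left; apply/eqP.
  have : L ^+ n != 0 by rewrite expf_neq0// gt_eqF.
  by move: (L ^+ n) => x x0; field.
Qed.

Lemma rellich_ae : exists (s : nat -> nat) (l : V -> R),
  [/\ {homo s : i j / (i < j)%N}, measurable_fun setT l &
    {ae lambda, forall y, Q y -> (fun m => u (s m) y) @ \oo --> l y}].
Proof.
have [U UU Uoo] := ultra_nat.
have pk k : 0 < 1 / (2 ^ k.+1)%:R :> R by rewrite divr_gt0// ltr0n expn_gt0.
have [A AP] : {A : nat -> set nat & forall m, U (A m) /\ forall j k, A m j -> A m k ->
    (\int[lambda]_(y in Q) `|u j y - u k y|%:E <= (1 / (2 ^ m.+1)%:R)%:E)%E}.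
  apply: (@choice _ _ (fun m A => U A /\ forall j k, A j -> A k ->
    (\int[lambda]_(y in Q) `|u j y - u k y|%:E <= (1 / (2 ^ m.+1)%:R)%:E)%E)) => m.
  by have [A UA AP] := ultra_L1 UU (pk m); exists A.
have [s s_homo sA] := ultra_subseq UU Uoo (fun m => (AP m).1).
have sP m : (\int[lambda]_(y in Q) `|u (s m.+1) y - u (s m) y|%:E <= (1 / (2 ^ m.+1)%:R)%:E)%E.
  by apply: (AP m).2; apply: sA.
have md m : measurable_fun Q (fun y => u (s m.+1) y - u (s m) y).
  exact: measurable_funB (@mu Q _) (@mu Q _).
have i0 m : (0 <= \int[lambda]_(y in Q) `|u (s m.+1) y - u (s m) y|%:E)%E.
  by apply: integral_ge0 => y _; rewrite lee_fin.
have H := summable_ae (mu := lambda) mQ md (fast_sum_lty i0 sP).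
(* The upper limit is measurable everywhere and equals the limit where there is one; [fine] sends
   infinite values to 0. *)
pose l y := fine (limn_esup (fun m => (u (s m) y)%:E)).
exists s, l; split; first exact: s_homo.
  apply: measurableT_comp; first exact: fine_measurable.
  by apply: measurable_fun_limn_esup => m; apply/measurable_EFinP; exact: mu.
move: H; apply: filterS => y H Qy.
have cv : cvgn (fun m => u (s m) y).
  have /cvg_series_norm/normed_cvg/cvg_ex[r Hr] := H Qy.
  apply/cvg_ex; exists (u (s 0%N) y + r).
  have : (fun m => u (s 0%N) y + series (fun m => u (s m.+1) y - u (s m) y) m) @ \oo -->
      u (s 0%N) y + r by apply: cvgD; [exact: cvg_cst|exact: Hr].
  have -> // : (fun m => u (s 0%N) y + series (fun m => u (s m.+1) y - u (s m) y) m) =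
      (fun m => u (s m) y).
  apply/funext => m; rewrite /series/= (telescope_sumr (fun m => u (s m) y))//.
  by rewrite addrC subrK.
have cvE : (fun m => (u (s m) y)%:E) @ \oo --> (limn (fun m => u (s m) y))%:E.
  by apply: cvg_EFin => //; exact: nearW.
rewrite /l is_cvg_limn_esupE; last by apply/cvg_ex; eexists; exact: cvE.
have -> : limn (fun m => (u (s m) y)%:E) = (limn (fun m => u (s m) y))%:E.
  exact: cvg_lim cvE.
exact: cv.
Qed.

End rellich.

(** * Weighted norms *)

Section density.
Import HBNNSimple.
Context d (T : measurableType d) (R : realType) (mu m : {measure set T -> \bar R}).
Variable w : T -> R.
Hypotheses (mw : measurable_fun setT w) (w0 : forall x, 0 <= w x).
Hypothesis mE : forall A, measurable A -> m A = (\int[mu]_(x in A) (w x)%:E)%E.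
Local Open Scope ereal_scope.

Let density_nnsfun (h : {nnsfun T >-> R}) :
  \int[m]_x (h x)%:E = \int[mu]_x (h x * w x)%:E.
Proof.
have mhw y : measurable_fun setT (fun x => (y * \1_(h @^-1` [set y]) x * w x)%R).
  apply: measurable_funM mw; apply: measurable_funM; first exact: measurable_cst.
  exact/measurable_indic/measurable_sfunP.
rewrite integralT_nnsfun sintegralE.
transitivity (\int[mu]_x (\sum_(y \in range h) (y * \1_(h @^-1` [set y]) x * w x)%:E)).
  rewrite ge0_integral_fsum //; last 2 first.
  - by move=> y; apply/measurable_EFinP; exact: mhw.
  - move=> y x _; rewrite EFinM; apply: mule_ge0; first exact: nnfun_muleindic_ge0.
    by rewrite lee_fin.
  apply: eq_fsbigr => y; rewrite inE => -[x0 _ <-].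
  have hx0 : (0 <= h x0)%R by [].
  move: (h x0) hx0 => {x0}y y0.
  rewrite mE; last exact: measurable_sfunP.
  have mhy : measurable (h @^-1` [set y]) by exact: measurable_sfunP.
  rewrite integral_mkcond -ge0_integralZl//=.
  - apply: eq_integral => x _; rewrite /patch indicE; case: ifPn => xh.
      by rewrite -EFinM mulr1.
    by rewrite mule0 mulr0 mul0r.
  - by apply/(measurable_restrictT _ mhy).1/measurable_EFinP/measurable_funTS.
  - by move=> x _; rewrite /patch; case: ifP => _//; rewrite lee_fin.
apply: eq_integral => x _; rewrite fsumEFin//; congr EFin.
by rewrite [in RHS](fimfunE h x) mulr_fsuml.
Qed.

(** Both sides agree on simple functions and follow increasing approximations by monotone
    convergence. *)
Lemma ge0_integral_density (f : T -> R) : measurable_fun setT f ->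
  (forall x, 0 <= f x)%R ->
  \int[m]_x (f x)%:E = \int[mu]_x (f x * w x)%:E.
Proof.
move=> mf f0; have mfE : measurable_fun setT (EFin \o f) by exact/measurable_EFinP.
pose h := nnsfun_approx measurableT mfE.
have hcv x : (fun k => (h k x)%:E) @ \oo --> (f x)%:E.
  by apply: (cvg_nnsfun_approx measurableT mfE) => // y _; rewrite lee_fin.
have hnd x : {homo h ^~ x : a b / (a <= b)%N >-> (a <= b)%R}.
  by move=> a b ab; exact/lefP/nd_nnsfun_approx.
have mh k : measurable_fun setT (h k) by exact: measurable_funP.
have H1 := @cvg_monotone_convergence _ T R m setT measurableT (fun k x => (h k x)%:E)
  (fun k => (measurable_EFinP _ _).2 (mh k)).
have H2 := @cvg_monotone_convergence _ T R mu setT measurableT (fun k x => (h k x * w x)%:E)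
  (fun k => (measurable_EFinP _ _).2 (measurable_funM (mh k) mw)).
have E1 : (fun x => limn (fun k => (h k x)%:E)) = (fun x => (f x)%:E).
  by apply/funext => x; exact/cvg_lim.
have E2 : (fun x => limn (fun k => (h k x * w x)%:E)) = (fun x => (f x * w x)%:E).
  apply/funext => x; apply/cvg_lim => //.
  rewrite EFinM; have -> : (fun k => (h k x * w x)%:E) = (fun k => (h k x)%:E * (w x)%:E).
    by apply/funext => k; rewrite EFinM.
  by apply: cvgeZr; [exact: isT|exact: hcv].
rewrite E1 in H1; rewrite E2 in H2.
have H3 : (fun k => \int[mu]_x (h k x * w x)%:E) @ \oo --> \int[m]_x (f x)%:E.
  have -> : (fun k => \int[mu]_x (h k x * w x)%:E) = (fun k => \int[m]_x (h k x)%:E).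
    by apply/funext => k; rewrite -density_nnsfun.
  apply: H1.
  - by move=> k x _; rewrite lee_fin.
  - by move=> x _ a b ab; rewrite lee_fin; exact: hnd.
apply: (cvg_unique _ H3); first exact: ereal_hausdorff.
apply: H2.
- by move=> k x _; rewrite lee_fin mulr_ge0.
- by move=> x _ a b ab; rewrite lee_fin ler_wpM2r//; exact: hnd.
Qed.

End density.

Section Lnorm_integral.
Context d (T : measurableType d) (R : realType) (m : {measure set T -> \bar R}).
Variable p : R.
Hypothesis p0 : 0 < p.
Local Open Scope ereal_scope.
Implicit Types u : T -> R.

Let powE u x : `|(EFin \o u) x| `^ p = (`|u x| `^ p)%:E.
Proof. exact: poweR_EFin. Qed.

Lemma Lnorm_powR u : 'N[m]_p%:E[EFin \o u] `^ p = \int[m]_x (`|u x| `^ p)%:E.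
Proof.
rewrite poweR_Lnorm ?gt_eqF//; apply: eq_integral => x _; exact: powE.
Qed.

Let int_ge0 u : 0 <= \int[m]_x (`|u x| `^ p)%:E.
Proof. by apply: integral_ge0 => x _; rewrite lee_fin powR_ge0. Qed.

Lemma Lnorm_le u (t : R) : (0 <= t)%R ->
  ('N[m]_p%:E[EFin \o u] <= t%:E) = (\int[m]_x (`|u x| `^ p)%:E <= (t `^ p)%:E).
Proof.
move=> t0; rewrite -Lnorm_powR -poweR_EFin.
have N0 := Lnorm_ge0 m p%:E (EFin \o u).
have inI (x : \bar R) : 0 <= x -> x \in `[0, +oo] by rewrite in_itv/= leey andbT.
apply/idP/idP => [H|H].
  exact: (gt0_ler_poweR (ltW p0) (inI _ N0) (inI t%:E _)).
rewrite -(poweRe1 N0) -(@divff _ p) ?gt_eqF// poweRrM.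
have -> : t%:E = (t%:E `^ p) `^ p^-1.
  by rewrite -poweRrM divff ?gt_eqF// poweRe1// lee_fin.
apply: (gt0_ler_poweR _ (inI _ (poweR_ge0 _ _)) (inI _ (poweR_ge0 _ _)) H).
by rewrite invr_ge0 ltW.
Qed.

Lemma LfunE u : (u \in Lfun m p%:E) <->
  measurable_fun setT u /\ \int[m]_x (`|u x| `^ p)%:E < +oo.
Proof.
rewrite -Lnorm_powR; split => [/andP[]|[mu uoo]].
  rewrite !inE/= => mu uoo; split; first exact: mu.
  by apply: poweR_lty; exact: uoo.
apply/andP; split; rewrite inE/=; first exact: mu.
by apply: lty_poweRy uoo; rewrite gt_eqF.
Qed.

End Lnorm_integral.

Section weighted_integrals.
Context {R : realType} {n : nat}.
Local Notation V := 'rV[R]_n.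
Local Notation lambda := (@lebesgue R n).
Local Open Scope ereal_scope.

Lemma ge0_integral_weighted (w : weight R n) (f : V -> R) : measurable_fun setT f ->
  (forall x, 0 <= f x)%R ->
  \int[weighted w]_x (f x)%:E = \int[lambda]_x (f x * w x)%:E.
Proof.
move=> mf f0; apply: (ge0_integral_density _ _ _ mf f0).
- exact: weight_measurable.
- exact: weight_ge0.
- by [].
Qed.

(** The restricted measure has density w times the indicator of [E]. *)
Lemma ge0_integral_mrestr_weighted (w : weight R n) (E : set V) (mE : measurable E)
    (f : V -> R) : measurable_fun setT f -> (forall x, 0 <= f x)%R ->
  \int[mrestr (weighted w) mE]_x (f x)%:E = \int[lambda]_(x in E) (f x * w x)%:E.
Proof.
move=> mf f0.
have m1 : measurable_fun setT (fun x => w x * \1_E x)%R.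
  by apply: measurable_funM; [exact: weight_measurable|exact: measurable_indic].
rewrite (@ge0_integral_density _ _ _ lambda (mrestr (weighted w) mE) _ m1)//.
- rewrite [RHS]integral_mkcond; apply: eq_integral => x _.
  by rewrite /patch indicE; case: (x \in E); rewrite ?mulr1// !mulr0.
- by move=> x; rewrite mulr_ge0// weight_ge0.
- move=> A mA.
  transitivity (\int[lambda]_(x in A `&` E) (w x)%:E); first by [].
  rewrite integral_mkcondr.
  apply: eq_integral => x _.
  by rewrite /patch indicE; case: (x \in E); rewrite ?mulr1// mulr0.
Qed.

End weighted_integrals.

(** * Weighted embeddings *)

(** Young's inequality for a^p w and w^(-alpha) with t = 1/(1 + alpha), for which the powers of w
    cancel. It stands in for Hölder's inequality between the weighted L^p and the plain L^s norm. *)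
Lemma powR_weight_young (R : realType) (alpha p a w : R) : 0 < alpha ->
  0 <= a -> 0 < w ->
  a `^ (p * alpha / (1 + alpha)) <= a `^ p * w + w `^ (- alpha).
Proof.
move=> al0 a0 w0; have al1 : 0 < 1 + alpha by rewrite addr_gt0.
pose t := (1 + alpha)^-1.
have tE : 1 - t = alpha / (1 + alpha) by rewrite /t; field; rewrite gt_eqF.
have t01 : 0 <= t <= 1.
  by rewrite invr_ge0 (ltW al1)/= -subr_ge0 tE divr_ge0 ?(ltW al1)// ltW.
have A0 : 0 <= a `^ p * w by rewrite mulr_ge0 ?powR_ge0// ltW.
apply: le_trans (powR_young A0 (powR_ge0 w (- alpha)) t01).
rewrite powRM ?powR_ge0 ?(ltW w0)// -!powRrM -[leRHS]mulrA -powRD ?(gt_eqF w0) ?implybT//.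
have -> : 1 - t + - alpha * t = 0 by rewrite tE /t; field; rewrite gt_eqF.
by rewrite powRr0 mulr1 tE mulrA.
Qed.

(** Young's inequality with exponents beta/(beta-1) and beta. A small [e] will give compactness at
    the endpoint. *)
Lemma powR_density_young (R : realType) (beta q x v e : R) : 1 < beta ->
  0 <= x -> 0 <= v -> 0 < e ->
  x `^ q * v <= e * x `^ (q * (beta / (beta - 1))) +
    e `^ (- (beta - 1)) * v `^ beta.
Proof.
move=> b1 x0 v0 e0; have b0 : 0 < beta by rewrite (lt_trans _ b1).
have b10 : 0 < beta - 1 by rewrite subr_gt0.
have t01 : 0 < beta^-1 <= 1 by rewrite invr_gt0 b0 invf_le1// ltW.
have := powR_young_eps (powR_ge0 x (q * (beta / (beta - 1)))) (powR_ge0 v beta) t01 e0.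
rewrite -!powRrM divff ?gt_eqF// powRr1//.
have -> : q * (beta / (beta - 1)) * (1 - beta^-1) = q by field; rewrite !gt_eqF.
by have -> : (1 - beta^-1) / beta^-1 = beta - 1 by field; rewrite gt_eqF.
Qed.

(** The common shape of the estimates below: a pointwise bound by two functions and a constant,
    integrated. *)
Lemma integral_bound d (T : measurableType d) (R : realType)
    (mu : {measure set T -> \bar R}) (D : set T) (f f1 f2 : T -> R)
    (a b c A1 A2 V : R) : measurable D ->
  measurable_fun D f -> measurable_fun D f1 -> measurable_fun D f2 ->
  (forall x, D x -> 0 <= f x) -> (forall x, D x -> 0 <= f1 x) ->
  (forall x, D x -> 0 <= f2 x) -> 0 <= a -> 0 <= b -> 0 <= c ->
  {ae mu, forall x, D x -> f x <= a * f1 x + b * f2 x + c} ->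
  (\int[mu]_(x in D) (f1 x)%:E <= A1%:E)%E ->
  (\int[mu]_(x in D) (f2 x)%:E <= A2%:E)%E -> (mu D <= V%:E)%E ->
  (\int[mu]_(x in D) (f x)%:E <= (a * A1 + b * A2 + c * V)%:E)%E.
Proof.
move=> mD mf m1 m2 f0 f10 f20 a0 b0 c0 fle I1 I2 DV.
have ma : measurable_fun D (fun x => a * f1 x).
  by apply: measurable_funM; [exact: measurable_cst|exact: m1].
have mb : measurable_fun D (fun x => b * f2 x).
  by apply: measurable_funM; [exact: measurable_cst|exact: m2].
have mc : measurable_fun D (fun=> c) := measurable_cst _.
have mab : measurable_fun D (fun x => a * f1 x + b * f2 x) := measurable_funD ma mb.
have mabc : measurable_fun D (fun x => a * f1 x + b * f2 x + c) := measurable_funD mab mc.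
have a0' x : D x -> 0 <= a * f1 x by move=> Dx; rewrite mulr_ge0// f10.
have b0' x : D x -> 0 <= b * f2 x by move=> Dx; rewrite mulr_ge0// f20.
have ab0 x : D x -> 0 <= a * f1 x + b * f2 x by move=> Dx; rewrite addr_ge0 ?a0' ?b0'.
apply: (@le_trans _ _ (\int[mu]_(x in D) (a * f1 x + b * f2 x + c)%:E)%E).
  apply: ae_ge0_le_integral.
  - exact: mD.
  - by move=> x Dx; rewrite lee_fin f0.
  - exact/measurable_EFinP.
  - by move=> x Dx; rewrite lee_fin addr_ge0 ?ab0.
  - exact/measurable_EFinP.
  - by move: fle; apply: filterS => x H Dx; rewrite lee_fin; exact: H.
have E1 : (\int[mu]_(x in D) (a * f1 x + b * f2 x + c)%:E =
    \int[mu]_(x in D) (a * f1 x + b * f2 x)%:E + \int[mu]_(x in D) c%:E)%E.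
  rewrite -ge0_integralD.
  - by apply: eq_integral => x _; rewrite EFinD.
  - exact: mD.
  - by move=> x Dx; rewrite lee_fin ab0.
  - exact/measurable_EFinP.
  - by move=> x _; rewrite lee_fin.
  - exact/measurable_EFinP.
have E2 : (\int[mu]_(x in D) (a * f1 x + b * f2 x)%:E =
    \int[mu]_(x in D) (a * f1 x)%:E + \int[mu]_(x in D) (b * f2 x)%:E)%E.
  rewrite -ge0_integralD.
  - by apply: eq_integral => x _; rewrite EFinD.
  - exact: mD.
  - by move=> x Dx; rewrite lee_fin a0'.
  - exact/measurable_EFinP.
  - by move=> x Dx; rewrite lee_fin b0'.
  - exact/measurable_EFinP.
have E3 (k : R) (F : T -> R) : 0 <= k -> measurable_fun D F -> (forall x, D x -> 0 <= F x) ->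
    (\int[mu]_(x in D) (k * F x)%:E = k%:E * \int[mu]_(x in D) (F x)%:E)%E.
  move=> k0 mF F0; rewrite -ge0_integralZl_EFin.
  - by apply: eq_integral => x _; rewrite EFinM.
  - exact: mD.
  - by move=> x Dx; rewrite lee_fin F0.
  - exact/measurable_EFinP.
  - exact: k0.
rewrite E1 E2 (E3 a f1)// (E3 b f2)//; have /= -> := integral_cst mu mD c%:E.
rewrite !EFinD !EFinM; apply: leeD; first apply: leeD; apply: lee_wpmul2l => //.
Qed.

Section sobolev_family.
Context {R : realType} {n : nat} (z : 'rV[R]_n) (L s : R).
Local Notation V := 'rV[R]_n.
Local Notation lambda := (@lebesgue R n).
Local Notation Q := (cube z L).

(** What both spaces provide on [Q] for a function of norm at most [N]. The constant [K] is the same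
    for all functions, and the powers of [N] keep the bounds homogeneous. *)
Definition sobolev_family (K N : R) (u : V -> R) := L1loc lambda u /\
  exists g, [/\ is_weak_grad u g,
    (\sum_(i < n) \int[lambda]_(y in Q) (`|g y ord0 i| `^ s)%:E <= (K * N `^ s)%:E)%E &
    `|cube_mean z L u| <= K * N].

Hypotheses (L0 : 0 < L) (n2 : (2 <= n)%N) (s1 : 1 <= s) (sn : s < n%:R).
Local Notation st := (n%:R * s / (n%:R - s)).

Let mQ : measurable Q. Proof. exact: measurable_cube. Qed.

Let lQ : (lambda Q <= (L ^+ n)%:E)%E.
Proof. by have -> : lambda Q = (L ^+ n)%:E := lebesgue_cube z L0. Qed.

Let Ln0 : 0 < L ^+ n. Proof. by rewrite exprn_gt0. Qed.

Lemma sobolev_exponent_ge1 : 1 <= st.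
Proof.
have ns0 : 0 < n%:R - s by rewrite subr_gt0.
rewrite ler_pdivlMr// mul1r; apply: (@le_trans _ _ n%:R).
  by rewrite gerBl (le_trans _ s1).
by rewrite ler_peMr.
Qed.

Let st0 : 0 <= st. Proof. exact: le_trans sobolev_exponent_ge1. Qed.

Lemma sobolev_family_poincare (K : R) : 0 < K -> exists2 C, 0 <= C &
  forall N u g, 0 < N -> L1loc lambda u -> is_weak_grad u g ->
  (\sum_(i < n) \int[lambda]_(y in Q) (`|g y ord0 i| `^ s)%:E <= (K * N `^ s)%:E)%E ->
  (\int[lambda]_(y in Q) (`|u y - cube_mean z L u| `^ st)%:E <= (C * N `^ st)%:E)%E.
Proof.
move=> K0; have [C C0 CP] := sobolev_poincare_cube n2 s1 sn.
have ns0 : 0 < n%:R - s by rewrite subr_gt0.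
exists (C * K `^ (n%:R / (n%:R - s))); first by rewrite mulr_ge0 ?powR_ge0// ltW.
move=> N u g N0 lu ug gK.
have KN : 0 < K * N `^ s by rewrite mulr_gt0// powR_gt0.
have := CP z L u g _ L0 lu ug KN gK.
rewrite powRM ?(ltW K0) ?powR_ge0// -powRrM mulrA.
by have -> : s * (n%:R / (n%:R - s)) = st by rewrite mulrCA mulrA.
Qed.

Let mpow (u : V -> R) c t : L1loc lambda u ->
  measurable_fun Q (fun y => `|u y - c| `^ t).
Proof.
move=> [mu _]; apply: (@measurable_norm_powR _ _ _ Q).
apply: measurable_funB; last exact: measurable_cst.
exact: measurable_funTS.
Qed.

Lemma sobolev_family_bound (K : R) : 0 < K -> exists2 C, 0 <= C &
  forall N u, 0 < N -> sobolev_family K N u ->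
  (\int[lambda]_(y in Q) (`|u y| `^ st)%:E <= (C * N `^ st)%:E)%E.
Proof.
move=> K0; have [C C0 CP] := sobolev_family_poincare K0.
exists (2 `^ st * C + 2 `^ st * K `^ st * L ^+ n).
  by rewrite addr_ge0// !mulr_ge0 ?powR_ge0// ltW.
move=> N u N0 [lu [g [ug gK uK]]].
have N0' := ltW N0; have K0' := ltW K0.
have I1 := CP N u g N0 lu ug gK.
have I2 : (\int[lambda]_(y in Q) (0 : R)%:E <= (0 : R)%:E)%E by rewrite integral0.
have m0 : measurable_fun Q (fun=> 0 : R) := measurable_cst _.
have mst : measurable_fun Q (fun y => `|u y| `^ st).
  by have := mpow 0 st lu; under eq_fun do rewrite subr0.
have c0 : 0 <= 2 `^ st * (K * N) `^ st by rewrite mulr_ge0 ?powR_ge0.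
have := @integral_bound _ _ _ lambda Q (fun y => `|u y| `^ st)
  (fun y => `|u y - cube_mean z L u| `^ st) (fun=> 0) (2 `^ st) 0
  (2 `^ st * (K * N) `^ st) _ _ _ mQ mst (mpow _ _ lu) m0
  (fun _ _ => powR_ge0 _ _) (fun _ _ => powR_ge0 _ _) (fun _ _ => lexx 0)
  (powR_ge0 _ _) (lexx 0) c0 _ I1 I2 lQ.
rewrite mul0r addr0 powRM// => H; apply: le_trans (H _) _.
  apply: nearW => y _; rewrite ?mul0r ?addr0 -mulrDr.
  set m := cube_mean z L u in uK *.
  have H1 : `|u y| <= `|u y - m| + K * N.
    by rewrite -{1}(subrK m (u y)) (le_trans (ler_normD _ _))// lerD2l.
  apply: le_trans (le_powR2 st0 (normr_ge0 _) H1) _.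
  rewrite -(powRM _ K0' N0').
  exact: powR_addr_le st0 (normr_ge0 _) (mulr_ge0 K0' N0').
rewrite lee_fin le_eqVlt; apply/orP; left; apply/eqP.
by move: (2 `^ st) (K `^ st) (N `^ st) (L ^+ n) => a b c d; ring.
Qed.

(** On a cube, |x| <= 1 + |x|^t turns the bounds on the gradient and on u into L^1 bounds, as
    [rellich_ae] requires. *)
Lemma sobolev_family_rellich (K N : R) (u : nat -> V -> R) : 0 < K -> 0 < N ->
  (forall k, sobolev_family K N (u k)) ->
  exists (s : nat -> nat) (l : V -> R),
  [/\ {homo s : i j / (i < j)%N}, measurable_fun setT l &
    {ae lambda, forall y, Q y -> (fun m => u (s m) y) @ \oo --> l y}].
Proof.
move=> K0 N0 uF; have [C C0 CP] := sobolev_family_bound K0.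
have lu k : L1loc lambda (u k) by have [] := uF k.
have [g gP] : {g : nat -> V -> V & forall k, is_weak_grad (u k) (g k) /\
    (\sum_(i < n) \int[lambda]_(y in Q) (`|g k y ord0 i| `^ s)%:E <= (K * N `^ s)%:E)%E}.
  apply: (@choice _ _ (fun k g => is_weak_grad (u k) g /\
    (\sum_(i < n) \int[lambda]_(y in Q) (`|g y ord0 i| `^ s)%:E <= (K * N `^ s)%:E)%E)) => k.
  by have [_ [g [ug gK _]]] := uF k; exists g.
have Cst0 : 0 <= C * N `^ st by rewrite mulr_ge0// powR_ge0.
have KN0 : 0 <= K * N `^ s by rewrite mulr_ge0 ?powR_ge0// ltW.
pose K1 := C * N `^ st + L ^+ n + (K * N `^ s + n%:R * L ^+ n).
have z0 (f : V -> R) : (\int[lambda]_(y in Q) (0 : R)%:E <= (0 : R)%:E)%E by rewrite integral0.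
have m0 : measurable_fun Q (fun=> 0 : R) := measurable_cst _.
have bound (f : V -> R) (t A : R) : 1 <= t -> measurable_fun Q f ->
    (\int[lambda]_(y in Q) (`|f y| `^ t)%:E <= A%:E)%E ->
    (\int[lambda]_(y in Q) `|f y|%:E <= (A + L ^+ n)%:E)%E.
  move=> t1 mf fA.
  have mfn : measurable_fun Q (fun y => `|f y|) by exact: measurableT_comp mf.
  have := @integral_bound _ _ _ lambda Q (fun y => `|f y|) (fun y => `|f y| `^ t)
    (fun=> 0) 1 0 1 _ _ _ mQ mfn (measurable_norm_powR t mf) m0
    (fun _ _ => normr_ge0 _) (fun _ _ => powR_ge0 _ _) (fun _ _ => lexx 0)
    ler01 (lexx 0) ler01 _ fA (z0 f) lQ.
  rewrite mul0r addr0 !mul1r; apply; apply: nearW => y _; rewrite ?mulr0 ?addr0 ?mul1r addrC.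
  by rewrite -{1}(powRr1 (normr_ge0 (f y))); exact: powR_le1D.
apply: (@rellich_ae R n z L L0 u g K1 lu (fun k => (gP k).1)) => k.
- apply: (@le_trans _ _ (K * N `^ s + n%:R * L ^+ n)%:E); last first.
    by rewrite lee_fin lerDr addr_ge0// ltW.
  have mg i : measurable_fun Q (fun y => g k y ord0 i).
    by apply: measurable_funTS; have [[]] := (gP k).1 i.
  pose J i := (\int[lambda]_(y in Q) (`|g k y ord0 i| `^ s)%:E)%E.
  have J0 i : (0 <= J i)%E by apply: integral_ge0 => y _; rewrite lee_fin powR_ge0.
  have Jfin i : J i \is a fin_num.
    rewrite ge0_fin_numE//; apply: le_lt_trans (ltry (K * N `^ s)).
    apply: le_trans (gP k).2; rewrite (bigD1 i)//= leeDl//.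
    by apply: sume_ge0 => j _; exact: J0.
  apply: (@le_trans _ _ (\sum_(i < n) (fine (J i) + L ^+ n)%:E)%E).
    apply: lee_sum => i _; apply: (bound _ s) => //.
    by rewrite fineK.
  rewrite sumEFin big_split/= sumr_const card_ord -[_ *+ n]mulr_natl lee_fin lerD2r.
  rewrite -lee_fin -sumEFin; apply: le_trans (gP k).2.
  by apply: lee_sum => i _; rewrite fineK.
- apply: (@le_trans _ _ (C * N `^ st + L ^+ n)%:E); last first.
    by rewrite lee_fin lerDl addr_ge0// mulr_ge0// ltW.
  apply: (bound _ st) => //; first exact: sobolev_exponent_ge1.
    by apply: measurable_funTS; have [] := lu k.
  exact: CP.
Qed.

Section weight.
Variables (beta q : R) (E : set V) (v : V -> R) (B : R).
Hypotheses (b1 : 1 < beta) (q1 : 1 <= q) (qst : q * (beta / (beta - 1)) <= st).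
Hypotheses (mE : measurable E) (EQ : E `<=` Q).
Hypotheses (mv : measurable_fun setT v) (v0 : forall x, 0 <= v x).
Hypothesis vB : (\int[lambda]_(y in Q) (v y `^ beta)%:E <= B%:E)%E.

Let q0 : 0 <= q. Proof. exact: le_trans q1. Qed.

Let r0 : 0 <= q * (beta / (beta - 1)).
Proof.
rewrite mulr_ge0 ?divr_ge0//; first by rewrite (le_trans _ (ltW b1)).
by rewrite subr_ge0 ltW.
Qed.

(** The additional [e] pays for raising the exponent q beta/(beta-1) to [st]. *)
Let young (x y e : R) : 0 <= x -> 0 <= y -> 0 < e ->
  x `^ q * y <= e * x `^ st + e `^ (- (beta - 1)) * y `^ beta + e.
Proof.
move=> x0 y0 e0; apply: le_trans (powR_density_young q b1 x0 y0 e0) _.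
rewrite [leRHS]addrAC lerD2r.
have := ler_wpM2l (ltW e0) (powR_le1D r0 qst x0).
by rewrite mulrDr mulr1 addrC.
Qed.

Let mvb : measurable_fun Q (fun x => v x `^ beta).
Proof.
apply: measurable_funTS; apply: (measurableT_comp (measurable_powR beta)); exact: mv.
Qed.

Let muqv (u : V -> R) : measurable_fun setT u -> measurable_fun Q (fun x => `|u x| `^ q * v x).
Proof.
move=> mu; apply: measurable_funM; last exact: measurable_funTS.
by apply: (@measurable_norm_powR _ _ _ Q); exact: measurable_funTS.
Qed.

Let must (u : V -> R) : measurable_fun setT u -> measurable_fun Q (fun x => `|u x| `^ st).
Proof.
by move=> mu; apply: (@measurable_norm_powR _ _ _ Q); exact: measurable_funTS.
Qed.

Lemma weighted_bound (u : V -> R) (A : R) : measurable_fun setT u ->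
  (\int[lambda]_(y in Q) (`|u y| `^ st)%:E <= A%:E)%E ->
  (\int[lambda]_(y in E) (`|u y| `^ q * v y)%:E <= (A + B + L ^+ n)%:E)%E.
Proof.
move=> mu uA; apply: (@le_trans _ _ (\int[lambda]_(y in Q) (`|u y| `^ q * v y)%:E)%E).
  apply: ge0_subset_integral.
  - exact: mE.
  - exact: mQ.
  - by apply/measurable_EFinP; exact: muqv.
  - by move=> y _; rewrite lee_fin mulr_ge0 ?powR_ge0.
  - exact: EQ.
have := @integral_bound _ _ _ lambda Q (fun y => `|u y| `^ q * v y)
  (fun y => `|u y| `^ st) (fun y => v y `^ beta) 1 1 1 _ _ _ mQ (muqv mu) (must mu) mvb
  (fun y _ => mulr_ge0 (powR_ge0 _ _) (v0 y)) (fun _ _ => powR_ge0 _ _)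
  (fun _ _ => powR_ge0 _ _) ler01 ler01 ler01 _ uA vB lQ.
rewrite !mul1r; apply; apply: nearW => y _.
by have := young (normr_ge0 (u y)) (v0 y) ltr01; rewrite powR1.
Qed.

(** The step that includes the endpoint. The excess [h] of the integrand over t (|u_k - l|^st + 1)
    is dominated by a multiple of v^beta independent of k and tends to 0 almost everywhere; what
    remains has an integral of order t. *)
Lemma weighted_cvg (u : nat -> V -> R) (l : V -> R) (A : R) :
  (forall k, measurable_fun setT (u k)) -> measurable_fun setT l ->
  {ae lambda, forall y, Q y -> u ^~ y @ \oo --> l y} ->
  (forall k, \int[lambda]_(y in Q) (`|u k y| `^ st)%:E <= A%:E)%E ->
  (\int[lambda]_(y in Q) (`|l y| `^ st)%:E <= A%:E)%E /\
  (fun k => \int[lambda]_(y in E) (`|u k y - l y| `^ q * v y)%:E)%E @ \oo --> 0%E.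
Proof.
move=> mu ml ul uA.
have A0 : 0 <= A.
  rewrite -lee_fin; apply: le_trans (uA 0%N).
  by apply: integral_ge0 => y _; rewrite lee_fin powR_ge0.
have lA : (\int[lambda]_(y in Q) (`|l y| `^ st)%:E <= A%:E)%E.
  apply: (fatou_powR mQ sobolev_exponent_ge1 _ _ ul uA).
  - by move=> k; apply: measurable_funTS; exact: mu.
  - exact: measurable_funTS.
split=> //.
pose A3 := 2 `^ st * A + 2 `^ st * A.
have A30 : 0 <= A3 by rewrite addr_ge0// mulr_ge0// powR_ge0.
have md k : measurable_fun setT (fun y => u k y - l y) := measurable_funB (mu k) ml.
have dA k : (\int[lambda]_(y in Q) (`|u k y - l y| `^ st)%:E <= A3%:E)%E.
  have := @integral_bound _ _ _ lambda Q (fun y => `|u k y - l y| `^ st)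
    (fun y => `|u k y| `^ st) (fun y => `|l y| `^ st) (2 `^ st) (2 `^ st) 0 _ _ _ mQ
    (must (md k)) (must (mu k)) (must ml) (fun _ _ => powR_ge0 _ _)
    (fun _ _ => powR_ge0 _ _) (fun _ _ => powR_ge0 _ _) (powR_ge0 _ _) (powR_ge0 _ _)
    (lexx 0) _ (uA k) lA lQ.
  rewrite mul0r addr0; apply; apply: nearW => y _; rewrite ?addr0 -mulrDr.
  apply: le_trans (le_powR2 st0 (normr_ge0 _) (ler_normB _ _)) _.
  exact: powR_addr_le st0 (normr_ge0 _) (normr_ge0 _).
pose f k y := `|u k y - l y| `^ q * v y.
have f0 k y : 0 <= f k y by rewrite mulr_ge0 ?powR_ge0.
have mf k : measurable_fun Q (f k) := muqv (md k).
have fE0 k : (0 <= \int[lambda]_(y in E) (f k y)%:E)%E.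
  by apply: integral_ge0 => y _; rewrite lee_fin.
apply/(cvge0P fE0) => e e0.
(* The excess, at most t for large k, then adds up with t A3 and t L^n to [e]. *)
pose t := e / (1 + A3 + L ^+ n).
have S0 : 0 < 1 + A3 + L ^+ n by rewrite addr_gt0// ltr_pwDl.
have t0 : 0 < t by rewrite divr_gt0.
pose h k y := Num.max (f k y - t * (`|u k y - l y| `^ st + 1)) 0.
have h0 k y : 0 <= h k y by rewrite le_max lexx orbT.
have hf k y : h k y <= f k y.
  by rewrite ge_max f0 andbT gerBl mulr_ge0 ?(ltW t0)// addr_ge0 ?powR_ge0.
have hv k y : h k y <= t `^ (- (beta - 1)) * v y `^ beta.
  rewrite ge_max mulr_ge0 ?powR_ge0// andbT lerBlDr addrC mulrDr mulr1.
  by have := young (normr_ge0 (u k y - l y)) (v0 y) t0; rewrite addrAC.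
have mh k : measurable_fun Q (h k).
  apply: measurable_maxr; last exact: measurable_cst.
  apply: measurable_funB; first exact: mf.
  apply: measurable_funM; first exact: measurable_cst.
  by apply: measurable_funD; [exact: must (md k)|exact: measurable_cst].
have iv : lambda.-integrable Q (fun y => (t `^ (- (beta - 1)) * v y `^ beta)%:E).
  apply: (@eq_integrable _ _ _ lambda Q mQ (fun y => (t `^ (- (beta - 1)))%:E * (v y `^ beta)%:E)%E).
    by move=> y _; rewrite EFinM.
  apply: integrableZl => //; apply/integrableP; split; first exact/measurable_EFinP.
  apply: le_lt_trans (ltry B); apply: le_trans vB.
  rewrite le_eqVlt; apply/orP; left; apply/eqP; apply: eq_integral => y _.
  by rewrite gee0_abs// lee_fin powR_ge0.
have hcv : {ae lambda, forall y, Q y -> (fun k => (h k y)%:E) @ \oo --> (0 : R)%:E}.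
  move: ul; apply: filterS => y H Qy; have {}H := H Qy.
  apply: cvg_EFin; first exact: nearW.
  apply: (squeeze_cvgr (f := fun=> 0) (h := fun k => f k y)).
  - by apply: nearW => k; rewrite /= h0 hf.
  - exact: cvg_cst.
  - have d0 : (fun k => u k y - l y) @ \oo --> 0.
      by rewrite -(subrr (l y)); apply: cvgB; [exact: H|exact: cvg_cst].
    have := cvgM (cvg_norm_powR q1 d0) (cvg_cst (v y)).
    have -> : `|0 : R| `^ q * v y = 0.
      by rewrite normr0 powR0 ?mul0r// gt_eqF// (lt_le_trans _ q1).
    by move=> H1; exact: H1.
have hg : {ae lambda, forall y k, Q y ->
    (`|(h k y)%:E| <= (t `^ (- (beta - 1)) * v y `^ beta)%:E)%E}.
  by apply: nearW => y k _; rewrite gee0_abs lee_fin.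
have [_ _ /=] := @dominated_convergence _ _ _ lambda Q mQ (fun k y => (h k y)%:E) (fun=> 0%:E)
  (fun y => (t `^ (- (beta - 1)) * v y `^ beta)%:E) (fun k => (measurable_EFinP _ _).2 (mh k))
  (measurable_cst _) hcv iv hg.
rewrite integral0 => Hcv.
have hE0 k : (0 <= \int[lambda]_(y in Q) (h k y)%:E)%E.
  by apply: integral_ge0 => y _; rewrite lee_fin.
have [k0 k0P] := (cvge0P hE0).1 Hcv _ t0.
exists k0 => k kk.
apply: (@le_trans _ _ (\int[lambda]_(y in Q) (f k y)%:E)%E).
  apply: ge0_subset_integral.
  - exact: mE.
  - exact: mQ.
  - by apply/measurable_EFinP; exact: mf.
  - by move=> y _; rewrite lee_fin.
  - exact: EQ.
have := @integral_bound _ _ _ lambda Q (f k) (h k)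
  (fun y => `|u k y - l y| `^ st) 1 t t _ _ _ mQ (mf k) (mh k) (must (md k))
  (fun y _ => f0 k y) (fun y _ => h0 k y) (fun _ _ => powR_ge0 _ _)
  ler01 (ltW t0) (ltW t0) _ (k0P k kk) (dA k) lQ.
have -> : 1 * t + t * A3 + t * L ^+ n = e.
  by rewrite mul1r -{1}(mulr1 t) -!mulrDr /t divfK// gt_eqF.
apply; apply: nearW => y _; rewrite mul1r -addrA -[X in _ + (_ + X)](mulr1 t) -mulrDr.
by rewrite -lerBlDr le_max lexx.
Qed.

End weight.

End sobolev_family.

(** * Compact embedding of a space controlled by [sobolev_family] *)

Section embedding.
Context {R : realType} {n : nat} (z : 'rV[R]_n) (L s : R).
Local Notation V := 'rV[R]_n.
Local Notation lambda := (@lebesgue R n).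
Local Notation Q := (cube z L).
Hypotheses (L0 : 0 < L) (n2 : (2 <= n)%N) (s1 : 1 <= s) (sn : s < n%:R).
Local Notation st := (n%:R * s / (n%:R - s)).

Variables (beta q : R) (E : set V) (v : weight R n) (B : R).
Hypotheses (b1 : 1 < beta) (q1 : 1 <= q) (qst : q * (beta / (beta - 1)) <= st).
Hypotheses (mE : measurable E) (EQ : E `<=` Q).
Hypothesis vB : (\int[lambda]_(y in Q) (v y `^ beta)%:E <= B%:E)%E.

Let mQ : measurable Q. Proof. exact: measurable_cube. Qed.
Let lQ : (lambda Q <= (L ^+ n)%:E)%E.
Proof. by have -> : lambda Q = (L ^+ n)%:E := lebesgue_cube z L0. Qed.
Let lE : (lambda E <= (L ^+ n)%:E)%E.
Proof. by apply: le_trans lQ; apply: le_measure; rewrite ?inE//. Qed.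
Let Ln0 : 0 < L ^+ n. Proof. by rewrite exprn_gt0. Qed.
Let st0 : 0 <= st. Proof. exact: le_trans (sobolev_exponent_ge1 s1 sn). Qed.
Let q0 : 0 < q. Proof. exact: lt_le_trans q1. Qed.
Let mv : measurable_fun setT v. Proof. exact: weight_measurable. Qed.
Let v0 x : 0 <= v x. Proof. exact: weight_ge0. Qed.

Let B0 : 0 <= B.
Proof.
rewrite -lee_fin; apply: le_trans vB.
by apply: integral_ge0 => y _; rewrite lee_fin powR_ge0.
Qed.

Lemma integral_mrestr_norm_powR (r : R) (u : V -> R) : measurable_fun setT u ->
  (\int[mrestr (weighted v) mE]_y (`|u y| `^ r)%:E =
   \int[lambda]_(y in E) (`|u y| `^ r * v y)%:E)%E.
Proof.
move=> mu; have mur : measurable_fun setT (fun y => `|u y| `^ r).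
  exact: (@measurable_norm_powR _ _ _ setT).
exact: (ge0_integral_mrestr_weighted v mE mur (fun _ => powR_ge0 _ _)).
Qed.

Lemma LqE_norm_le (r : R) (u : V -> R) (t : R) : 0 < r -> measurable_fun setT u -> 0 <= t ->
  (LqE_norm r (weighted v) mE u <= t%:E)%E =
  (\int[lambda]_(y in E) (`|u y| `^ r * v y)%:E <= (t `^ r)%:E)%E.
Proof.
by move=> r0 mu t0; rewrite -(integral_mrestr_norm_powR r mu); exact: Lnorm_le.
Qed.

Lemma LqEE (r : R) (u : V -> R) : 0 < r ->
  LqE r (weighted v) mE u <-> measurable_fun setT u /\
  (\int[lambda]_(y in E) (`|u y| `^ r * v y)%:E < +oo)%E.
Proof.
move=> r0; rewrite /LqE/=; split=> [/(LfunE _ r0)[mu uoo]|[mu uoo]].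
  by split; [exact: mu|rewrite -(integral_mrestr_norm_powR r mu); exact: uoo].
apply/(LfunE _ r0); split; first exact: mu.
by rewrite (integral_mrestr_norm_powR r mu); exact: uoo.
Qed.

(** [weighted_bound] comes from an additive Young inequality and is not homogeneous; applying it to
    u/N restores the power of [N]. *)
Lemma weighted_bound_homogeneous (C N : R) (u : V -> R) : 0 <= C -> 0 < N ->
  measurable_fun setT u ->
  (\int[lambda]_(y in Q) (`|u y| `^ st)%:E <= (C * N `^ st)%:E)%E ->
  (\int[lambda]_(y in E) (`|u y| `^ q * v y)%:E <= ((C + B + L ^+ n) * N `^ q)%:E)%E.
Proof.
move=> C0 N0 mu uC; have Ni0 : 0 <= N^-1 by rewrite invr_ge0 ltW.
have mun : measurable_fun setT (fun y => N^-1 * u y).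
  by apply: measurable_funM; [exact: measurable_cst|exact: mu].
have z0 D : (\int[lambda]_(y in D) (0 : R)%:E <= (0 : R)%:E)%E by rewrite integral0.
have m0 (D : set V) : measurable_fun D (fun=> 0 : R) := measurable_cst _.
have mst (w : V -> R) : measurable_fun setT w -> measurable_fun Q (fun y => `|w y| `^ st).
  by move=> mw; apply: (@measurable_norm_powR _ _ _ Q); exact: measurable_funTS.
have mqv (w : V -> R) : measurable_fun setT w -> measurable_fun E (fun x => `|w x| `^ q * v x).
  move=> mw; apply: measurable_funM; last exact: measurable_funTS.
  by apply: (@measurable_norm_powR _ _ _ E); exact: measurable_funTS.
have H1 := @integral_bound _ _ _ lambda Q (fun y => `|N^-1 * u y| `^ st)
  (fun y => `|u y| `^ st) (fun=> 0) ((N^-1) `^ st) 0 0 _ _ _ mQ (mst _ mun) (mst _ mu) (m0 _)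
  (fun _ _ => powR_ge0 _ _) (fun _ _ => powR_ge0 _ _) (fun _ _ => lexx 0)
  (powR_ge0 _ _) (lexx 0) (lexx 0) _ uC (z0 Q) lQ.
have NV t : N^-1 `^ t * N `^ t = 1 by rewrite -powRM ?mulVf ?gt_eqF ?powR1// ltW.
have nE y : `|N^-1 * u y| = N^-1 * `|u y| by rewrite normrM ger0_norm.
have {}H1 : (\int[lambda]_(y in Q) (`|N^-1 * u y| `^ st)%:E <= C%:E)%E.
  have -> : C = N^-1 `^ st * (C * N `^ st) + 0 * 0 + 0 * L ^+ n.
    by rewrite !mul0r !addr0 mulrCA NV mulr1.
  by apply: H1; apply: nearW => y _; rewrite mul0r !addr0 nE powRM.
have H2 := weighted_bound L0 b1 q1 qst mE EQ mv v0 vB mun H1.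
have := @integral_bound _ _ _ lambda E (fun y => `|u y| `^ q * v y)
  (fun y => `|N^-1 * u y| `^ q * v y) (fun=> 0) (N `^ q) 0 0 _ _ _ mE (mqv _ mu) (mqv _ mun) (m0 _)
  (fun y _ => mulr_ge0 (powR_ge0 _ _) (v0 y)) (fun y _ => mulr_ge0 (powR_ge0 _ _) (v0 y))
  (fun _ _ => lexx 0) (powR_ge0 _ _) (lexx 0) (lexx 0) _ H2 (z0 E) lE.
have -> : N `^ q * (C + B + L ^+ n) + 0 * 0 + 0 * L ^+ n = (C + B + L ^+ n) * N `^ q.
  by rewrite !mul0r !addr0 mulrC.
apply; apply: nearW => y _; rewrite mul0r !addr0 nE powRM//.
by rewrite !mulrA (mulrC (N `^ q)) NV mul1r.
Qed.

(** A finite norm and membership in [sobolev_family] suffice, so that both embeddings are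
    instances. *)
Lemma compact_embedding_family (X : set (V -> R)) (normX : (V -> R) -> \bar R) (K : R) :
  0 < K -> (forall u, X u -> (0 <= normX u < +oo)%E) ->
  (forall N u, 0 < N -> X u -> (normX u <= N%:E)%E -> sobolev_family z L s K N u) ->
  compact_embedding X (LqE q (weighted v) mE) normX (LqE_norm q (weighted v) mE).
Proof.
move=> K0 X0 XF; have [C C0 CP] := sobolev_family_bound z L0 n2 s1 sn K0.
(* Adding 1 makes the bound positive, since [N] has to be positive. *)
have fX u : X u -> 0 < fine (normX u) + 1 /\ (normX u <= (fine (normX u) + 1)%:E)%E.
  move=> Xu; have /andP[x0 xoo] := X0 u Xu; split; first by rewrite ltr_wpDl// fine_ge0.
  by rewrite EFinD fineK ?ge0_fin_numE// leeDl.
have mu u : X u -> measurable_fun setT u.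
  by move=> Xu; have [f0 fle] := fX u Xu; have [[]] := XF _ u f0 Xu fle.
pose D := C + B + L ^+ n.
have D0 : 0 <= D := addr_ge0 (addr_ge0 C0 B0) (ltW Ln0).
have bd N u : 0 < N -> X u -> (normX u <= N%:E)%E ->
    (\int[lambda]_(y in E) (`|u y| `^ q * v y)%:E <= (D * N `^ q)%:E)%E.
  move=> N0 Xu uN; apply: weighted_bound_homogeneous => //; first exact: mu.
  by apply: CP => //; exact: XF.
pose C3 := D `^ q^-1.
have C30 : 0 <= C3 by exact: powR_ge0.
have nb N u : 0 < N -> X u -> (normX u <= N%:E)%E ->
    (LqE_norm q (weighted v) mE u <= (C3 * N)%:E)%E.
  move=> N0 Xu uN; rewrite LqE_norm_le//; [|exact: mu|by rewrite mulr_ge0// ltW].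
  apply: le_trans (bd N u N0 Xu uN) _.
  by rewrite lee_fin powRM ?(ltW N0)// -powRrM mulVf ?gt_eqF// powRr1.
split; first split.
- move=> u Xu; have [f0 fle] := fX u Xu.
  apply/LqEE => //; split; first exact: mu.
  exact: le_lt_trans (bd _ u f0 Xu fle) (ltry _).
- exists C3 => u Xu; have /andP[x0 xoo] := X0 u Xu.
  have fE : normX u = (fine (normX u))%:E by rewrite fineK// ge0_fin_numE.
  have [f0|f0] := ltrP 0 (fine (normX u)).
    by rewrite fE -EFinM; apply: nb => //; rewrite -fE.
  (* A function of norm 0 satisfies the estimate for every positive [N]; here N = e/(C3 + 1) makes
     the target norm at most [e]. *)
  have nX0 : normX u = 0%E.
    by rewrite fE; congr EFin; apply/eqP; rewrite eq_le f0 fine_ge0.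
  rewrite nX0 mule0; apply/lee_addgt0Pr => e e0; rewrite add0e.
  have C31 : 0 < C3 + 1 by rewrite ltr_wpDl.
  apply: le_trans (nb (e / (C3 + 1)) u _ Xu _) _.
  + by rewrite divr_gt0.
  + by rewrite nX0 lee_fin ltW// divr_gt0.
  + rewrite lee_fin mulrCA ger_pMr// ler_pdivrMr// mul1r lerDl//.
- move=> u Xu [C' uC']; pose N := Num.max C' 1.
  have N0 : 0 < N by rewrite lt_max ltr01 orbT.
  have uN k : (normX (u k) <= N%:E)%E.
    by apply: le_trans (uC' k) _; rewrite lee_fin le_max lexx.
  have uF k : sobolev_family z L s K N (u k) by exact: XF.
  have [sg [l [sg_homo ml ul]]] := sobolev_family_rellich L0 n2 s1 sn K0 N0 uF.
  have uA k := CP N (u (sg k)) N0 (uF (sg k)).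
  have muk k : measurable_fun setT (u (sg k)) := mu _ (Xu _).
  have [lA cv] := weighted_cvg L0 s1 sn b1 q1 qst mE EQ mv v0 vB muk ml ul uA.
  exists sg, l; split; first exact: sg_homo.
    apply/LqEE => //; split; first exact: ml.
    exact: le_lt_trans (weighted_bound L0 b1 q1 qst mE EQ mv v0 vB ml lA) (ltry _).
  have f0 k : (0 <= \int[lambda]_(y in E) (`|u (sg k) y - l y| `^ q * v y)%:E)%E.
    by apply: integral_ge0 => y _; rewrite lee_fin mulr_ge0// powR_ge0.
  have n0 k : (0 <= LqE_norm q (weighted v) mE (u (sg k) \- l)%R)%E by exact: Lnorm_ge0.
  apply/(cvge0P n0) => e e0.
  have [k0 k0P] := (cvge0P f0).1 cv _ (powR_gt0 q e0).
  exists k0 => k kk.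
  have mdk : measurable_fun setT (u (sg k) \- l) by exact: measurable_funB (muk k) ml.
  by rewrite (LqE_norm_le q0 mdk (ltW e0)); exact: k0P.
Qed.

End embedding.

(** * The two function spaces as Sobolev families *)

Section families.
Context {R : realType} {n : nat} (z : 'rV[R]_n) (L alpha p : R).
Local Notation V := 'rV[R]_n.
Local Notation lambda := (@lebesgue R n).
Local Notation Q := (cube z L).
Local Notation s := (p * alpha / (1 + alpha)).
Local Notation st := (n%:R * s / (n%:R - s)).
Variables (w : weight R n) (W : R).
Hypotheses (L0 : 0 < L) (n2 : (2 <= n)%N) (s1 : 1 <= s) (sn : s < n%:R).
Hypotheses (al0 : 0 < alpha) (p0 : 0 < p).
Hypothesis wW : (\int[lambda]_(y in Q) (w y `^ (- alpha))%:E <= W%:E)%E.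

Let mQ : measurable Q. Proof. exact: measurable_cube. Qed.
Let lQ : (lambda Q <= (L ^+ n)%:E)%E.
Proof. by have -> : lambda Q = (L ^+ n)%:E := lebesgue_cube z L0. Qed.
Let Ln0 : 0 < L ^+ n. Proof. by rewrite exprn_gt0. Qed.
Let mw : measurable_fun setT w. Proof. exact: weight_measurable. Qed.
Let w0 x : 0 <= w x. Proof. exact: weight_ge0. Qed.
Let W0 : 0 <= W.
Proof.
rewrite -lee_fin; apply: le_trans wW.
by apply: integral_ge0 => y _; rewrite lee_fin powR_ge0.
Qed.
Let zero_le D : (\int[lambda]_(y in D) (0 : R)%:E <= (0 : R)%:E)%E.
Proof. by rewrite integral0. Qed.
Let m0 (D : set V) : measurable_fun D (fun=> 0 : R).
Proof. exact: measurable_cst. Qed.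
Let mpow (f : V -> R) (t : R) (D : set V) : measurable_fun setT f ->
  measurable_fun D (fun y => `|f y| `^ t).
Proof.
by move=> mf; apply: (@measurable_norm_powR _ _ _ D); exact: measurable_funTS.
Qed.
Let mpoww (f : V -> R) (t : R) (v : weight R n) (D : set V) : measurable_fun setT f ->
  measurable_fun D (fun y => `|f y| `^ t * v y).
Proof.
move=> mf; apply: measurable_funM; first exact: mpow.
by apply: measurable_funTS; exact: weight_measurable.
Qed.

Lemma Lnorm_cube_bound (f : V -> R) (N : R) : 0 <= N -> measurable_fun setT f ->
  ('N[weighted w]_p%:E[EFin \o f] <= N%:E)%E ->
  (\int[lambda]_(y in Q) (`|f y| `^ p * w y)%:E <= (N `^ p)%:E)%E.
Proof.
move=> N0 mf; rewrite (Lnorm_le _ p0)// => H; apply: le_trans H.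
have mfp : measurable_fun setT (fun y => `|f y| `^ p) := mpow p mf.
rewrite (ge0_integral_weighted w mfp (fun _ => powR_ge0 _ _)).
apply: ge0_subset_integral.
- exact: mQ.
- exact: measurableT.
- by apply/measurable_EFinP; exact: mpoww.
- by move=> y _; rewrite lee_fin mulr_ge0 ?powR_ge0.
- by [].
Qed.

(** [powR_weight_young] is applied to |g|/N for homogeneity. The comparison of [f] with [g] serves
    for a component of the gradient and its length. *)
Lemma weighted_young_integral (f g : V -> R) (N : R) : 0 < N ->
  measurable_fun setT f -> measurable_fun setT g ->
  (forall y, `|f y| <= `|g y|) ->
  (\int[lambda]_(y in Q) (`|g y| `^ p * w y)%:E <= (N `^ p)%:E)%E ->
  (\int[lambda]_(y in Q) (`|f y| `^ s)%:E <= ((1 + W) * N `^ s)%:E)%E.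
Proof.
move=> N0 mf mg fg gN; have N0' := ltW N0.
have s0 : 0 <= s by exact: le_trans s1.
have mwa : measurable_fun Q (fun y => w y `^ (- alpha)).
  by apply: measurable_funTS; apply: (measurableT_comp (measurable_powR (- alpha))).
have NE t : N `^ t * N `^ (- t) = 1.
  by rewrite powRN divff// gt_eqF// powR_gt0.
have := @integral_bound _ _ _ lambda Q (fun y => `|f y| `^ s)
  (fun y => `|g y| `^ p * w y) (fun y => w y `^ (- alpha)) (N `^ s * N `^ (- p)) (N `^ s) 0
  _ _ _ mQ (mpow s mf) (mpoww p w mg) mwa (fun _ _ => powR_ge0 _ _)
  (fun y _ => mulr_ge0 (powR_ge0 _ _) (w0 y)) (fun _ _ => powR_ge0 _ _)
  (mulr_ge0 (powR_ge0 _ _) (powR_ge0 _ _)) (powR_ge0 _ _) (lexx 0) _ gN wW lQ.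
have -> : N `^ s * N `^ (- p) * N `^ p + N `^ s * W + 0 * L ^+ n = (1 + W) * N `^ s.
  by rewrite -mulrA [N `^ (- p) * _]mulrC NE mul0r; ring.
apply; have := weight_gt0 w; apply: filterS => y wy _.
have gn0 : 0 <= `|g y| * N^-1 by rewrite mulr_ge0// invr_ge0.
have fy : `|f y| `^ s <= N `^ s * (`|g y| * N^-1) `^ s.
  by rewrite -powRM// mulrCA divff ?gt_eqF// mulr1 le_powR2.
apply: le_trans fy _; rewrite addr0 -(mulrA (N `^ s)) -mulrDr; apply: ler_wpM2l; first exact: powR_ge0.
apply: le_trans (powR_weight_young p al0 gn0 wy) _.
have -> : (`|g y| * N^-1) `^ p = N `^ (- p) * `|g y| `^ p.
  by rewrite powRM ?invr_ge0// powRV// powRN mulrC.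
by rewrite mulrA.
Qed.

Lemma weak_gradP (u : V -> R) : weakly_differentiable u -> is_weak_grad u (weak_grad u).
Proof. by move=> [_ [g ug]]; rewrite /weak_grad; apply: xgetPex; exists g. Qed.

Lemma weak_grad_le_abs (u : V -> R) y i : `|weak_grad u y ord0 i| <= `|abs_grad u y|.
Proof.
rewrite [leRHS]ger0_norm ?sqrtr_ge0// -sqrtr_sqr ler_wsqrtr// (bigD1 i)//= lerDl.
by apply: sumr_ge0 => j _; rewrite sqr_ge0.
Qed.

Lemma grad_energy_bound (u : V -> R) (N : R) : 0 < N -> weakly_differentiable u ->
  measurable_fun setT (abs_grad u) ->
  ('N[weighted w]_p%:E[EFin \o abs_grad u] <= N%:E)%E ->
  (\sum_(i < n) \int[lambda]_(y in Q) (`|weak_grad u y ord0 i| `^ s)%:E <=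
   (n%:R * (1 + W) * N `^ s)%:E)%E.
Proof.
move=> N0 uw mG GN; have ug := weak_gradP uw.
apply: (@le_trans _ _ (\sum_(i < n) ((1 + W) * N `^ s)%:E)%E).
  apply: lee_sum => i _; have [[mgi _] _] := ug i.
  apply: (weighted_young_integral N0 mgi mG) => [y|]; first exact: weak_grad_le_abs.
  exact: Lnorm_cube_bound (ltW N0) mG GN.
by rewrite sumEFin lee_fin sumr_const card_ord -[leLHS]mulr_natl mulrA.
Qed.

Lemma cube_mean_le (u : V -> R) (A : R) : L1loc lambda u ->
  (\int[lambda]_(y in Q) `|u y|%:E <= A%:E)%E -> `|cube_mean z L u| <= A / L ^+ n.
Proof.
move=> lu uA; rewrite /cube_mean normrM normfV (gtr0_norm Ln0) ler_pM2r ?invr_gt0//.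
have iu := L1loc_integrable_cube z L lu.
rewrite -lee_fin (EFin_normr_Rintegral mQ iu).
exact: le_trans (le_abse_integral lambda mQ (measurable_int _ iu)) uA.
Qed.

(** The mean over [Q] is bounded through the L^s norm of [u], obtained in the same way as that of
    the gradient. *)
Lemma W1p_family : exists2 K, 0 < K & forall N u, 0 < N -> W1p p (weighted w) u ->
  (W1p_norm p (weighted w) u <= N%:E)%E -> sobolev_family z L s K N u.
Proof.
have n0 : 0 < n%:R :> R by rewrite ltr0n (leq_trans _ n2).
have W1 : 0 < 1 + W by rewrite ltr_pwDl.
have K1 : 0 < n%:R * (1 + W) by rewrite mulr_gt0.
have K2 : 0 < (1 + W + L ^+ n) / L ^+ n by rewrite divr_gt0// addr_gt0.
exists (n%:R * (1 + W) + (1 + W + L ^+ n) / L ^+ n); first by rewrite addr_gt0.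
move=> N u N0 [uw uL gL] uN; have N0' := ltW N0.
have /(LfunE _ p0)[mu _] := uL; have /(LfunE _ p0)[mG _] := gL.
have [lu _] := uw.
have uN1 : ('N[weighted w]_p%:E[EFin \o u] <= N%:E)%E.
  by apply: le_trans uN; rewrite leeDl// Lnorm_ge0.
have uN2 : ('N[weighted w]_p%:E[EFin \o abs_grad u] <= N%:E)%E.
  by apply: le_trans uN; rewrite leeDr// Lnorm_ge0.
split; first exact: lu.
exists (weak_grad u); split; first exact: weak_gradP.
  apply: le_trans (grad_energy_bound N0 uw mG uN2) _.
  by rewrite lee_fin ler_wpM2r ?powR_ge0// lerDl ltW.
have us := weighted_young_integral N0 mu mu (fun _ => lexx _) (Lnorm_cube_bound N0' mu uN1).
have mnu : measurable_fun Q (fun y => `|u y|).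
  by apply: measurableT_comp; exact: measurable_funTS.
have uA : (\int[lambda]_(y in Q) `|u y|%:E <= (N * (1 + W) + N * L ^+ n)%:E)%E.
  have := @integral_bound _ _ _ lambda Q (fun y => `|u y|)
    (fun y => `|u y| `^ s) (fun=> 0) (N * N^-1 `^ s) 0 N _ _ _ mQ mnu (mpow s mu) (@m0 Q)
    (fun _ _ => normr_ge0 _) (fun _ _ => powR_ge0 _ _) (fun _ _ => lexx 0)
    (mulr_ge0 N0' (powR_ge0 _ _)) (lexx 0) N0' _ us (zero_le Q) lQ.
  have -> : N * N^-1 `^ s * ((1 + W) * N `^ s) + 0 * 0 + N * L ^+ n =
      N * (1 + W) + N * L ^+ n.
    have NV : N^-1 `^ s * N `^ s = 1 by rewrite -powRM ?invr_ge0// mulVf ?powR1// gt_eqF.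
    by rewrite mul0r addr0 mulrACA NV mulr1.
  apply; apply: nearW => y _; have Ni0 : 0 <= N^-1 by rewrite invr_ge0.
  rewrite mul0r addr0 -(mulrA N) -(powRM s Ni0 (normr_ge0 _)).
  have x0 : 0 <= N^-1 * `|u y| by rewrite mulr_ge0// invr_ge0.
  have := ler_wpM2l N0' (powR_le1D ler01 s1 x0).
  by rewrite powRr1// mulrA divff ?gt_eqF// mul1r mulrDr mulr1 [N + _]addrC.
apply: le_trans (cube_mean_le lu uA) _.
rewrite -mulrDr -mulrA mulrC ler_wpM2r// lerDr ltW//.
Qed.

Section Dp.
Variables (beta : R) (E : set V) (v : weight R n) (B k : R).
Hypotheses (b1 : 1 < beta) (bst : 1 * (beta / (beta - 1)) <= st).
Hypotheses (mE : measurable E) (EQ : E `<=` Q).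
Hypothesis vB : (\int[lambda]_(y in Q) (v y `^ beta)%:E <= B%:E)%E.
Hypotheses (k0 : 0 < k) (kE : (k%:E <= \int[lambda]_(y in E) (v y)%:E)%E).

Let lE : (lambda E <= (L ^+ n)%:E)%E.
Proof. by apply: le_trans lQ; apply: le_measure; rewrite ?inE. Qed.

(** The oscillation u - m is bounded in L^1(E, nu) by Sobolev-Poincaré and the weighted estimate for
    exponent 1, and [u] by its norm. Hence |m| nu(E) is bounded, and [k] is a positive lower bound
    of nu(E). *)
Lemma Dp_family : exists2 K, 0 < K & forall N u, 0 < N ->
  (Dp p (weighted w) `&` LqE 1 (weighted v) mE) u ->
  (DpL1_norm p (weighted w) (weighted v) mE u <= N%:E)%E -> sobolev_family z L s K N u.
Proof.
have n0 : 0 < n%:R :> R by rewrite ltr0n (leq_trans _ n2).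
have W1 : 0 < 1 + W by rewrite ltr_pwDl.
have B0 : 0 <= B.
  rewrite -lee_fin; apply: le_trans vB.
  by apply: integral_ge0 => y _; rewrite lee_fin powR_ge0.
have K1 : 0 < n%:R * (1 + W) by rewrite mulr_gt0.
have [C C0 CP] := sobolev_family_poincare z L0 n2 s1 sn K1.
pose D := C + B + L ^+ n.
have D0 : 0 <= D := addr_ge0 (addr_ge0 C0 B0) (ltW Ln0).
have K2 : 0 < (D + 1) / k by rewrite divr_gt0// ltr_wpDl.
exists (n%:R * (1 + W) + (D + 1) / k); first by rewrite addr_gt0.
move=> N u N0 [[uw lum gL] uL] uN; have N0' := ltW N0.
have /(LfunE _ p0)[mG _] := gL.
have [lu _] := uw; have [mu _] := lu.
have uN1 : (LqE_norm 1 (weighted v) mE u <= N%:E)%E.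
  by apply: le_trans uN; rewrite leeDr// Lnorm_ge0.
have uN2 : ('N[weighted w]_p%:E[EFin \o abs_grad u] <= N%:E)%E.
  by apply: le_trans uN; rewrite leeDl// Lnorm_ge0.
have ug := weak_gradP uw; have gK := grad_energy_bound N0 uw mG uN2.
split; first exact: lu.
exists (weak_grad u); split; first exact: ug.
  by apply: le_trans gK _; rewrite lee_fin ler_wpM2r ?powR_ge0// lerDl ltW.
set m := cube_mean z L u.
have I1 := CP N u _ N0 lu ug gK.
have mum : measurable_fun setT (fun y => u y - m).
  by apply: measurable_funB; [exact: mu|exact: measurable_cst].
have I2 := weighted_bound_homogeneous L0 b1 (lexx 1) bst mE EQ vB C0 N0 mum I1.
rewrite -/D in I2.
have I3 : (\int[lambda]_(y in E) (`|u y| `^ 1 * v y)%:E <= (N `^ 1)%:E)%E.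
  by rewrite -LqE_norm_le.
have mmv : measurable_fun E (fun y => `|m| * v y).
  apply: measurable_funM; first exact: measurable_cst.
  by apply: measurable_funTS; exact: weight_measurable.
have v0 y : 0 <= v y by exact: weight_ge0.
have := @integral_bound _ _ _ lambda E (fun y => `|m| * v y)
  (fun y => `|u y - m| `^ 1 * v y) (fun y => `|u y| `^ 1 * v y) 1 1 0 _ _ _ mE mmv
  (mpoww 1 v mum) (mpoww 1 v mu) (fun y _ => mulr_ge0 (normr_ge0 _) (v0 y))
  (fun y _ => mulr_ge0 (powR_ge0 _ _) (v0 y)) (fun y _ => mulr_ge0 (powR_ge0 _ _) (v0 y))
  ler01 ler01 (lexx 0) _ I2 I3 lE.
rewrite !mul1r mul0r addr0 !powRr1// => H.
have {}H : (\int[lambda]_(y in E) (`|m| * v y)%:E <= (D * N + N)%:E)%E.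
  apply: H; apply: nearW => y _; rewrite ?mul1r ?addr0 !powRr1// -mulrDl ler_wpM2r//.
  by rewrite -{1}(subKr (u y) m) (le_trans (ler_normB _ _))// addrC distrC.
have H1 : ((`|m| * k)%:E <= \int[lambda]_(y in E) (`|m| * v y)%:E)%E.
  have mvE : measurable_fun E (EFin \o v).
    by apply/measurable_EFinP; apply: measurable_funTS; exact: weight_measurable.
  rewrite EFinM; apply: le_trans (lee_wpmul2l _ kE) _; first by rewrite lee_fin.
  have v0E y : E y -> (0 <= (EFin \o v) y)%E by move=> _; rewrite lee_fin.
  rewrite -(ge0_integralZl_EFin lambda mE v0E mvE (normr_ge0 m)).
  by rewrite le_eqVlt; apply/orP; left; apply/eqP; apply: eq_integral => y _.
have := le_trans H1 H; rewrite lee_fin -ler_pdivlMr// => /le_trans; apply.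
have -> : (D * N + N) / k = (D + 1) / k * N.
  by rewrite -{2}(mul1r N) -mulrDl mulrAC.
by rewrite ler_wpM2r// lerDr ltW.
Qed.

End Dp.

End families.

Lemma bounded_sub_cube (R : realType) (n : nat) (E : set 'rV[R]_n) : bounded_set E ->
  exists (z : 'rV[R]_n) (L : R), 0 < L /\ E `<=` cube z L.
Proof.
move=> [M [_ EM]]; pose B := Num.max M 0 + 1.
have B0 : 0 < B by rewrite ltr_wpDl// le_max lexx orbT.
have MB : M < B by rewrite ltr_pwDr// le_max lexx.
(* The margin of 1 gives the strict lower inequality of the half-open cube. *)
exists (const_mx (- (B + 1))), (2 * (B + 1)); split; first by rewrite mulr_gt0// addr_gt0.
move=> x Ex; rewrite cubeE => i; rewrite !mxE.
have /ler_normlP[h1 h2] : `|x ord0 i| <= B.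
  apply: le_trans (EM _ MB x Ex); rewrite [leRHS]mx_normrE.
  by apply: (le_bigmax _ (fun ij : 'I_1 * 'I_n => `|x ij.1 ij.2|) (ord0, i)).
by apply/andP; split; lra.
Qed.

(** * The set E: the null case and its weighted mass *)

Section null_domain.
Context {R : realType} {n : nat}.
Local Notation V := 'rV[R]_n.
Local Notation lambda := (@lebesgue R n).
Variables (E : set V) (mE : measurable E) (v : weight R n) (q : R).

Let mint (u : V -> R) (D : set V) : measurable_fun setT u ->
  measurable_fun D (fun y => (`|u y| `^ q * v y)%:E).
Proof.
move=> mu; apply/measurable_EFinP; apply: measurable_funM.
  by apply: (@measurable_norm_powR _ _ _ D); exact: measurable_funTS.
by apply: measurable_funTS; exact: weight_measurable.
Qed.

(** All target norms vanish, so a sequence converges to its first term. *)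
Lemma compact_embedding_null (X : set (V -> R)) normX : 0 < q -> lambda E = 0%E ->
  (forall u, X u -> measurable_fun setT u) -> (forall u, X u -> (0 <= normX u)%E) ->
  compact_embedding X (LqE q (weighted v) mE) normX (LqE_norm q (weighted v) mE).
Proof.
move=> q0 E0 mX X0.
have int0 (u : V -> R) : measurable_fun setT u -> (\int[lambda]_(y in E) (`|u y| `^ q * v y)%:E = 0)%E.
  by move=> mu; exact: (null_set_integral mE (mint mu) E0).
have Y (u : V -> R) : measurable_fun setT u -> LqE q (weighted v) mE u.
  by move=> mu; apply/(LqEE v mE u q0); split; [exact: mu|rewrite int0].
have Y0 (u : V -> R) : measurable_fun setT u -> LqE_norm q (weighted v) mE u = 0%E.
  move=> mu; apply/eqP; rewrite eq_le Lnorm_ge0 andbT.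
  by rewrite (LqE_norm_le v mE q0 mu (lexx 0)) int0// lee_fin powR_ge0.
split; first split.
- by move=> u Xu; apply: Y; exact: mX.
- by exists 0 => u Xu; rewrite mul0e Y0 ?lexx//; exact: mX.
- move=> u Xu _; exists id, (u 0%N); split; first by move=> i j.
    by apply: Y; exact: mX.
  have -> : (fun k => LqE_norm q (weighted v) mE (u (id k) \- u 0%N)) = (fun=> 0%E).
    by apply/funext => k; apply: Y0; apply: measurable_funB; exact: mX.
  exact: cvg_cst.
Qed.

(** Since v > 0 almost everywhere, a zero integral would make [E] null. *)
Lemma weight_mass_gt0 : lambda E != 0%E ->
  exists2 k : R, 0 < k & (k%:E <= \int[lambda]_(y in E) (v y)%:E)%E.
Proof.
move=> E0; set I := (\int[lambda]_(y in E) _)%E.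
have v0 y : (0 <= (v y)%:E)%E by rewrite lee_fin weight_ge0.
have I0 : (0 <= I)%E by apply: integral_ge0.
have mv : measurable_fun E (EFin \o v).
  by apply/measurable_EFinP; apply: measurable_funTS; exact: weight_measurable.
have [Ie|Ine] := eqVneq I 0%E; last first.
  have [Ioo|Ioo] := eqVneq I +oo%E; first by exists 1 => //; rewrite Ioo leey.
  have Ifin : I \is a fin_num by rewrite ge0_fin_numE// ltey.
  by exists (fine I); [apply: fine_gt0; rewrite lt0e Ine I0 ltey Ioo|rewrite fineK].
have H : (\int[lambda]_(y in E) `|(EFin \o v) y| = 0)%E.
  transitivity I; last exact: Ie.
  by apply: eq_integral => y _; exact: gee0_abs (v0 y).
have v_ae := (ae_eq_integral_abs lambda mE mv).1 H.
have : {ae lambda, forall y, ~ E y}.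
  have vpos := weight_gt0 v; move: v_ae vpos; rewrite /ae_eq; apply: filterS2 => y Hy vy Ey.
  by have /= [vy0] := Hy Ey; rewrite vy0 ltxx in vy.
move=> [N [mN N0 EN]]; case/eqP: E0; apply/eqP; rewrite eq_le measure_ge0 andbT -N0.
apply: le_measure; rewrite ?inE// => y Ey; apply: EN => /=; exact.
Qed.

End null_domain.

(** * The exponents and the two embeddings *)

Theorem theorem3p1 (R : realType) (n : nat) (w v : weight R n)
    (alpha beta p : R) :
  0 < alpha -> 1 < beta ->
  L1loc lebesgue w ->
  L1loc lebesgue (fun x => w x `^ (- alpha)) ->
  L1loc lebesgue (fun x => v x `^ beta) ->
  Num.max (n%:R * (alpha^-1 + beta^-1)) (1 + alpha^-1) <= p ->
  p < n%:R * (1 + alpha^-1) ->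
  forall (E : set 'rV[R]_n) (mE : measurable E), bounded_set E ->
  forall q : R, 1 <= q ->
    q <= n%:R * p * (1 - beta^-1) / ((n%:R - p) + n%:R / alpha) ->
    compact_embedding (W1p p (weighted w)) (LqE q (weighted v) mE)
      (W1p_norm p (weighted w)) (LqE_norm q (weighted v) mE) /\
    compact_embedding (Dp p (weighted w) `&` LqE 1 (weighted v) mE)
      (LqE q (weighted v) mE)
      (DpL1_norm p (weighted w) (weighted v) mE)
      (LqE_norm q (weighted v) mE).
Proof.
move=> al0 b1 _ lw lv; rewrite ge_max => /andP[_ p1] pn E mE bE q q1 qle.
have [z [L [L0 EQ]]] := bounded_sub_cube bE.
have ali : 0 < alpha^-1 by rewrite invr_gt0.
have p0 : 0 < p by rewrite (lt_le_trans _ p1)// addr_gt0.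
have q0 : 0 < q by rewrite (lt_le_trans _ q1).
have al1 : 0 < 1 + alpha by rewrite addr_gt0.
(* The exponent of the unweighted Sobolev space: s >= 1 amounts to 1 + 1/alpha <= p, and s < n to p
   < n (1 + 1/alpha). *)
pose s := p * alpha / (1 + alpha).
have s1 : 1 <= s.
  rewrite /s ler_pdivlMr// mul1r.
  have : (1 + alpha^-1) * alpha <= p * alpha by rewrite ler_pM2r.
  by rewrite mulrDl mul1r mulVf ?gt_eqF// addrC.
have sn : s < n%:R.
  rewrite /s ltr_pdivrMr//.
  have : p * alpha < n%:R * (1 + alpha^-1) * alpha by rewrite ltr_pM2r.
  by rewrite -mulrA mulrDl mul1r mulVf ?gt_eqF// (addrC alpha).
have n2 : (2 <= n)%N by rewrite -(ltr_nat R) (le_lt_trans s1 sn).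
have ns0 : 0 < n%:R - s by rewrite subr_gt0.
have b10 : 0 < beta - 1 by rewrite subr_gt0.
have b0 : 0 < beta by rewrite (lt_trans _ b1).
(* This is the bound on [q]: its right side equals n s / (n - s) times (beta - 1)/beta. *)
have qst : q * (beta / (beta - 1)) <= n%:R * s / (n%:R - s).
  rewrite mulrA ler_pdivrMr// -ler_pdivlMr//; apply: le_trans qle _.
  rewrite le_eqVlt; apply/orP; left; apply/eqP.
  have D1 : n%:R * (1 + alpha) - p * alpha != 0.
    rewrite gt_eqF// subr_gt0; move: sn; rewrite /s ltr_pdivrMr//.
  have D2 : n%:R - p + n%:R / alpha = (n%:R * (1 + alpha) - p * alpha) / alpha.
    by field; rewrite gt_eqF.
  have D3 : n%:R - s = (n%:R * (1 + alpha) - p * alpha) / (1 + alpha).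
    by rewrite /s; field; rewrite gt_eqF.
  rewrite D2 D3 /s; field.
  by rewrite D1 !gt_eqF.
have bst : 1 * (beta / (beta - 1)) <= n%:R * s / (n%:R - s).
  by apply: le_trans qst; rewrite ler_wpM2r// ltW// divr_gt0.
have cube_fin (f : 'rV[R]_n -> R) : (forall x, 0 <= f x) -> L1loc lebesgue f ->
    exists B : R, (\int[@lebesgue R n]_(y in cube z L) (f y)%:E <= B%:E)%E.
  move=> f0 lf; have /integrableP[_ foo] := L1loc_integrable_cube z L lf.
  exists (fine (\int[@lebesgue R n]_(y in cube z L) (f y)%:E)%E); rewrite fineK//.
  rewrite ge0_fin_numE; last by apply: integral_ge0 => y _; rewrite lee_fin.
  apply: le_lt_trans foo; rewrite le_eqVlt; apply/orP; left; apply/eqP.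
  by apply: eq_integral => y _; rewrite /= ger0_norm.
have [W wW] := cube_fin _ (fun x => powR_ge0 _ _) lw.
have [B vB] := cube_fin _ (fun x => powR_ge0 _ _) lv.
have W1p_fin u : W1p p (weighted w) u -> (0 <= W1p_norm p (weighted w) u < +oo)%E.
  move=> [_ uL gL]; rewrite adde_ge0 ?Lnorm_ge0//=.
  by apply: lte_add_pinfty; [have /andP[_] := uL|have /andP[_] := gL]; rewrite inE.
have Dp_fin u : (Dp p (weighted w) `&` LqE 1 (weighted v) mE) u ->
    (0 <= DpL1_norm p (weighted w) (weighted v) mE u < +oo)%E.
  move=> [[_ _ gL] uL]; rewrite adde_ge0 ?Lnorm_ge0//=.
  by apply: lte_add_pinfty; [have /andP[_] := gL|have /andP[_] := uL]; rewrite inE.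
split.
  have [K K0 KP] := W1p_family L0 n2 s1 al0 p0 wW.
  exact: (compact_embedding_family L0 n2 s1 sn b1 q1 qst mE EQ vB K0 W1p_fin KP).
(* On a null [E] the L^1(E, nu) norm says nothing about the mean, so this case is treated apart. *)
have [E0|E0] := eqVneq (@lebesgue R n E) 0%E.
  apply: (compact_embedding_null mE v q0 E0) => u Xu; last by have /andP[] := Dp_fin u Xu.
  by have [[[[mu _] _] _ _] _] := Xu.
have [k k0 kE] := weight_mass_gt0 mE v E0.
have [K K0 KP] := Dp_family L0 n2 s1 sn al0 p0 wW b1 bst mE EQ vB k0 kE.
exact: (compact_embedding_family L0 n2 s1 sn b1 q1 qst mE EQ vB K0 Dp_fin KP).
Qed.
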